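(* Let $0<\alpha\le1$ and $\lambda>1$. For $f$ in a generic subset of $\mathcal{F}_\lambda(\alpha)$, in the $C^{1+\alpha}$-topology, there exists a unique $f$-invariant Lyapunov maximizing measure $\mu_f$. Moreover, the support of $\mu_f$ is uniquely ergodic.
   Context: $\mathcal{F}_\lambda(\alpha)$ is the class of $C^{1+\alpha}$ endomorphisms $f:S^1\to S^1$ of the circle ($C^1$ maps whose derivative is $\alpha$-Hölder) which are coverings of degree 2, orientation preserving, and expanding with $f'(x)>\lambda$ for all $x\in S^1$. It is given the $C^{1+\alpha}$-topology, induced by the norm $\|f\|_{1+\alpha}=\|f\|_{C^1}+\mathrm{Hold}_\alpha(f')$, where $\mathrm{Hold}_\alpha(g)=\sup_{0<d(x,y)\le1}|g(x)-g(y)|/d(x,y)^\alpha$. An $f$-invariant Borel probability is a Lyapunov maximizing measure if it maximizes $\int\log f'\,d\nu$ among all $f$-invariant Borel probabilities $\nu$. A set is generic if it contains a countable intersection of open dense subsets. A closed forward invariant set is uniquely ergodic if it supports exactly one $f$-invariant Borel probability. *)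

(* Defs.v *)
From HB Require Import structures.
From mathcomp Require Import all_boot all_order all_algebra.
From mathcomp Require Import generic_quotient ring_quotient.
From mathcomp Require Import all_classical all_reals all_analysis.

Set Implicit Arguments.
Unset Strict Implicit.
Unset Printing Implicit Defensive.

Import Order.TTheory GRing.Theory Num.Theory.
Import numFieldNormedType.Exports.

Local Open Scope classical_set_scope.
Local Open Scope ring_scope.
Local Open Scope quotient_scope.

(* The subgroup Z of R; [int_num_subdef] is the predicate behind [Num.int]. *)
Definition integers (R : realType) : zmodClosed R :=
  GRing.ZmodClosed.clone R (@Num.int_num_subdef R) _.

(* S^1 = R / Z, with the quotient group structure and the quotient topology. *)
Definition circle (R : realType) : Type :=
  quotient_topology (Quotient.quot (integers R)).

HB.instance Definition _ (R : realType) :=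
  PointedTopological.copy (circle R)
    (quotient_topology (Quotient.quot (integers R))).
HB.instance Definition _ (R : realType) :=
  GRing.isZmodule.Build (circle R)
    (@Quotient.addqA R (integers R)) (@Quotient.addqC R (integers R))
    (@Quotient.add0q R (integers R)) (@Quotient.addNq R (integers R)).

Section Circle.
Variable R : realType.

Definition cpi (t : R) : circle R :=
  \pi_(Quotient.quot (integers R)) t.

(* The representative of x in [-1/2, 1/2[; it does not depend on [repr x]. *)
Definition cval (x : circle R) : R :=
  let t : R := repr (x : Quotient.quot (integers R)) in
  t - (Num.floor (t + 2^-1))%:~R.

Definition cdist (x y : circle R) : R := `|cval (x - y)|.

End Circle.

Section CircleMaps.
Variable R : realType.
Implicit Types (f : circle R -> circle R) (phi : circle R -> R).

(* f read in the charts h |-> x + h at x and y |-> cval (y - f x) at f x *)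
Definition local_expr f (x : circle R) : R -> R :=
  fun h => cval (f (x + cpi h) - f x).

Definition cderiv f (x : circle R) : R := derive1 (local_expr f x) 0.

Definition C1_map f :=
  (forall x, derivable (local_expr f x) 0 1) /\ continuous (cderiv f).

Definition rlocal_expr phi (x : circle R) : R -> R := fun h => phi (x + cpi h).

Definition rderiv phi (x : circle R) : R := derive1 (rlocal_expr phi x) 0.

Definition C1_fun phi :=
  (forall x, derivable (rlocal_expr phi x) 0 1) /\ continuous (rderiv phi).

Definition Hold (alpha : R) (g : circle R -> R) : \bar R :=
  ereal_sup [set r | exists x y, 0 < cdist x y <= 1 /\
                       r = (`|g x - g y| / cdist x y `^ alpha)%:E].

Definition norm_C1 phi : \bar R :=
  (ereal_sup [set (`|phi x|)%:E | x in [set: circle R]] +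
   ereal_sup [set (`|rderiv phi x|)%:E | x in [set: circle R]])%E.

Definition norm_C1alpha (alpha : R) phi : \bar R :=
  (norm_C1 phi + Hold alpha (rderiv phi))%E.

End CircleMaps.

Definition homeo_between (T : topologicalType) (f : T -> T) (U V : set T) :=
  exists g : T -> T,
    [/\ {within U, continuous f}, {within V, continuous g},
        (forall x, U x -> V (f x) /\ g (f x) = x) &
        (forall y, V y -> U (g y) /\ f (g y) = y)].

(* The degree of a covering is its number of sheets. *)
Definition covering_of_degree (k : nat) (T : topologicalType) (f : T -> T) :=
  continuous f /\
  forall y : T, exists V : set T, exists U : 'I_k -> set T,
    [/\ open V /\ V y, (forall i, open (U i)), trivIset [set: 'I_k] U,
        f @^-1` V = (\bigcup_i U i) &
        forall i, homeo_between f (U i) V].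

Section ExpandingMaps.
Variables (R : realType) (alpha lambda : R).

(* The condition 0 < f' expresses that f preserves the orientation of R / Z. *)
Definition is_expanding_map : set (circle R -> circle R) :=
  [set f | [/\ C1_map f /\ (Hold alpha (cderiv f) < +oo)%E,
               covering_of_degree 2 f,
               (forall x, 0 < cderiv f x) &
               (forall x, lambda < cderiv f x)]].

Definition expanding_map : Type := set_type is_expanding_map.

HB.instance Definition _ := Choice.on expanding_map.

Definition emap (f : expanding_map) : circle R -> circle R := val f.

(* The C^{1+alpha} norm applies to real functions, while g - f takes values in
   R / Z; it is taken on a C^1 lift phi : circle -> R of g - f. *)
Definition C1alpha_ball (f : expanding_map) (e : R) : set expanding_map :=
  [set g | exists phi : circle R -> R,
     [/\ C1_fun phi, (norm_C1alpha alpha phi < e%:E)%E &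
         forall x, emap g x = emap f x + cpi (phi x)]].

Definition C1alpha_open (U : set expanding_map) :=
  forall f, U f -> exists2 e : R, 0 < e & C1alpha_ball f e `<=` U.

Lemma C1alpha_openT : C1alpha_open setT.
Proof. by move=> f _; exists 1. Qed.

Lemma C1alpha_openI (A B : set expanding_map) :
  C1alpha_open A -> C1alpha_open B -> C1alpha_open (A `&` B).
Proof.
move=> oA oB f [/oA[e e0 eA] /oB[d d0 dB]].
exists (Num.min e d); first by rewrite lt_min e0 d0.
move=> g [phi [C1phi small gE]]; split.
- apply: eA; exists phi; split => //; apply: lt_le_trans small _.
  by rewrite lee_fin ge_min lexx.
- apply: dB; exists phi; split => //; apply: lt_le_trans small _.
  by rewrite lee_fin ge_min lexx orbT.
Qed.

Lemma C1alpha_open_bigU (I : Type) (A : I -> set expanding_map) :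
  (forall i, C1alpha_open (A i)) -> C1alpha_open (\bigcup_i A i).
Proof.
move=> oA f [i _ /oA[e e0 eA]]; exists e => // g /eA Aig; by exists i.
Qed.

HB.instance Definition _ := isOpenTopological.Build expanding_map
  C1alpha_openT C1alpha_openI C1alpha_open_bigU.

End ExpandingMaps.

Definition generic (T : topologicalType) (A : set T) :=
  exists U : nat -> set T,
    (forall n, open (U n) /\ dense (U n)) /\ \bigcap_n U n `<=` A.

Definition cborel (R : realType) : Type :=
  g_sigma_algebraType (@open (circle R)).

HB.instance Definition _ (R : realType) :=
  Measurable.copy (cborel R) (g_sigma_algebraType (@open (circle R))).

Section Measures.
Variable R : realType.
Implicit Types (f : circle R -> circle R) (mu nu : probability (cborel R) R).

(* Probabilities are total functions on sets; only their values on Borel sets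
   are meaningful. *)
Definition same_measure mu nu :=
  forall A : set (cborel R), measurable A -> mu A = nu A.

Definition invariant f mu :=
  forall A : set (cborel R), measurable A -> mu (f @^-1` A) = mu A.

Definition lyapunov f mu : \bar R :=
  (\int[mu]_x (ln (cderiv f x))%:E)%E.

Definition maximizing f mu :=
  invariant f mu /\ forall nu, invariant f nu -> (lyapunov f nu <= lyapunov f mu)%E.

Definition supp mu : set (circle R) :=
  [set x | forall U : set (circle R), open U -> U x -> (0 < mu U)%E].

Definition uniquely_ergodic f (K : set (circle R)) :=
  [/\ closed K, f @` K `<=` K &
      exists mu, [/\ invariant f mu, mu K = 1%E &
        forall nu, invariant f nu -> nu K = 1%E -> same_measure nu mu]].

End Measures.

(* Main.v *)
Require Import Defs.
From HB Require Import structures.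
From mathcomp Require Import all_boot all_order all_algebra.
From mathcomp Require Import generic_quotient ring_quotient.
From mathcomp Require Import all_classical all_reals all_analysis.
From mathcomp Require Import measurable_realfun.
From mathcomp Require Import ring lra.
From mathcomp Require Import zify.

Set Implicit Arguments.
Unset Strict Implicit.
Unset Printing Implicit Defensive.

Import Order.TTheory GRing.Theory Num.Theory.
Import numFieldNormedType.Exports.

Local Open Scope classical_set_scope.
Local Open Scope ring_scope.

(* For an open dense set of maps the maximizing measure is carried by a single
   periodic orbit.  The dynamics is studied on a lift F : R -> R, with
   F (x + 1) = F x + 2 and potential phi = ln F'.

   Let m be the supremum of the averages of phi over periodic orbits.  A
   sub-action V makes the deficit V o F - V + m - phi nonnegative.  Counting the
   itineraries of points of small deficit (an argument of Bressaud and Quas)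
   gives periodic orbits whose total deficit is smaller than any given negative
   power of their period; splitting an orbit at its close returns then gives one
   that is g-separated with total deficit at most delta * g^alpha.

   With D a small multiple of g and kap = ep * D^alpha, add to F a bump of width
   D around this orbit that vanishes on the orbit and has derivative kap * F'
   there.  It is small in C^{1+alpha}, keeps the orbit and raises its average by
   ln (1 + kap), which outweighs the deficit: Birkhoff sums then lose a fixed
   amount at each visit outside a neighbourhood of the orbit, and this survives
   C^{1+alpha}-small perturbations.  Integrating this inequality against an
   invariant measure shows that a maximizing measure does not charge the
   complement of the neighbourhood, so by expansivity it lives on the orbit. *)

(** * Short cycles in graphs of words *)

(** A split at a close return may multiply the defect by a constant [L], and about log2 n splits may
    be needed for an orbit of period n, so the defect to start from must beat n^(- log2 L). Since
    [L] grows as [delta] shrinks, and [delta] depends on the map, no fixed polynomial rate would do: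
    this is why the counting argument has to reach every power of the period. The scales of the bump
    are forced. Width [D] and slope [kap] produce a Hölder constant of order kap / D^alpha, so the
    slope can be at most a small multiple of D^alpha, and the defect must be small against that same
    power. Potential and dynamics move together when the map is perturbed. The sub-action V of the
    original F is kept throughout: replacing F by F + eta in V o F costs a multiple of |eta|^alpha,
    at most of order (kap D)^alpha, which is small against kap = ep D^alpha because of the extra
    factor kap^alpha. Near the orbit the cost is only a multiple of the alpha-th power of the
    distance to it, and sums geometrically along an excursion. *)

Section ShortCycles.
Variables (T : finType) (e : rel T) (k : nat).
Hypothesis no_cycle : forall s, (0 < size s <= k)%N -> ~~ cycle e s.

(** A repeated vertex would cut a cycle of length at most [k] out of the path. *)
Lemma no_cycle_uniq s : (size s <= k)%N -> sorted e s -> uniq s.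
Proof.
elim: s => //= x p IH szp xp; apply/andP; split; last first.
  by apply: IH; [exact: ltnW|exact: path_sorted xp].
apply/negP => xinp; case/splitPr: xinp szp xp => p1 p2 szp.
rewrite -cat_rcons cat_path => /andP[xp _].
apply/negP: xp; apply: (@no_cycle (x :: p1)).
by move: szp; rewrite /= size_cat /=; lia.
Qed.

(* An edge of s running backwards in t would close a segment of t into a short
   cycle, so s and t list their common vertices in the same order. *)
Lemma no_cycle_eq s t : (size s <= k)%N -> (size t <= k)%N ->
  sorted e s -> sorted e t -> s =i t -> s = t.
Proof.
move=> szs szt ss st st_eq; have ut := no_cycle_uniq szt st.
apply: (@irr_sorted_eq _ (fun x y => index x t < index y t)%N) => //.
- by move=> x y z; exact: ltn_trans.
- by move=> x; exact: ltnn.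
- case: s ss szs st_eq => // x0 s ss szs st_eq; apply/(sortedP x0) => i hi.
  have exy := (sortedP x0 ss) _ hi.
  set x := nth _ _ i in exy *; set y := nth _ _ i.+1 in exy *.
  have xt : x \in t by rewrite -st_eq mem_nth// ltnW.
  have yt : y \in t by rewrite -st_eq mem_nth.
  case/splitPr: yt st szt ut xt {st_eq} => t1 t2 st szt ut.
  rewrite mem_cat inE => /or3P[xt1|/eqP xy|xt2].
  + have yt1 : y \notin t1.
      by move: ut; rewrite cat_uniq /= negb_or => /and3P[_ /andP[]].
    rewrite !index_cat xt1 (negbTE yt1) /= eqxx addn0 index_mem//.
  + have : ~~ cycle e [:: y].
      by apply: no_cycle; move: szt; rewrite size_cat /=; lia.
    by rewrite /= andbT -{1}xy exy.
  + case/splitPr: xt2 st szt {ut} => t3 t4.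
    rewrite sorted_cat_cons => /andP[_]; rewrite cat_path => /= /and3P[p2 lx _] szt.
    have : ~~ cycle e (y :: rcons t3 x).
      apply: no_cycle; move: szt; rewrite !size_cat /= size_cat size_rcons /=; lia.
    by rewrite /= !rcons_path last_rcons p2 lx exy.
- case: t ut {szt st st_eq} => // x0 t ut; apply/(sortedP x0) => i hi.
  by rewrite !index_uniq// ltnW.
Qed.

(** Such a path is determined by its set of vertices, a [k]-subset of [W]. Compared with the trivial
    count #|W|^k this saves a factor k!. *)
Lemma no_cycle_card (W : {set T}) :
  (#|[set t : k.-tuple T | sorted e t & all [in W] t]| <= 'C(#|W|, k))%N.
Proof.
rewrite -cards_draws -(@card_in_imset _ _ (fun t : k.-tuple T => [set x in t])).
  apply: subset_leq_card; apply/fintype.subsetP => A /imsetP[t].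
  rewrite !inE => /andP[st /allP tW] ->; apply/andP; split.
    by apply/fintype.subsetP => x; rewrite inE => /tW.
  by rewrite cardsE (card_uniqP _) ?size_tuple// no_cycle_uniq ?size_tuple.
move=> s t; rewrite !inE => /andP[ss _] /andP[st _] /setP st_eq.
apply/val_inj; apply: no_cycle_eq; rewrite ?size_tuple//.
by move=> x; have := st_eq x; rewrite !inE.
Qed.

End ShortCycles.

(** The factors i + 1 and k - i of the two factorials are paired; their product is at least k. The
    result stands in for Stirling's formula: ln k! >= (k / 2) ln k. *)
Lemma expn_le_sqr_fact k : (k ^ k <= k`! * k`!)%N.
Proof.
have e : k`! = (\prod_(i < k) i.+1)%N by rewrite fact_prod big_add1 /= big_mkord.
have e' : k`! = (\prod_(i < k) (k - i))%N.
  rewrite e (reindex_inj rev_ord_inj); apply: eq_bigr => i _ /=.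
  have := ltn_ord i; lia.
rewrite {1}e e' -big_split /= -[X in (_ ^ X <= _)%N]card_ord -prod_nat_const.
apply: leq_prod => i _; have := ltn_ord i; nia.
Qed.

(** * Factorial languages of binary words and their entropy *)

Section Language.
Variables (R : realType) (L : nat -> nat -> Prop).
Hypothesis L_lt : forall n w, L n w -> (w < 2 ^ n)%N.
Hypothesis L_prefix : forall j k w, L (j + k) w -> L j (w %/ 2 ^ k).
Hypothesis L_suffix : forall j k w, L (j + k) w -> L k (w %% 2 ^ k).
Hypothesis L_ex : forall n, exists w, L n w.

Let pow_gt0 n : (0 < 2 ^ n)%N. Proof. by rewrite expn_gt0. Qed.

(** Words of length n are numbers below 2^n, the first letter being the most significant: dividing
    by 2^k drops the last k letters, reducing modulo 2^k keeps just these. *)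
Definition word n w : 'I_(2 ^ n) := Ordinal (ltn_pmod w (pow_gt0 n)).

Definition words n : {set 'I_(2 ^ n)} := [set w | `[< L n (val w) >]].

Lemma in_words n (w : 'I_(2 ^ n)) : (w \in words n) = `[< L n w >].
Proof. by rewrite inE. Qed.

Lemma words_gt0 n : (0 < #|words n|)%N.
Proof.
have [w Lw] := L_ex n; apply/card_gt0P; exists (word n w).
by rewrite inE /=; apply/asboolP; rewrite modn_small// L_lt.
Qed.

Lemma words_addn j k : (#|words (j + k)| <= #|words j| * #|words k|)%N.
Proof.
rewrite -cardsX.
pose f (w : 'I_(2 ^ (j + k))) := (word j (w %/ 2 ^ k), word k w).
have lt_div (w : 'I_(2 ^ (j + k))) : (w %/ 2 ^ k < 2 ^ j)%N.
  by rewrite ltn_divLR// -expnD.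
rewrite -(@card_in_imset _ _ f); last first.
  move=> v w _ _ [/= h1 h2]; apply/val_inj => /=.
  rewrite (divn_eq v (2 ^ k)) (divn_eq w (2 ^ k)) h2; congr (_ * _ + _)%N.
  by move: h1; rewrite !modn_small.
apply: subset_leq_card; apply/fintype.subsetP => x /imsetP[w].
rewrite inE => /asboolP Lw ->; rewrite !inE /= modn_small//.
by apply/andP; split; apply/asboolP; [exact: L_prefix|exact: L_suffix Lw].
Qed.

Definition follows n (u v : 'I_(2 ^ n)) := `[< L (n + n) (u * 2 ^ n + v) >].

Fixpoint blocks n k (w : nat) : seq 'I_(2 ^ n) :=
  if k is k'.+1 then rcons (blocks n k' (w %/ 2 ^ n)) (word n w) else [::].

Lemma size_blocks n k w : size (blocks n k w) = k.
Proof. by elim: k w => //= k IH w; rewrite size_rcons IH. Qed.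

Lemma blocks_inj n k v w : (v < 2 ^ (k * n))%N -> (w < 2 ^ (k * n))%N ->
  blocks n k v = blocks n k w -> v = w.
Proof.
elim: k v w => [|k IH] v w /=; first by rewrite mul0n expn0 !ltnS !leqn0 => /eqP -> /eqP ->.
rewrite mulSn addnC expnD => hv hw /rcons_inj [h1 h2].
rewrite (divn_eq v (2 ^ n)) (divn_eq w (2 ^ n)) h2; congr (_ * _ + _)%N.
by apply: IH h1; rewrite ltn_divLR.
Qed.

Lemma blocks_words n k w : L (k * n) w -> all [in words n] (blocks n k w).
Proof.
elim: k w => //= k IH w; rewrite mulSn addnC => Lw.
rewrite all_rcons IH ?andbT; last exact: L_prefix Lw.
by rewrite /= inE; apply/asboolP; exact: L_suffix Lw.
Qed.

Lemma blocks_sorted n k w : L (k * n) w -> sorted (@follows n) (blocks n k w).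
Proof.
elim: k w => [//|[//|k] IH] w Lw.
have Lk : L (k.+1 * n) (w %/ 2 ^ n).
  by apply: L_prefix; rewrite -mulSnr.
have /= IHk := IH _ Lk.
rewrite /= -cats1 cat_rcons sorted_cat_cons IHk /=.
rewrite andbT; apply/asboolP => /=.
have Lw' : L (k * n + (n + n)) w by rewrite addnA -!mulSnr.
have := L_suffix Lw'; congr (L _ _).
set a := (w %/ 2 ^ n)%N; rewrite {1}(divn_eq w (2 ^ n)) -/a {1}(divn_eq a (2 ^ n)).
rewrite mulnDl -mulnA -expnD -addnA modnMDl modn_small// expnD.
have := ltn_pmod a (pow_gt0 n); have := ltn_pmod w (pow_gt0 n); nia.
Qed.

(** Cutting into blocks is injective and turns words of length k n into k-paths in the graph of
    n-words, which [no_cycle_card] counts. *)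
Lemma words_ge_blocks n k :
  (forall s, (0 < size s <= k)%N -> ~~ cycle (@follows n) s) ->
  (#|words (k * n)| * k`! <= #|words n| ^ k)%N.
Proof.
move=> nc; apply: (@leq_trans ('C(#|words n|, k) * k`!)).
  rewrite leq_pmul2r ?fact_gt0//.
  pose f (w : 'I_(2 ^ (k * n))) : k.-tuple _ := tcast (size_blocks n k w) (in_tuple (blocks n k w)).
  rewrite -(@card_in_imset _ _ f); last first.
    move=> v w _ _ /(congr1 val) /=; rewrite !val_tcast /= => h.
    by apply/val_inj; exact: blocks_inj h.
  apply: leq_trans (no_cycle_card nc (words n)).
  apply: subset_leq_card; apply/fintype.subsetP => x /imsetP[w].
  rewrite in_words inE => /asboolP Lw ->; rewrite /f !val_tcast /=.
  by apply/andP; split; [exact: blocks_sorted|exact: blocks_words].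
rewrite bin_ffact ffact_prod -[X in (_ <= _ ^ X)%N]card_ord -prod_nat_const.
by apply: leq_prod => i _; rewrite leq_subr.
Qed.

Let lnp n : R := ln (#|words n|%:R).

Let lnp_ge0 n : 0 <= lnp n.
Proof. by rewrite ln_ge0// ler1n words_gt0. Qed.

Let lnp_mul k n : lnp (k * n) <= k%:R * lnp n.
Proof.
elim: k => [|k IH].
  by rewrite mul0n mul0r /lnp ln_le0// lern1 (leq_trans (max_card _))// card_ord.
rewrite mulSn addnC -natr1 mulrDl mul1r (le_trans _ (lerD IH (lexx _)))//.
rewrite -lnM ?posrE ?ltr0n ?words_gt0// -natrM ler_ln ?posrE ?ltr0n ?muln_gt0 ?words_gt0//.
by rewrite ler_nat words_addn.
Qed.

(* Bressaud-Quas: k-paths in the graph of n-words are at least exp(h k n) in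
   number, h the entropy; without cycles of length at most k they are at most
   p(n)^k / k!, where p(n) = exp(h n + o(n)). *)
Lemma short_cycle (g : R) (N0 : nat) : 0 < g -> exists2 n, (N0 <= n)%N &
  exists s : seq 'I_(2 ^ n), [/\ (0 < size s)%N, (size s)%:R <= expR (g * n%:R) &
    cycle (@follows n) s].
Proof.
move=> g0.
pose E := [set lnp n.+1 / n.+1%:R | n in [set: nat]].
have Einf : has_inf E.
  split; first by exists (lnp 1 / 1), 0%N.
  by exists 0 => _ [n _ <-]; rewrite divr_ge0.
(* The entropy, as an infimum: it bounds every ratio [lnp n / n] from below and is nearly attained
   at one length. *)
set h := inf E.
have lnp_h n : h * n%:R <= lnp n.
  case: n => [|n]; first by rewrite mulr0.
  rewrite -ler_pdivlMr ?ltr0n//; apply: inf_lbound; first by case: Einf.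
  by exists n.
have [_ [n0 _ <-] hn0] := inf_adherent (divr_gt0 g0 (ltr0n _ 4)) Einf.
pose N1 := maxn N0 (Num.trunc (2 / g)).
(* A multiple of the near-optimal length keeps its ratio by subadditivity, while the other factor
   pushes n past N0 and 2 / g. *)
pose n := (N1.+1 * n0.+1)%N.
have nN1 : (N1.+1 <= n)%N by rewrite leq_pmulr.
have lnp_n : lnp n <= (h + g / 4) * n%:R.
  apply: (le_trans (lnp_mul _ _)); rewrite natrM mulrCA ler_wpM2l//.
  by rewrite -ler_pdivrMr ?ltr0n// ltW.
have gn : 1 <= g / 2 * n%:R.
  have h1 : 2 / g < n%:R.
    apply: lt_le_trans (truncnS_gt _) _; rewrite ler_nat (leq_trans _ nN1)// ltnS.
    exact: leq_maxr.
  have : 2 / g * (g / 2) < n%:R * (g / 2) by rewrite ltr_pM2r// divr_gt0.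
  have -> : 2 / g * (g / 2) = 1 by field; rewrite gt_eqF.
  by rewrite mulrC => /ltW.
set Y := expR (g / 2 * n%:R).
have Y2 : 2 <= Y by apply: le_trans (expR_ge1Dx _); lra.
(* k lies between exp (g n / 2) and exp (g n). The lower bound gives ln k! > k g n / 4, which the
   slack g / 4 above the entropy cannot absorb. *)
pose k := (Num.trunc Y).+1.
have kY : Y < k%:R by exact: truncnS_gt.
have kY2 : k%:R <= expR (g * n%:R).
  have -> : g * n%:R = g / 2 * n%:R + g / 2 * n%:R by lra.
  rewrite expRD -/Y /k -natr1.
  have : (Num.trunc Y)%:R <= Y by rewrite truncn_le; lra.
  have : Y * 2 <= Y * Y by rewrite ler_pM2l//; lra.
  lra.
exists n; first by rewrite (leq_trans _ nN1)// ltnW// ltnS leq_maxl.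
have [[s [s1 s2]]|nc] := pselect (exists s, (0 < size s <= k)%N /\ cycle (@follows n) s).
  exists s; split => //; first by case/andP: s1.
  by apply: le_trans kY2; rewrite ler_nat; case/andP: s1.
exfalso.
have {}nc s : (0 < size s <= k)%N -> ~~ cycle (@follows n) s.
  by move=> hs; apply/negP => cs; apply: nc; exists s.
have k0 : (0 : R) < k%:R by rewrite ltr0n.
have f0 : (0 : R) < k`!%:R by rewrite ltr0n fact_gt0.
have p0 j : (0 : R) < #|words j|%:R by rewrite ltr0n words_gt0.
have h1 : lnp (k * n) + ln k`!%:R <= k%:R * lnp n.
  rewrite -lnM ?posrE// -natrM mulr_natl -lnXn// -natrX ler_ln ?posrE ?ltr0n ?muln_gt0 ?fact_gt0 ?words_gt0 ?expn_gt0 ?words_gt0//.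
  by rewrite ler_nat words_ge_blocks.
have h2 : k%:R * ln (k%:R : R) <= 2 * ln k`!%:R.
  rewrite mulr_natl -lnXn// mulr_natl mulr2n -lnM ?posrE// -natrX -natrM.
  by rewrite ler_ln ?posrE ?ltr0n ?muln_gt0 ?expn_gt0 ?fact_gt0// ler_nat expn_le_sqr_fact.
have h3 := lnp_h (k * n)%N.
have h4 : k%:R * lnp n <= k%:R * ((h + g / 4) * n%:R) by rewrite ler_pM2l.
have h5 : ln Y < ln (k%:R : R) by rewrite ltr_ln ?posrE// expR_gt0.
have h6 : k%:R * ln Y < k%:R * ln (k%:R : R) by rewrite ltr_pM2l.
move: h6 h3; rewrite /Y expRK natrM => h6 h3.
by lra.
Qed.

End Language.

(** * Expanding maps on the line *)

Section PowR.
Variable R : realType.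
Implicit Types (x y a d e : R).

Lemma powR_le x y a : 0 <= a -> 0 <= x -> x <= y -> x `^ a <= y `^ a.
Proof.
move=> a0 x0 xy; apply: ge0_ler_powR => //; rewrite nnegrE //.
exact: le_trans xy.
Qed.

Lemma powR_le_one x a : 0 <= a -> 0 <= x -> x <= 1 -> x `^ a <= 1.
Proof. by move=> a0 x0 /(powR_le a0 x0); rewrite powR1. Qed.

Lemma powR_addle x y a : 0 <= a -> a <= 1 -> 0 <= x -> 0 <= y ->
  (x + y) `^ a <= 2 * (x `^ a + y `^ a).
Proof.
move=> a0 a1.
wlog xy : x y / x <= y => [hw x0 y0|x0 y0].
  have [xy|/ltW yx] := leP x y; first exact: hw.
  by rewrite addrC [_ `^ _ + _]addrC; exact: hw.
apply: (@le_trans _ _ ((2 * y) `^ a)).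
  by apply: powR_le => //; rewrite ?addr_ge0// mulr2n mulrDl !mul1r lerD2r.
rewrite powRM//; apply: ler_pM => //; rewrite ?powR_ge0//; last first.
  by rewrite lerDr powR_ge0.
by rewrite -{2}[2]powRr1//; apply: ler_powR => //; rewrite ler1n.
Qed.

Lemma powR_small a e : 0 < a -> 0 < e -> exists2 d, 0 < d & forall x, 0 <= x -> x <= d -> x `^ a <= e.
Proof.
move=> a0 e0; exists (e `^ a^-1); first exact: powR_gt0.
move=> x x0 xd; have := powR_le (ltW a0) x0 xd.
by rewrite -powRrM mulVf ?gt_eqF// powRr1// ltW.
Qed.

End PowR.

Section Birkhoff.
Variables (R : realType) (F phi : R -> R).

Definition birkhoff n x : R := \sum_(i < n) phi (iter i F x).

Lemma birkhoff0 x : birkhoff 0 x = 0.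
Proof. by rewrite /birkhoff big_ord0. Qed.

Lemma birkhoffS n x : birkhoff n.+1 x = birkhoff n x + phi (iter n F x).
Proof. by rewrite /birkhoff big_ord_recr. Qed.

Lemma birkhoffD m n x :
  birkhoff (m + n) x = birkhoff m x + birkhoff n (iter m F x).
Proof.
elim: n => [|n IH]; first by rewrite addn0 birkhoff0 addr0.
by rewrite addnS !birkhoffS IH addrA addnC iterD.
Qed.

Lemma birkhoffSl n x : birkhoff n.+1 x = phi x + birkhoff n (F x).
Proof. by rewrite -add1n birkhoffD birkhoffS birkhoff0 add0r. Qed.

End Birkhoff.

Section Expanding.
Variables (R : realType) (alpha lam Lam H : R) (F phi : R -> R).
Hypothesis alpha_gt0 : 0 < alpha.
Hypothesis lam_gt1 : 1 < lam.
Hypothesis H_ge0 : 0 <= H.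
Hypothesis F_cont : continuous F.
Hypothesis F_exp : forall x y, x <= y -> lam * (y - x) <= F y - F x.
Hypothesis F_lip : forall x y, `|F x - F y| <= Lam * `|x - y|.
Hypothesis F_deg2 : forall x, F (x + 1) = F x + 2.
Hypothesis phi_per : forall x, phi (x + 1) = phi x.
Hypothesis phi_hold : forall x y, `|phi x - phi y| <= H * `|x - y| `^ alpha.

Let lam_gt0 : 0 < lam. Proof. exact: lt_trans lam_gt1. Qed.

Lemma periodic_int (T : Type) (g : R -> T) :
  (forall x, g (x + 1) = g x) -> forall x (a : int), g (x + a%:~R) = g x.
Proof.
move=> g1 x a.
have gn y (n : nat) : g (y + n%:R) = g y.
  by elim: n => [|n IH]; rewrite ?addr0// -natr1 addrA g1 IH.
by case: a => n; rewrite ?NegzE ?mulrNz -pmulrn; [exact: gn|rewrite -(gn _ n.+1) subrK].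
Qed.

Lemma iter_deg2 n x (a : int) :
  iter n F (x + a%:~R) = iter n F x + (2 ^+ n * a)%:~R.
Proof.
have F1 y (b : int) : F (y + b%:~R) = F y + (2 * b)%:~R.
  have := @periodic_int R (fun x => F x - 2 * x) _ y b.
  rewrite intrM /= => h; apply/eqP; rewrite -subr_eq0; apply/eqP.
  rewrite -[RHS](subrr (F y - 2 * y)) -{1}h; first by lra.
  by move=> z; rewrite F_deg2; lra.
elim: n => [|n IH]; first by rewrite expr0 mul1r.
by rewrite iterS IH F1 mulrA -exprS.
Qed.

Lemma iter_exp n x y : x <= y -> lam ^+ n * (y - x) <= iter n F y - iter n F x.
Proof.
elim: n => [|n IH] xy; first by rewrite expr0 mul1r.
have h := IH xy; have h1 : iter n F x <= iter n F y.
  by rewrite -subr_ge0 (le_trans _ h)// mulr_ge0 ?exprn_ge0 ?subr_ge0 ?(ltW lam_gt0).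
rewrite !iterS (le_trans _ (F_exp h1))// exprS -mulrA ler_pM2l//.
Qed.

Lemma iter_norm n x y : lam ^+ n * `|x - y| <= `|iter n F x - iter n F y|.
Proof.
wlog xy : x y / x <= y => [hw|].
  have [/hw//|/ltW/hw] := leP x y; by rewrite distrC [X in _ <= X]distrC.
have h := iter_exp n xy.
rewrite distrC ger0_norm ?subr_ge0// distrC ger0_norm// (le_trans _ h)//.
by rewrite mulr_ge0 ?exprn_ge0 ?subr_ge0 ?(ltW lam_gt0).
Qed.

Lemma iter_mono n x y : `|x - y| <= `|iter n F x - iter n F y|.
Proof.
apply: le_trans (iter_norm n x y).
by rewrite ler_peMl// exprn_ege1// ltW.
Qed.

Lemma iter_le n x y : (iter n F x <= iter n F y) = (x <= y).
Proof.
have lt0 := exprn_gt0 n lam_gt0.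
apply/idP/idP => [|xy]; last first.
  by rewrite -subr_ge0 (le_trans _ (iter_exp n xy))// mulr_ge0 ?(ltW lt0)// subr_ge0.
move=> h; rewrite leNgt; apply/negP => yx.
have := iter_exp n (ltW yx); rewrite leNgt => /negP; apply.
by apply: (@le_lt_trans _ _ 0); rewrite ?subr_le0// mulr_gt0// subr_gt0.
Qed.

Lemma iter_cont n : continuous (iter n F).
Proof.
elim: n => [|n IH] x; first exact: cvg_id.
apply: (@continuous_comp _ _ _ (iter n F) F); [exact: IH|exact: F_cont].
Qed.

Lemma IVT_solve (g : R -> R) a b v : continuous g -> a <= b -> g a <= v <= g b ->
  exists2 c, a <= c <= b & g c = v.
Proof.
move=> gc ab /andP[av vb].
have [||c] := @IVT R g a b v ab; first exact: continuous_subspaceT.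
  by have gab := le_trans av vb; rewrite min_l// max_r// av vb.
by rewrite in_itv /= => ? <-; exists c.
Qed.

Lemma iter_surj n v : exists x, iter n F x = v.
Proof.
suff s u : exists x, F x = u.
  elim: n v => [v|n IH v]; first by exists v.
  by have [y <-] := s v; have [x <-] := IH y; exists x.
set M := `|u - F 0|.
have M0 : 0 <= M by exact: normr_ge0.
have h1 : F 0 + M <= F M.
  have := F_exp M0; rewrite subr0 -lerBrDl; apply: le_trans.
  by rewrite ler_peMl// ltW.
have h2 : F (- M) <= F 0 - M.
  have := @F_exp (- M) 0; rewrite oppr_le0 => /(_ M0); rewrite sub0r opprK => h.
  rewrite lerBrDl -lerBrDr; apply: le_trans h; by rewrite ler_peMl// ltW.
have /andP[h3 h4] : - M <= u - F 0 <= M by rewrite -ler_norml.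
have [|||x _ <-] := @IVT_solve F (- M) M u; [exact: F_cont|lra|lra|by exists x].
Qed.

(** Backward iteration contracts distances by 1 / lam at least, hence their alpha-th powers by this
    factor. *)
Definition hold_ratio : R := (lam^-1) `^ alpha.
Local Notation q := hold_ratio.

Lemma hold_ratio_gt0 : 0 < q.
Proof. by rewrite powR_gt0// invr_gt0. Qed.

Lemma hold_ratio_lt1 : q < 1.
Proof.
have <- : 1 `^ alpha = 1 :> R by rewrite powR1.
by rewrite gt0_ltr_powR// ?nnegrE ?invr_ge0 ?(ltW lam_gt0) ?invf_lt1.
Qed.

Lemma powR_contract d e : 0 <= d -> lam * d <= e -> d `^ alpha <= q * e `^ alpha.
Proof.
move=> d0 de; rewrite -powRM ?invr_ge0 ?(ltW lam_gt0)//; last first.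
  by apply: le_trans de; rewrite mulr_ge0// ltW.
by apply: powR_le => //; [exact: ltW|rewrite ler_pdivlMl].
Qed.

Lemma powR_contractX n d e : 0 <= d -> lam ^+ n * d <= e ->
  d `^ alpha <= q ^+ n * e `^ alpha.
Proof.
move=> d0; elim: n e => [|n IH] e; first by rewrite !expr0 !mul1r => /powR_le; apply; rewrite // ltW.
rewrite exprS -mulrA => h.
have := powR_contract _ h; rewrite mulr_ge0 ?exprn_ge0 ?(ltW lam_gt0)// => /(_ isT) h1.
apply: le_trans (IH _ (lexx _)) _.
by rewrite exprSr -mulrA ler_wpM2l ?exprn_ge0 ?(ltW hold_ratio_gt0).
Qed.

(** The sum of the series H (q + q^2 + ...). *)
Definition hold_sum : R := H * q / (1 - q).

Lemma hold_sum_ge0 : 0 <= hold_sum.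
Proof.
by rewrite divr_ge0 ?mulr_ge0 ?subr_ge0 ?(ltW hold_ratio_lt1) ?(ltW hold_ratio_gt0).
Qed.

(** Bounded distortion: seen backwards from time n the distances decay geometrically, so the one at
    time n controls the whole sum. *)
Lemma birkhoff_close n x y :
  `|birkhoff F phi n x - birkhoff F phi n y| <=
    hold_sum * `|iter n F x - iter n F y| `^ alpha.
Proof.
elim: n => [|n IH]; first by rewrite !birkhoff0 subrr normr0 mulr_ge0 ?hold_sum_ge0 ?powR_ge0.
rewrite !birkhoffS; set d := iter n F x - iter n F y.
have h1 : `|d| `^ alpha <= q * `|iter n.+1 F x - iter n.+1 F y| `^ alpha.
  by apply: powR_contract => //; have := iter_norm 1 (iter n F x) (iter n F y); rewrite expr1.
have -> : birkhoff F phi n x + phi (iter n F x) - (birkhoff F phi n y + phi (iter n F y))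
  = (birkhoff F phi n x - birkhoff F phi n y) + (phi (iter n F x) - phi (iter n F y)) by ring.
apply: le_trans (ler_normD _ _) _.
apply: le_trans (lerD IH (phi_hold _ _)) _; rewrite -mulrDl.
have -> : hold_sum * `|iter n.+1 F x - iter n.+1 F y| `^ alpha =
   (hold_sum + H) * (q * `|iter n.+1 F x - iter n.+1 F y| `^ alpha).
  rewrite mulrA; congr (_ * _); rewrite /hold_sum; field.
  by rewrite subr_eq0 eq_sym lt_eqF ?hold_ratio_lt1.
by rewrite ler_wpM2l// addr_ge0 ?hold_sum_ge0.
Qed.

Definition closing_const : R := hold_sum * (lam / (lam - 1)) `^ alpha.

Lemma closing_const_ge0 : 0 <= closing_const.
Proof. by rewrite mulr_ge0 ?hold_sum_ge0 ?powR_ge0. Qed.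

(** The displacement [iter n F y - y] increases with slope at least lam - 1, so it takes the value
    [a] within |t| / (lam - 1) of x. Intermediate distances do not exceed the final one, itself at
    most |t| / (lam - 1) + |t|. *)
Lemma closing n x (a : int) t : (0 < n)%N -> iter n F x = x + a%:~R + t ->
  exists p, [/\ iter n F p = p + a%:~R,
    forall i, (i <= n)%N -> `|iter i F p - iter i F x| <= lam / (lam - 1) * `|t| &
    `|birkhoff F phi n p - birkhoff F phi n x| <= closing_const * `|t| `^ alpha].
Proof.
move=> n0 hx; have l10 : 0 < lam - 1 by rewrite subr_gt0.
set c := `|t| / (lam - 1).
have c0 : 0 <= c by rewrite divr_ge0 ?(ltW l10).
have ct : (lam - 1) * c = `|t| by rewrite /c mulrC divfK ?gt_eqF.
have K y z : y <= z -> (lam - 1) * (z - y) <= (iter n F z - z) - (iter n F y - y).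
  move=> yz; have := iter_exp n yz.
  have : lam * (z - y) <= lam ^+ n * (z - y).
    by rewrite ler_wpM2r ?subr_ge0// -{1}[lam]expr1 ler_weXn2l// ltW.
  lra.
have /andP[t1 t2] : - `|t| <= t <= `|t| by rewrite -ler_norml.
have [|||p /andP[p1 p2] hp] := @IVT_solve (fun y => iter n F y - y) (x - c) (x + c) a%:~R.
- move=> y; apply: cvgB; [exact: iter_cont|exact: cvg_id].
- lra.
- have := @K (x - c) x; have := @K x (x + c).
  have -> : x + c - x = c by ring.
  have -> : x - (x - c) = c by ring.
  by rewrite ct hx !lerDl gerBl c0 => /(_ isT) h1 /(_ isT) h2; apply/andP; lra.
have px : `|p - x| <= c by rewrite ler_norml; lra.
have Fp : iter n F p = p + a%:~R by lra.
have e : c + `|t| = lam / (lam - 1) * `|t|.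
  by rewrite /c; field; rewrite gt_eqF.
have pn : `|iter n F p - iter n F x| <= lam / (lam - 1) * `|t|.
  rewrite Fp hx -e.
  have -> : p + a%:~R - (x + a%:~R + t) = (p - x) - t by ring.
  by apply: le_trans (ler_normB _ _) _; rewrite lerD2r.
exists p; split => // [i ile|].
  apply: le_trans pn; apply: le_trans (iter_mono (n - i) _ _) _.
  by rewrite -!iterD subnK.
apply: le_trans (birkhoff_close _ _ _) _.
rewrite /closing_const -mulrA ler_wpM2l ?hold_sum_ge0//.
rewrite -powRM ?normr_ge0 ?divr_ge0 ?(ltW l10) ?(ltW lam_gt0)//.
by apply: powR_le; rewrite ?(ltW alpha_gt0).
Qed.

Lemma birkhoff_int n x (a : int) :
  birkhoff F phi n (x + a%:~R) = birkhoff F phi n x.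
Proof.
by apply: eq_bigr => i _; rewrite iter_deg2 (periodic_int phi_per).
Qed.

Lemma frac_bound (x : R) : 0 <= x - (Num.floor x)%:~R < 1.
Proof.
by have := floor_itv x; rewrite intrD => /andP[h1 h2]; rewrite subr_ge0 h1 ltrBlDl.
Qed.

Definition phi_bound : R := `|phi 0| + H.

Lemma phi_bounded x : `|phi x| <= phi_bound.
Proof.
set y := x - (Num.floor x)%:~R; have /andP[y0 y1] := frac_bound x.
have -> : phi x = phi y by rewrite -(periodic_int phi_per y (Num.floor x)) subrK.
have := phi_hold y 0; rewrite subr0 => h.
have -> : phi y = phi 0 + (phi y - phi 0) by ring.
rewrite (le_trans (ler_normD _ _))// lerD2l (le_trans h)// -[X in _ <= X]mulr1.
rewrite ler_wpM2l//.
by apply: powR_le_one; rewrite ?normr_ge0 ?(ltW alpha_gt0)// ger0_norm// ltW.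
Qed.

Lemma birkhoff_bounded n x : `|birkhoff F phi n x| <= n%:R * phi_bound.
Proof.
elim: n => [|n IH]; first by rewrite birkhoff0 normr0 mul0r.
rewrite birkhoffS -natr1 mulrDl mul1r (le_trans (ler_normD _ _))// lerD//.
exact: phi_bounded.
Qed.

(** Periodicity on the circle; n need not be the least period. *)
Definition per n p := (0 < n)%N /\ exists a : int, iter n F p = p + a%:~R.

Lemma per_iter n p i : per n p -> per n (iter i F p).
Proof.
move=> [n0 [a ha]]; split => //; exists (2 ^+ i * a).
by rewrite -iterD addnC iterD ha iter_deg2.
Qed.

Lemma per_int n p (b : int) : per n p -> per n (p + b%:~R).
Proof.
move=> [n0 [a ha]]; split => //; exists (a + (2 ^+ n - 1) * b).
by rewrite iter_deg2 ha !(intrD, intrM) rmorphN /=; ring.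
Qed.

Lemma birkhoff_per_iter n p i : per n p ->
  birkhoff F phi n (iter i F p) = birkhoff F phi n p.
Proof.
move=> [n0 [a ha]]; have := birkhoffD F phi i n p.
by rewrite addnC birkhoffD ha birkhoff_int addrC => /addrI.
Qed.

Lemma per_mul k n p : (0 < k)%N -> per n p -> per (k * n) p.
Proof.
move=> k0 [n0 [a ha]]; split; first by rewrite muln_gt0 k0.
elim: k k0 => // -[|k] IH _; first by exists a; rewrite mul1n.
have [|b hb] := IH; first exact: ltn0Sn.
exists (b + 2 ^+ (k.+1 * n) * a).
by rewrite mulSn addnC iterD ha iter_deg2 hb intrD addrA.
Qed.

Lemma birkhoff_per_mul k n p : per n p ->
  birkhoff F phi (k * n) p = k%:R * birkhoff F phi n p.
Proof.
move=> pn; elim: k => [|k IH]; first by rewrite mul0n birkhoff0 mul0r.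
by rewrite mulSn addnC birkhoffD IH birkhoff_per_iter// -natr1 mulrDl mul1r.
Qed.

(** Rounding the displacement down to an integer leaves an error below 1, so every orbit segment
    closes up at a cost independent of its length. *)
Lemma per_closing n x : (0 < n)%N -> exists p, per n p /\
  `|birkhoff F phi n p - birkhoff F phi n x| <= closing_const.
Proof.
move=> n0; set t := iter n F x - x.
have /andP[f0 f1] := frac_bound t.
have [|p [hp _ hS]] := @closing n x (Num.floor t) (t - (Num.floor t)%:~R) n0.
  by rewrite /t; ring.
exists p; split; first by split => //; exists (Num.floor t).
apply: le_trans hS _; rewrite -[X in _ <= X]mulr1 ler_wpM2l ?closing_const_ge0//.
by apply: powR_le_one; rewrite ?normr_ge0 ?(ltW alpha_gt0)// ger0_norm// ltW.
Qed.

Lemma fixpoint_exists : exists b, F b = b.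
Proof.
have e : iter 1 F 0 = 0 + 0%:~R + F 0 by rewrite /= !add0r.
have [p [hp _ _]] := closing (ltn0Sn 0) e.
by exists p; rewrite -[LHS]/(iter 1 F p) hp addr0.
Qed.

(** * Maximal averages, sub-actions and deficits *)

Definition max_average : R :=
  sup [set r | exists n p, per n p /\ r = birkhoff F phi n p / n%:R].
Local Notation m := max_average.

Lemma has_sup_average :
  has_sup [set r | exists n p, per n p /\ r = birkhoff F phi n p / n%:R].
Proof.
split.
  have [b hb] := fixpoint_exists.
  exists (birkhoff F phi 1 b / 1%:R), 1%N, b; split => //; split => //.
  by exists 0; rewrite /= hb addr0.
exists phi_bound => _ [n [p [[n0 _] ->]]].
rewrite ler_pdivrMr ?ltr0n// mulrC (le_trans (ler_norm _))//.
exact: birkhoff_bounded.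
Qed.

Lemma per_average n p : per n p -> birkhoff F phi n p <= n%:R * m.
Proof.
move=> np; rewrite mulrC -ler_pdivrMr ?ltr0n//; last by case: np.
by apply: ub_le_sup; [case: has_sup_average|exists n, p].
Qed.

Lemma birkhoff_max n x : birkhoff F phi n x <= n%:R * m + closing_const.
Proof.
case: n => [|n]; first by rewrite birkhoff0 mul0r add0r closing_const_ge0.
have [//|p [np h]] := @per_closing n.+1 x.
have := per_average np; move: h; rewrite ler_norml => /andP[h1 h2]; lra.
Qed.

(* The resulting V satisfies phi x <= V (F x) - V x + m, see [deficit_ge0]. *)
Definition subaction_set x := [set r | exists n y (a : int),
  iter n F y = x + a%:~R /\ r = birkhoff F phi n y - n%:R * m].

Definition subaction x : R := sup (subaction_set x).
Local Notation V := subaction.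

Lemma subaction_has_ubound x : has_ubound (subaction_set x).
Proof.
exists closing_const => _ [n [y [a [_ ->]]]].
by rewrite lerBlDl; exact: birkhoff_max.
Qed.

Lemma subaction_ge x n y (a : int) : iter n F y = x + a%:~R ->
  birkhoff F phi n y - n%:R * m <= V x.
Proof.
by move=> h; apply: ub_le_sup; [exact: subaction_has_ubound|exists n, y, a].
Qed.

Lemma subaction_le x v :
  (forall n y (a : int), iter n F y = x + a%:~R ->
     birkhoff F phi n y - n%:R * m <= v) -> V x <= v.
Proof.
move=> h; apply: ge_sup; last by move=> _ [n [y [a [hy ->]]]]; exact: (h n y a).
by exists 0, 0%N, x, 0; rewrite addr0 birkhoff0 mul0r subr0.
Qed.

Lemma subaction_bound x : 0 <= V x <= closing_const.
Proof.
apply/andP; split.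
  by have := @subaction_ge x 0 x 0; rewrite addr0 birkhoff0 mul0r subr0 => /(_ erefl).
by apply: subaction_le => n y a _; rewrite lerBlDl; exact: birkhoff_max.
Qed.

Lemma subaction_per x : V (x + 1) = V x.
Proof.
apply/eqP; rewrite eq_le; apply/andP; split; apply: subaction_le => n y a hy.
  by apply: (@subaction_ge _ _ _ (1 + a)); rewrite hy intrD addrA.
by apply: (@subaction_ge _ _ _ (a - 1)); rewrite hy intrB; ring.
Qed.

(** On the line every iterate of F is onto, so a candidate for [V u] is matched with one for [V v]
    having the same n and a; [birkhoff_close] compares the two. *)
Lemma subaction_hold x y : `|V x - V y| <= hold_sum * `|x - y| `^ alpha.
Proof.
have h u v : V u <= V v + hold_sum * `|u - v| `^ alpha.
  apply: subaction_le => n y' a hy.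
  have [z hz] := iter_surj n (v + a%:~R).
  have := birkhoff_close n y' z; rewrite hy hz.
  have -> : u + a%:~R - (v + a%:~R) = u - v by ring.
  rewrite ler_norml => /andP[h1 h2].
  have := subaction_ge hz; lra.
rewrite ler_norml; have := h x y; have := h y x; rewrite (distrC y) => h1 h2.
apply/andP; lra.
Qed.

Definition deficit x : R := V (F x) - V x + m - phi x.
Local Notation D := deficit.

(** A candidate for [V x], followed for one more step, is a candidate for [V (F x)]. *)
Lemma deficit_ge0 x : 0 <= D x.
Proof.
suff : V x <= V (F x) + m - phi x by rewrite /deficit; lra.
apply: subaction_le => n y a hy.
have := @subaction_ge (F x) n.+1 y (2 * a).
rewrite iterS hy birkhoffS hy (periodic_int phi_per) -natr1.
have -> : F (x + a%:~R) = F x + (2 * a)%:~R by exact: (iter_deg2 1).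
move=> /(_ erefl); lra.
Qed.

Lemma deficit_int x (a : int) : D (x + a%:~R) = D x.
Proof.
rewrite /deficit; have -> : F (x + a%:~R) = F x + (2 * a)%:~R by exact: (iter_deg2 1).
by rewrite !(periodic_int subaction_per) (periodic_int phi_per).
Qed.

Lemma deficit_sum n x :
  birkhoff F D n x = n%:R * m - birkhoff F phi n x + V (iter n F x) - V x.
Proof.
elim: n => [|n IH]; first by rewrite !birkhoff0 mul0r; ring.
by rewrite !birkhoffS IH /deficit -natr1; ring.
Qed.

(** The coboundary V o F - V telescopes away along a periodic orbit, so this is the total deficit of
    the orbit. *)
Definition defect n p := n%:R * m - birkhoff F phi n p.

Lemma defect_sum n p : per n p -> defect n p = birkhoff F D n p.
Proof.
move=> [_ [a ha]]; rewrite deficit_sum ha (periodic_int subaction_per).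
by rewrite /defect; ring.
Qed.

Lemma defect_ge0 n p : per n p -> 0 <= defect n p.
Proof. by move=> /per_average; rewrite subr_ge0. Qed.

Lemma Lam_ge0 : 0 <= Lam.
Proof. by have := F_lip 1 0; rewrite subr0 normr1 mulr1; exact: le_trans. Qed.

Definition deficit_hold_const : R := hold_sum * Lam `^ alpha + hold_sum + H.
Local Notation CD := deficit_hold_const.

Lemma deficit_hold_const_ge0 : 0 <= CD.
Proof.
apply: addr_ge0 => //; apply: addr_ge0; last exact: hold_sum_ge0.
by apply: mulr_ge0; [exact: hold_sum_ge0|exact: powR_ge0].
Qed.

Lemma deficit_hold x y : `|D x - D y| <= CD * `|x - y| `^ alpha.
Proof.
have h1 := subaction_hold x y; have h2 := phi_hold x y.
have h3 : `|V (F x) - V (F y)| <= hold_sum * Lam `^ alpha * `|x - y| `^ alpha.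
  apply: le_trans (subaction_hold _ _) _; rewrite -mulrA ler_wpM2l ?hold_sum_ge0//.
  by rewrite -powRM ?Lam_ge0//; apply: powR_le; rewrite ?(ltW alpha_gt0).
have -> : D x - D y = (V (F x) - V (F y)) + (V y - V x) + (phi y - phi x).
  by rewrite /deficit; ring.
rewrite (le_trans (ler_normD _ _))// !mulrDl lerD//; last by rewrite distrC.
by rewrite (le_trans (ler_normD _ _))// lerD// distrC.
Qed.

Lemma iter_deg2_nat n x (k : nat) :
  iter n F (x + k%:R) = iter n F x + (2 ^ n * k)%:R.
Proof. by rewrite -[k%:R]/(k%:~R) iter_deg2 intrM rmorphXn /= natrM natrX. Qed.

Lemma iter_deg2_natB n x (k : nat) :
  iter n F (x - k%:R) = iter n F x - (2 ^ n * k)%:R.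
Proof. by apply/eqP; rewrite eq_sym subr_eq -iter_deg2_nat subrK. Qed.

Lemma deficit_natB x (k : nat) : D (x - k%:R) = D x.
Proof. by rewrite -(deficit_int (x - k%:R) k) -[k%:~R]/(k%:R) subrK. Qed.

Lemma sum_deficit_ge n eta : (0 < n)%N ->
  (forall x, exists2 i, (i < n)%N & eta < D (iter i F x)) ->
  forall x, eta <= birkhoff F D n x.
Proof.
move=> n0 h x; have [i hi Di] := h x.
rewrite /birkhoff (bigD1 (Ordinal hi)) //=.
apply: le_trans (ltW Di) _; rewrite lerDl.
by apply: sumr_ge0 => j _; exact: deficit_ge0.
Qed.

(** Otherwise any n steps would cost at least eta, and all periodic averages would be at most m -
    eta / n, against the choice of m. *)
Lemma small_deficit n eta : 0 < eta ->
  exists x, forall i, (i < n)%N -> D (iter i F x) <= eta.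
Proof.
move=> eta0; have [->|n0] := posnP n; first by exists 0.
apply: contrapT => /forallNP h.
have {}h x : exists2 i, (i < n)%N & eta < D (iter i F x).
  have /existsNP[i /not_implyP[hi /negP]] := h x.
  by rewrite -ltNge => hD; exists i.
have hS := sum_deficit_ge n0 h.
have hk k x : k%:R * eta <= birkhoff F D (k * n) x.
  elim: k x => [|k IH] x; first by rewrite mul0n birkhoff0 mul0r.
  by rewrite mulSn birkhoffD -natr1 mulrDl mul1r addrC lerD.
suff : m <= m - eta / n%:R.
  by rewrite lerBrDr gerDl leNgt divr_gt0// ltr0n.
apply: ge_sup; first by case: has_sup_average.
move=> _ [N [p [pN ->]]]; have N0 : (0 < N)%N by case: pN.
(* The length N n is at once N blocks of length n and n periods of p. *)
have := hk N p; rewrite mulnC -defect_sum; last exact: per_mul.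
rewrite /defect birkhoff_per_mul// natrM -mulrA -mulrBr => h1.
rewrite ler_pdivrMr ?ltr0n//.
have h2 : N%:R * eta / n%:R <= N%:R * m - birkhoff F phi N p.
  by rewrite ler_pdivrMr ?ltr0n// [X in _ <= X]mulrC.
have -> : (m - eta / n%:R) * N%:R = N%:R * m - N%:R * eta / n%:R by ring.
by lra.
Qed.

(** * Itineraries of orbits of small deficit *)

Section Itinerary.
Variable b : R.
Hypothesis Fb : F b = b.

Lemma iter_fix n : iter n F b = b.
Proof. by elim: n => //= n ->. Qed.

Lemma iter_fix_nat n (k : nat) : iter n F (b + k%:R) = b + (2 ^ n * k)%:R.
Proof. by rewrite iter_deg2_nat iter_fix. Qed.

(* The orbits following the itinerary w (read in base 2 with respect to the
   partition at b) include some with arbitrarily small deficit. *)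
Definition itinerary n w := (w < 2 ^ n)%N /\ forall eta, 0 < eta ->
  exists x, [/\ b + w%:R <= iter n F x, iter n F x <= b + w%:R + 1 &
    forall i, (i < n)%N -> D (iter i F x) <= eta].

Lemma itinerary_prefix j k w : itinerary (j + k) w -> itinerary j (w %/ 2 ^ k).
Proof.
have pk : (0 < 2 ^ k)%N by rewrite expn_gt0.
move=> [wlt h]; split; first by rewrite ltn_divLR// -expnD.
move=> eta /h[x [x1 x2 x3]]; exists x; rewrite addnC iterD in x1 x2; split.
- rewrite -(iter_le k) iter_fix_nat (le_trans _ x1)// lerD2l ler_nat mulnC.
  exact: leq_divM.
- rewrite -addrA natr1 -(iter_le k) iter_fix_nat (le_trans x2)//.
  by rewrite -addrA lerD2l natr1 ler_nat mulnC ltn_ceil.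
- by move=> i hi; apply: x3; rewrite ltn_addr.
Qed.

Lemma itinerary_suffix j k w : itinerary (j + k) w -> itinerary k (w %% 2 ^ k).
Proof.
have pk : (0 < 2 ^ k)%N by rewrite expn_gt0.
move=> [wlt h]; split; first by rewrite ltn_pmod.
move=> eta /h[x [x1 x2 x3]]; exists (iter j F x - (w %/ 2 ^ k)%:R).
rewrite addnC iterD in x1 x2.
have e : (w%:R : R) = (2 ^ k * (w %/ 2 ^ k))%:R + (w %% 2 ^ k)%:R.
  by rewrite {1}(divn_eq w (2 ^ k)) natrD mulnC.
split.
- by rewrite iter_deg2_natB; move: x1; rewrite e; lra.
- by rewrite iter_deg2_natB; move: x2; rewrite e; lra.
- move=> i hi; rewrite iter_deg2_natB deficit_natB -iterD; apply: x3.
  by rewrite addnC ltn_add2l.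
Qed.

(** There are finitely many words of length n: if each failed at a level of its own, the minimum of
    these levels would contradict [small_deficit]. *)
Lemma itinerary_ex n : exists w, itinerary n w.
Proof.
apply: contrapT => /forallNP h.
have {}h (w : 'I_(2 ^ n)) : exists eta, 0 < eta /\
    forall x, b + (w : nat)%:R <= iter n F x -> iter n F x <= b + (w : nat)%:R + 1 ->
      exists2 i, (i < n)%N & eta < D (iter i F x).
  have /not_andP[//|/existsNP[eta /not_implyP[eta0 h2]]] := h w.
  exists eta; split => // x x1 x2; apply: contrapT => h3; apply: h2.
  exists x; split => // i hi; rewrite leNgt; apply/negP => h4.
  by apply: h3; exists i.
have [eta_ heta] := choice h.
pose e := \big[Order.min/1]_(w : 'I_(2 ^ n)) eta_ w.
have e0 : 0 < e by apply/bigmin_gtP; split => // w _; case: (heta w).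
have [x0 hx0] := small_deficit n e0.
pose x := x0 - (Num.floor (x0 - b))%:~R.
have hx i : (i < n)%N -> D (iter i F x) <= e.
  by move=> /hx0; rewrite /x -mulrNz iter_deg2 deficit_int.
have /andP[xb xb1] : b <= x < b + 1.
  by have := frac_bound (x0 - b); rewrite /x => /andP[h1 h2]; apply/andP; lra.
pose y := iter n F x - b.
have y0 : 0 <= y by rewrite subr_ge0 -[X in X <= _](iter_fix n) iter_le.
have y2 : y < (2 ^ n)%:R.
  have := iter_fix_nat n 1; rewrite muln1 => h1.
  by rewrite ltrBlDl -h1 ltNge iter_le -ltNge.
have wlt : (Num.trunc y < 2 ^ n)%N.
  by rewrite -(ltr_nat R) (le_lt_trans _ y2)// truncn_le.
have [] := heta (Ordinal wlt) => _ /(_ x) /=.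
have t1 : (Num.trunc y)%:R <= y by rewrite truncn_le.
have t2 : y < (Num.trunc y).+1%:R by exact: truncnS_gt.
case; rewrite ?/y -?natr1 in t1 t2 *; [lra|lra|].
move=> i hi; rewrite ltNge => /negP; apply.
by rewrite (le_trans (hx _ hi))// /e; exact: bigmin_le_cond.
Qed.

(** Edges are words of length 2 n for the sake of accuracy: the second half keeps two orbits within
    distance 1 for n further steps, so during the first half they agree up to lam^-n. *)
Lemma cycle_periodic n (s : seq 'I_(2 ^ n)) : (0 < n)%N -> (0 < size s)%N ->
  cycle (@follows itinerary n) s -> exists p, per (size s * n) p /\
    defect (size s * n) p <= (size s * n)%:R * ((1 + CD) * q ^+ n).
Proof.
move=> n0 l0 cs.
have [u [ulast ulink]] : exists u : nat -> nat, (forall i, u (i + size s)%N = u i) /\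
    forall i, (u i < 2 ^ n)%N /\ itinerary (n + n) (u i * 2 ^ n + u i.+1).
  case: s l0 cs => // x0 s _ /(pathP x0) cs.
  exists (fun i => nth x0 (x0 :: s) (i %% (size s).+1)); split.
    by move=> i /=; rewrite modnDr.
  move=> i; split; first exact: ltn_ord.
  have hi : (i %% (size s).+1 < size (rcons s x0))%N by rewrite size_rcons ltn_mod.
  have /asboolP := cs _ hi; congr (itinerary _ (_ * _ + _)).
    by rewrite -rcons_cons nth_rcons /= ltn_mod ltnS.
  have -> : (i.+1 %% (size s).+1 = (i %% (size s).+1).+1 %% (size s).+1)%N.
    by rewrite -[in RHS]addn1 modnDml addn1.
  rewrite nth_rcons.
  move: hi; rewrite size_rcons; move: (i %% _)%N => j hj.
  have [js|js] := ltnP j (size s); first by rewrite modn_small.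
  have -> : j = size s by lia.
  by rewrite eqxx modnn.
set l := size s in l0 ulast *.
(* The integer spelled by the first i blocks of the unrolled cycle. *)
pose W := fix W i := if i is j.+1 then (2 ^ n * W j + u j)%N else 0%N.
have Wlt i : (W i < 2 ^ (i * n))%N.
  elim: i => [|i IH]; first by rewrite mul0n.
  rewrite mulSn expnD /=; have := (ulink i).1; nia.
have [p /andP[pb pb1] hp] : exists2 p, b <= p <= b + 1 & iter (l * n) F p - p = (W l)%:R.
  apply: (@IVT_solve (fun y => iter (l * n) F y - y)).
  - by move=> y; apply: cvgB; [exact: iter_cont|exact: cvg_id].
  - by rewrite lerDl.
  - rewrite iter_fix subrr ler0n /=; have := iter_fix_nat (l * n) 1; rewrite muln1 => ->.
    have : (W l).+1%:R <= (2 ^ (l * n))%:R :> R by rewrite ler_nat.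
    by rewrite -natr1; lra.
(* The integer translate of the orbit point at time i n that lies in [b, b + 1], as [yI] will
   show. *)
pose y i := iter (i * n) F p - (W i)%:R.
have yS i : iter n F (y i) = y i.+1 + (u i)%:R.
  by rewrite /y iter_deg2_natB -iterD mulSn /= natrD; ring.
have yl : y l = p by rewrite /y -hp; ring.
have yper i : y (i + l)%N = y i.
  elim: i => [|i IH]; first by rewrite add0n yl /y mul0n /= subr0.
  by have := yS (i + l)%N; rewrite IH yS ulast addSn => /addIr.
have ykl k : y (k * l)%N = p.
  by elim: k => [|k IH]; [rewrite mul0n /y mul0n /= subr0|rewrite mulSn addnC yper].
have yI i : b <= y i <= b + 1.
  (* The n-th iterate maps [b, b + 1] onto [b, b + 2^n], so the inverse branches used here preserve
     [b, b + 1] and membership passes to smaller indices; periodicity provides arbitrarily large N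
     to start from. *)
  have back N : b <= y N <= b + 1 -> forall j, b <= y (N - j)%N <= b + 1.
    move=> yN; elim=> [|j IH]; first by rewrite subn0.
    have [jN|jN] := leqP N j.
      have -> : (N - j.+1 = 0)%N by apply/eqP; exact: leqW.
      by move: IH; have -> : (N - j = 0)%N by exact/eqP.
    have e : (N - j = (N - j.+1).+1)%N by rewrite subnSK.
    move: IH; rewrite e => /andP[h1 h2].
    have := yS (N - j.+1)%N; set z := y (N - j.+1)%N => hz.
    have hu : (u (N - j.+1)%N).+1%:R <= (2 ^ n)%:R :> R by rewrite ler_nat; case: (ulink (N - j.+1)%N).
    rewrite -natr1 in hu; have hu0 : 0 <= (u (N - j.+1)%N)%:R :> R by [].
    rewrite -(iter_le n b z) -(iter_le n z) iter_fix.
    have := iter_fix_nat n 1; rewrite muln1 => ->; rewrite hz; apply/andP; lra.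
  have := back (i * l)%N; rewrite ykl pb pb1 => /(_ isT (i * l - i)%N).
  by rewrite subKn// leq_pmulr.
have Dy i r : (r < n)%N -> D (iter r F (y i)) <= (1 + CD) * q ^+ n.
  move=> rn; have [_ hL] := (ulink i).2.
  have qn0 : 0 < q ^+ n by rewrite exprn_gt0// hold_ratio_gt0.
  (* The level q^n matches the accuracy of the shadowing. *)
  have [x [x1 x2 x3]] := hL _ qn0.
  have e : iter (n + n) F (y i) = y i.+2 + (u i * 2 ^ n + u i.+1)%:R.
    by rewrite iterD yS iter_deg2_nat yS natrD mulnC; ring.
  have /andP[z1 z2] := yI i.+2.
  have d1 : `|iter (n + n) F (y i) - iter (n + n) F x| <= 1.
    by rewrite e ler_norml; apply/andP; lra.
  have d2 : lam ^+ n * `|iter r F (y i) - iter r F x| <= 1.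
    apply: le_trans d1; apply: le_trans (iter_norm n _ _) _.
    rewrite -!iterD; apply: le_trans (iter_mono (n - r) _ _) _.
    by rewrite -!iterD addnCA subnK// ltnW.
  have := powR_contractX (normr_ge0 _) d2; rewrite powR1 mulr1 => d3.
  have := deficit_hold (iter r F (y i)) (iter r F x).
  have := x3 r; rewrite ltn_addr// => /(_ isT) x4.
  have : CD * `|iter r F (y i) - iter r F x| `^ alpha <= CD * q ^+ n.
    by rewrite ler_wpM2l// deficit_hold_const_ge0.
  rewrite ler_norml => h1 /andP[_ h2]; lra.
have pp : per (l * n) p.
  split; first by rewrite muln_gt0 l0.
  by exists (W l); rewrite -[(W l)%:~R]/((W l)%:R) -hp; ring.
exists p; split => //; rewrite defect_sum//.
elim: l {l0 ulast hp yl yper ykl pp} => [|l IH].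
  by rewrite mul0n birkhoff0 mul0r.
rewrite mulSn addnC birkhoffD natrD mulrDl lerD//.
rewrite mulr_natl -[X in _ *+ X]card_ord -sumr_const; apply: ler_sum => r _.
have -> : iter (l * n) F p = y l + (W l)%:R by rewrite /y subrK.
by rewrite iter_deg2_nat -(deficit_natB _ (2 ^ r * W l)) addrK Dy.
Qed.

End Itinerary.

(** The deficit decays like q^n in the word length n, while the period is at most n exp (a n) with a
    rate [a] that can be chosen. *)
Lemma periodic_small_defect (K : nat) eps : 0 < eps ->
  exists n p, per n p /\ defect n p * n%:R ^+ K <= eps.
Proof.
move=> eps0; have [b Fb] := fixpoint_exists.
pose g := - ln q.
have g0 : 0 < g by rewrite oppr_gt0 ln_lt0// hold_ratio_gt0 hold_ratio_lt1.
have qE : q = expR (- g) by rewrite /g opprK lnK// posrE hold_ratio_gt0.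
(* With this rate the (K + 1)-th power of the period is of order exp (g n / 2) at most, which leaves
   half of the decay of q^n. The extra power is for the number of terms in the defect. *)
pose a := g / (4 * K.+1%:R).
have a0 : 0 < a by rewrite divr_gt0// mulr_gt0.
pose C := (1 + CD) * a^-1 ^+ K.+1.
have C0 : 0 < C.
  by rewrite mulr_gt0 ?exprn_gt0 ?invr_gt0// ltr_wpDr// deficit_hold_const_ge0.
have [n nN [s [s0 sn cs]]] := @short_cycle R (itinerary b)
  (fun n w => @proj1 _ _) (@itinerary_prefix b Fb) (@itinerary_suffix b)
  (@itinerary_ex b Fb) a (Num.trunc (2 * C / (eps * g))).+1 a0.
have n0 : (0 < n)%N by exact: leq_trans nN.
have [p [pp hp]] := cycle_periodic Fb n0 s0 cs.
exists (size s * n)%N, p; split => //.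
set N := (size s * n)%N in pp hp *.
set E := expR (a * n%:R).
have NE : N%:R <= a^-1 * E ^+ 2.
  have hn : n%:R <= a^-1 * E.
    by rewrite ler_pdivlMl//; apply: le_trans (expR_ge1Dx _); lra.
  have -> : a^-1 * E ^+ 2 = E * (a^-1 * E) by ring.
  by rewrite natrM ler_pM.
have CD1 : 0 <= (1 + CD) * q ^+ n.
  apply: mulr_ge0; last by rewrite exprn_ge0// ltW// hold_ratio_gt0.
  by apply: addr_ge0 => //; exact: deficit_hold_const_ge0.
apply: (@le_trans _ _ (N%:R ^+ K.+1 * ((1 + CD) * q ^+ n))).
  by rewrite exprSr -mulrA mulrC ler_wpM2l ?exprn_ge0.
apply: (@le_trans _ _ ((a^-1 * E ^+ 2) ^+ K.+1 * ((1 + CD) * q ^+ n))).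
  by rewrite ler_wpM2r// lerXn2r// nnegrE// mulr_ge0 ?exprn_ge0 ?expR_ge0// invr_ge0 ltW.
have -> : (a^-1 * E ^+ 2) ^+ K.+1 * ((1 + CD) * q ^+ n) = C * expR (- (g / 2 * n%:R)).
  rewrite exprMn -exprM /E /C -expRM_natr qE -expRM_natr.
  have -> : a^-1 ^+ K.+1 * expR (a * n%:R * (2 * K.+1)%:R) * ((1 + CD) * expR (- g * n%:R))
     = (1 + CD) * a^-1 ^+ K.+1 * (expR (a * n%:R * (2 * K.+1)%:R) * expR (- g * n%:R)) by ring.
  rewrite -expRD; congr (_ * expR _).
  rewrite natrM /a; field.
  by rewrite /= addrC natr1 pnatr_eq0.
rewrite expRN ler_pdivrMr ?expR_gt0// -ler_pdivrMl//.
apply: le_trans (expR_ge1Dx _).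
have h1 : 2 * C / (eps * g) < n%:R.
  by apply: lt_le_trans (truncnS_gt _) _; rewrite ler_nat.
have h2 : 2 * C / (eps * g) * (g / 2) < n%:R * (g / 2) by rewrite ltr_pM2r// divr_gt0.
have h3 : 2 * C / (eps * g) * (g / 2) = eps^-1 * C by field; rewrite !gt_eqF.
by rewrite -h3; lra.
Qed.

(** * Splitting periodic orbits at close returns *)

Definition separated n p g := forall i j (a : int), (i < j < n)%N ->
  g <= `|iter i F p - iter j F p - a%:~R|.

(** A close return cuts the orbit into two loops with gaps t and -t, and each closes up at a cost of
    [closing_const] times g^alpha. The bound holds for the sum of both defects, hence for each of
    them, as they are nonnegative. *)
Lemma close_split n p d g : per n p -> defect n p <= d ->
  0 <= g -> ~ separated n p g ->
  exists n1 p1 n2 p2, [/\ per n1 p1, per n2 p2, (n1 + n2 = n)%N,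
    defect n1 p1 <= d + 2 * closing_const * g `^ alpha &
    defect n2 p2 <= d + 2 * closing_const * g `^ alpha].
Proof.
move=> pn hd g0 /existsNP[i /existsNP[j /existsNP[a /not_implyP[/andP[ij jn]]]]].
move=> /negP; rewrite -ltNge; set t := _ - _ => tg.
have [n0 [w hw]] := pn.
have k0 : (0 < j - i)%N by rewrite subn_gt0.
have l0 : (0 < n - (j - i))%N by clear -ij jn; lia.
have jin : (j - i <= n)%N by clear -ij jn; lia.
have e1 : iter (j - i) F (iter i F p) = iter i F p + (- a)%:~R + (- t).
  by rewrite -iterD subnK ?(ltnW ij)// /t rmorphN /=; ring.
have e2 : iter (n - (j - i)) F (iter j F p) = iter j F p + (a + 2 ^+ i * w)%:~R + t.
  rewrite -iterD (_ : n - (j - i) + j = i + n)%N; last by clear -ij jn; lia.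
  by rewrite iterD hw iter_deg2 intrD /t; ring.
have [p1 [hp1 _ s1]] := closing k0 e1; have [p2 [hp2 _ s2]] := closing l0 e2.
have pp1 : per (j - i) p1 by split => //; exists (- a).
have pp2 : per (n - (j - i)) p2 by split => //; exists (a + 2 ^+ i * w).
have S12 : birkhoff F phi (j - i) (iter i F p) + birkhoff F phi (n - (j - i)) (iter j F p)
   = birkhoff F phi n p.
  rewrite -(birkhoff_per_iter i pn) -{2}(subnK jin).
  by rewrite addnC birkhoffD -iterD subnK// ltnW.
have tt : `|t| `^ alpha <= g `^ alpha by apply: powR_le; [exact: ltW|exact: normr_ge0|exact: ltW].
have ct : closing_const * `|t| `^ alpha <= closing_const * g `^ alpha.
  by rewrite ler_wpM2l ?closing_const_ge0.
rewrite normrN in s1; move: s1 s2; rewrite !ler_norml => /andP[s11 s12] /andP[s21 s22].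
have d1 := defect_ge0 pp1; have d2 := defect_ge0 pp2.
exists (j - i)%N, p1, (n - (j - i))%N, p2; split => //; first by rewrite subnKC.
- move: d1 d2 hd; rewrite /defect (natrB _ jin) -S12.
  by clear -ct s11 s12 s21 s22; lra.
- move: d1 d2 hd; rewrite /defect (natrB _ jin) -S12.
  by clear -ct s11 s12 s21 s22; lra.
Qed.

(** Were no orbit separated enough, every orbit could be split down to period 1, where separation is
    void. The original defect would then be at least delta / L^s with s about log2 n, that is, a
    negative power of n, against [periodic_small_defect]. *)
Lemma exists_separated_periodic delta : 0 < delta ->
  exists n p g, [/\ per n p, 0 < g <= 1, separated n p g & defect n p <= delta * g `^ alpha].
Proof.
move=> delta0; apply: contrapT => no.
have {}no n p g : per n p -> 0 < g -> g <= 1 -> defect n p <= delta * g `^ alpha ->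
    ~ separated n p g.
  by move=> pn g0 g1 hd sep; apply: no; exists n, p, g; rewrite g0 g1.
pose L := 1 + 2 * closing_const / delta.
have L1 : 1 <= L.
  rewrite lerDl; apply: divr_ge0; last exact: ltW.
  by apply: mulr_ge0 => //; exact: closing_const_ge0.
(* Splitting at a close return halves the period and multiplies the defect by at most L. *)
have main s n p d : (n <= 2 ^ s)%N -> per n p -> 0 < d -> defect n p <= d -> delta <= L ^+ s * d.
  elim: s n p d => [|s IH] n p d ns pn d0 hd.
    rewrite expr0 mul1r leNgt; apply/negP => dd.
    apply: (no n p 1) => //; first by rewrite powR1 mulr1 (le_trans hd)// ltW.
    by move=> i j a; move: ns; rewrite expn0; clear; lia.
  have [dd|dd] := leP delta d.
    by rewrite (le_trans dd)// ler_peMl ?(ltW d0)// exprn_ege1.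
  (* The scale at which the admissible defect, delta g^alpha, equals d; a failure of separation at
     this scale turns d into L d. *)
  pose g := (d / delta) `^ alpha^-1.
  have dd0 : 0 < d / delta by rewrite divr_gt0.
  have g0 : 0 < g by rewrite powR_gt0.
  have g1 : g <= 1.
    by apply: powR_le_one; rewrite ?invr_ge0 ?(ltW alpha_gt0) ?(ltW dd0)// ler_pdivrMr// mul1r ltW.
  have ga : g `^ alpha = d / delta by rewrite -powRrM mulVf ?gt_eqF// powRr1// ltW.
  have hg : defect n p <= delta * g `^ alpha by rewrite ga mulrC divfK// gt_eqF.
  have [n1 [p1 [n2 [p2 [pp1 pp2 n12 h1 h2]]]]] := close_split pn hd (ltW g0) (no _ _ _ pn g0 g1 hg).
  have dL : d + 2 * closing_const * g `^ alpha = L * d by rewrite ga /L; ring.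
  rewrite dL in h1 h2.
  have Ld0 : 0 < L * d by rewrite mulr_gt0// (lt_le_trans ltr01).
  rewrite exprSr -mulrA; rewrite expnS in ns.
  have [n12le|n12le] := leqP n1 n2; [apply: (IH n1 p1)|apply: (IH n2 p2)] => //.
    by clear -n12 ns n12le; lia.
  by clear -n12 ns n12le; lia.
pose K := Num.trunc L.
(* Bounds L^s by a power of 2^s, hence by a polynomial in n. *)
have LK : L <= 2 ^+ K.+1.
  rewrite (le_trans (ltW (truncnS_gt L)))// -natrX ler_nat -/K.
  by apply: ltnW; exact: ltn_expl.
have eps0 : 0 < delta / 2 / 2 ^+ K.+1 by rewrite !divr_gt0// exprn_gt0.
have [n [p [pn hd]]] := periodic_small_defect K.+1 eps0.
have n0 : (0 < n)%N by case: pn.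
have nK : 0 < (n%:R : R) ^+ K.+1 by rewrite exprn_gt0// ltr0n.
pose s := up_log 2 n.
have ns : (n <= 2 ^ s)%N by exact: up_logP.
have s2n : (2 ^ s <= 2 * n)%N.
  case: (ltnP 1 n) => [n1|n1]; last by rewrite /s (_ : n = 1%N)//; clear -n0 n1; lia.
  have := up_log_gtn (isT : 1 < 2)%N n1; rewrite -/s.
  case: s {ns} => [|s']; first by rewrite expn0; clear -n0; lia.
  by rewrite /= expnS; clear; lia.
have := main s n p (delta / 2 / 2 ^+ K.+1 / n%:R ^+ K.+1) ns pn.
rewrite divr_gt0// ler_pdivlMr// hd => /(_ isT isT).
apply/negP; rewrite -ltNge.
have h1 : L ^+ s <= 2 ^+ K.+1 * n%:R ^+ K.+1.
  rewrite -exprMn (@le_trans _ _ ((2 ^+ K.+1) ^+ s))//.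
    by rewrite lerXn2r// nnegrE ?exprn_ge0// (le_trans ler01).
  rewrite -exprM mulnC exprM -natrX lerXn2r// ?nnegrE//.
  by rewrite -natrM ler_nat.
apply: (@le_lt_trans _ _ (2 ^+ K.+1 * n%:R ^+ K.+1 * (delta / 2 / 2 ^+ K.+1 / n%:R ^+ K.+1))).
  by rewrite ler_wpM2r// !mulr_ge0 ?invr_ge0 ?exprn_ge0// ltW.
have -> : 2 ^+ K.+1 * n%:R ^+ K.+1 * (delta / 2 / 2 ^+ K.+1 / n%:R ^+ K.+1) = delta / 2.
  have A0 : (2 : R) ^+ K.+1 != 0 by rewrite expf_neq0// pnatr_eq0.
  have B0 : (n%:R : R) ^+ K.+1 != 0 by rewrite gt_eqF.
  move: (2 ^+ K.+1) (n%:R ^+ K.+1) A0 B0 => A B A0 B0.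
  by field; rewrite A0 B0.
by rewrite ltr_pdivrMr// ltr_pMr// ltr1n.
Qed.

(** * The locking inequality around a separated periodic orbit *)

Section Locking.
Variables (V : R -> R) (CV VB : R) (n : nat) (p r tau l E : R) (k : nat).
Hypothesis V_per : forall x, V (x + 1) = V x.
Hypothesis V_hold : forall x y, `|V x - V y| <= CV * `|x - y| `^ alpha.
Hypothesis V_osc : forall x y, V x - V y <= VB.
Hypothesis CV_ge0 : 0 <= CV.
Hypothesis pn : per n p.

Definition orbit_lift y := exists j (a : int), y = iter j F p + a%:~R.

Definition near_orbit x := exists2 y, orbit_lift y & `|x - y| < r.

Definition orbit_average := birkhoff F phi n p / n%:R.
Local Notation A := orbit_average.

(** V is an arbitrary periodic Hölder function here, so that the sub-action of one map can serve for
    the maps near it. *)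
Definition excess x := phi x - A + V x - V (F x).
Local Notation Psi := excess.

Definition far_indic x : R := (`[< ~ near_orbit x >])%:R.

Hypothesis r_gt0 : 0 < r.
Hypothesis l_ge0 : 0 <= l.
Hypothesis tau_ge0 : 0 <= tau.
Hypothesis E_ge0 : 0 <= E.
Hypothesis orbit_sep : forall y z, orbit_lift y -> orbit_lift z ->
  `|y - z| < (Lam + 1) * r -> y = z.
Hypothesis excess_near : forall x y, orbit_lift y -> `|x - y| < r ->
  Psi x <= tau + E * `|x - y| `^ alpha.
Hypothesis excess_far : forall x, ~ near_orbit x -> Psi x <= - l.
(** The price of an excursion near the orbit: whole periods, ending at distance at most lam^-k r
    from the orbit; at most n + k leftover steps at [tau] each; the geometric sum of the E terms. *)
Hypothesis budget : (hold_sum + 2 * CV) * q ^+ k * r `^ alpha + (n + k)%:R * tau +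
  E / (1 - q) * r `^ alpha <= l / 2.

Lemma orbit_lift_iter y i : orbit_lift y -> orbit_lift (iter i F y).
Proof.
move=> [j [a ->]]; exists (i + j)%N, (2 ^+ i * a).
by rewrite iter_deg2 -iterD.
Qed.

Lemma orbit_lift_per y : orbit_lift y -> per n y /\ birkhoff F phi n y = n%:R * A.
Proof.
have n0 : (0 < n)%N by case: pn.
move=> [j [a ->]]; split; first by apply: per_int; exact: per_iter.
rewrite birkhoff_int birkhoff_per_iter// /A mulrC divfK//.
by rewrite pnatr_eq0 -lt0n.
Qed.

Lemma excess_sum N x :
  birkhoff F Psi N x = birkhoff F phi N x - N%:R * A + V x - V (iter N F x).
Proof.
elim: N => [|N IH]; first by rewrite !birkhoff0 mul0r; ring.
by rewrite !birkhoffS IH /excess -natr1; ring.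
Qed.

(** The image of the shadowed point and the orbit point near the next iterate are less than (Lam +
    1) r apart, so [orbit_sep] identifies them. *)
Lemma shadow x y T : orbit_lift y -> `|x - y| < r ->
  (forall i, (i < T)%N -> near_orbit (iter i F x)) ->
  forall i, (i < T)%N -> `|iter i F x - iter i F y| < r.
Proof.
move=> Oy xy h; elim=> [//|i IH] iT.
have [z Oz xz] := h _ iT.
suff -> : iter i.+1 F y = z by [].
apply: orbit_sep => //; first exact: orbit_lift_iter.
have h1 : `|iter i.+1 F x - iter i.+1 F y| <= Lam * r.
  by rewrite (le_trans (F_lip _ _))// ler_wpM2l ?Lam_ge0// ltW// IH// ltnW.
rewrite distrC in h1.
have -> : iter i.+1 F y - z = (iter i.+1 F y - iter i.+1 F x) + (iter i.+1 F x - z) by ring.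
by rewrite (le_lt_trans (ler_normD _ _))// mulrDl mul1r ler_ltD.
Qed.

(** Expansivity: the distance to the shadowed orbit point grows like lam^i yet stays below r. *)
Lemma near_orbit_always x : (forall i, near_orbit (iter i F x)) -> orbit_lift x.
Proof.
move=> h; have [y Oy xy] := h 0%N.
have sh i := shadow Oy xy (fun j (_ : (j < i.+1)%N) => h j) (ltnSn i).
suff -> : x = y by [].
apply/eqP; rewrite -subr_eq0 -normr_eq0; apply/negPn/negP => d0.
have {}d0 : 0 < `|x - y| by rewrite lt_neqAle eq_sym d0 normr_ge0.
have bern i : 1 + i%:R * (lam - 1) <= lam ^+ i.
  elim: i => [|i IH]; first by rewrite mul0r addr0.
  have l1 : 0 <= lam - 1 by rewrite subr_ge0 ltW.
  rewrite exprS (le_trans _ (ler_wpM2l (ltW lam_gt0) IH))// -natr1.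
  have : 0 <= i%:R * ((lam - 1) * (lam - 1)) by rewrite !mulr_ge0.
  lra.
pose i := (Num.trunc (r / `|x - y| / (lam - 1))).+1.
have := truncnS_gt (r / `|x - y| / (lam - 1)); rewrite -/i => hi.
rewrite ltr_pdivrMr ?subr_gt0// ltr_pdivrMr// in hi.
have h1 := le_lt_trans (iter_norm i x y) (sh i).
have : i%:R * (lam - 1) * `|x - y| <= lam ^+ i * `|x - y|.
  by rewrite ler_wpM2r// (le_trans _ (bern i))// lerDr.
lra.
Qed.

(** Going back in time, the alpha-th powers of the distances decrease by the factor q, so the last
    one, at most r^alpha, dominates their sum. *)
Lemma near_sum t x y : orbit_lift y ->
  (forall i, (i < t)%N -> `|iter i F x - iter i F y| < r) ->
  birkhoff F Psi t x <= t%:R * tau + E / (1 - q) * r `^ alpha.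
Proof.
have q1 : 0 < 1 - q by rewrite subr_gt0 hold_ratio_lt1.
have Eq : 0 <= E / (1 - q) by rewrite divr_ge0// ltW.
case: t => [|t] Oy h; first by rewrite birkhoff0 mul0r add0r mulr_ge0 ?powR_ge0.
have step i : (i < t.+1)%N -> Psi (iter i F x) <= tau + E * `|iter i F x - iter i F y| `^ alpha.
  by move=> it; apply: excess_near; [exact: orbit_lift_iter|exact: h].
have main i : (i < t.+1)%N -> birkhoff F Psi i.+1 x <=
    i.+1%:R * tau + E / (1 - q) * `|iter i F x - iter i F y| `^ alpha.
  elim: i => [|i IH] it.
    rewrite birkhoffS birkhoff0 add0r mul1r (le_trans (step _ it))// lerD2l.
    rewrite ler_wpM2r ?powR_ge0// ler_peMr// invf_ge1//.
    by rewrite gerBl ltW// hold_ratio_gt0.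
  have h1 : `|iter i F x - iter i F y| `^ alpha <= q * `|iter i.+1 F x - iter i.+1 F y| `^ alpha.
    by apply: powR_contract => //; have := iter_norm 1 (iter i F x) (iter i F y); rewrite expr1.
  have h2 := IH (ltnW it); have h3 := step _ it.
  have h4 := ler_wpM2l Eq h1.
  rewrite birkhoffS -natr1 mulrDl mul1r.
  set d := `|iter i.+1 F x - iter i.+1 F y| `^ alpha in h3 h4 *.
  have -> : E / (1 - q) * d = E / (1 - q) * (q * d) + E * d by field; rewrite gt_eqF.
  lra.
rewrite (le_trans (main t _))// lerD2l ler_wpM2l//.
by apply: powR_le; [exact: ltW|exact: normr_ge0|apply: ltW; exact: h].
Qed.

(* Along an excursion near the orbit, whole periods contribute only their
   (geometrically small) distance to the orbit; what is left has length at most n + k. *)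
Lemma run_sum T x : (forall i, (i < T)%N -> near_orbit (iter i F x)) ->
  birkhoff F Psi T x <= l / 2.
Proof.
have n0 : (0 < n)%N by case: pn.
have [->|T0] := posnP T; first by move=> _; rewrite birkhoff0 divr_ge0.
move=> h; have [y Oy xy] := h _ T0; have sh := shadow Oy xy h.
apply: le_trans budget.
(* The largest number of whole periods after which k + 1 steps remain: the orbit is then still
   shadowed k steps after time N, which makes the distance at time N at most lam^-k r. *)
pose c := ((T - k.+1) %/ n)%N; pose N := (c * n)%N.
have NT : (N <= T - k.+1)%N by exact: leq_divM.
have [c0|c0] := posnP c.
  have Tle : (T <= n + k)%N.
    have : (T - k.+1 < n)%N by rewrite -[X in (_ < X)%N]mul1n -ltn_divLR// -/c c0.
    by clear; lia.
  rewrite -addrA -[X in X <= _]add0r lerD//.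
    apply: mulr_ge0; last exact: powR_ge0.
    apply: mulr_ge0; last by rewrite exprn_ge0// ltW// hold_ratio_gt0.
    by apply: addr_ge0; [exact: hold_sum_ge0|exact: mulr_ge0].
  by rewrite (le_trans (near_sum Oy sh))// lerD2r ler_wpM2r// ler_nat.
have NkT : (N + k < T)%N.
  have : (0 < T - k.+1)%N by rewrite (leq_trans _ NT)// muln_gt0 c0.
  by clear -NT; lia.
have tle : (T - N <= n + k)%N.
  have : (T - k.+1 < N + n)%N by rewrite /N -mulSnr -ltn_divLR.
  by clear; lia.
have TE : (T = N + (T - N))%N by clear -NkT; lia.
have [pN [aN haN]] : per N y by apply: per_mul => //; case: (orbit_lift_per Oy).
set d := `|iter N F x - iter N F y|.
have dq : d `^ alpha <= q ^+ k * r `^ alpha.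
  apply: powR_contractX; first exact: normr_ge0.
  apply: le_trans (iter_norm k _ _) _.
  by rewrite -!iterD addnC ltW// sh.
have xyd : `|x - y| `^ alpha <= d `^ alpha.
  by apply: powR_le; [exact: ltW|exact: normr_ge0|exact: iter_mono].
have b1 := birkhoff_close N x y.
have b2 : birkhoff F phi N y = N%:R * A.
  have [py hy] := orbit_lift_per Oy.
  by rewrite birkhoff_per_mul// hy natrM mulrA.
have v1 := V_hold x y; have v2 := V_hold (iter N F y) (iter N F x).
rewrite (distrC (iter N F y)) -/d in v2.
have v3 : V (iter N F y) = V y by rewrite haN (periodic_int V_per).
have n1 : birkhoff F Psi (T - N) (iter N F x) <=
    (T - N)%:R * tau + E / (1 - q) * r `^ alpha.
  apply: (near_sum (y := iter N F y)); first exact: orbit_lift_iter.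
  by move=> i hi; rewrite -!iterD sh// addnC; move: hi; clear -NkT; lia.
have n2 : (T - N)%:R * tau <= (n + k)%:R * tau by rewrite ler_wpM2r// ler_nat.
rewrite TE birkhoffD excess_sum.
rewrite b2 -/d in b1; rewrite v3 in v2.
have c1 := ler_wpM2l hold_sum_ge0 dq.
have c2 := ler_wpM2l CV_ge0 dq; have c3 := ler_wpM2l CV_ge0 xyd.
move: b1 v1 v2; rewrite !ler_norml => /andP[_ b1] /andP[_ v1] /andP[_ v2].
move: c1 c2; set Q := q ^+ k * r `^ alpha => c1 c2.
rewrite -mulrA -/Q mulrDl.
lra.
Qed.

(** A far step earns l: one half pays for the indicator, the other for the gain, at most l / 2, of
    the excursion that may follow. Only an initial excursion stays unpaid. *)
Lemma locking N x :
  birkhoff F phi N x + l / 2 * birkhoff F far_indic N x <= N%:R * A + (l / 2 + VB).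
Proof.
pose chi x := Psi x + l / 2 * far_indic x.
have chiE M z : birkhoff F chi M z = birkhoff F Psi M z + l / 2 * birkhoff F far_indic M z.
  elim: M => [|M IH]; first by rewrite !birkhoff0 mulr0 addr0.
  by rewrite !birkhoffS IH /chi; ring.
have chi_far z : ~ near_orbit z -> chi z <= - (l / 2).
  move=> hz; have := excess_far hz; rewrite /chi /far_indic asboolT// mulr1.
  lra.
have chi_near z : near_orbit z -> chi z = Psi z.
  by move=> hz; rewrite /chi /far_indic asboolF ?mulr0 ?addr0//; apply/contrapT.
suff main M z : (birkhoff F chi M z <= l / 2) /\ (~ near_orbit z -> birkhoff F chi M z <= 0).
  have [h _] := main N x; rewrite chiE excess_sum in h.
  have := V_osc (iter N F x) x; move: h; lra.
have [m] := ubnP M; elim: m M z => // m IH [|M] z; rewrite ltnS => Mm.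
  by rewrite birkhoff0 divr_ge0.
have Pfar : ~ near_orbit z -> birkhoff F chi M.+1 z <= 0.
  move=> hz; rewrite birkhoffSl.
  have := chi_far _ hz; have [] := IH M (F z) Mm; lra.
split => //.
have [nz|fz] := pselect (near_orbit z); last first.
  by apply: le_trans (Pfar fz) _; rewrite divr_ge0.
have run t : (t <= M.+1)%N -> (forall i, (i < t)%N -> near_orbit (iter i F z)) ->
    birkhoff F chi t z <= l / 2.
  move=> _ h; rewrite (_ : birkhoff F chi t z = birkhoff F Psi t z); first exact: run_sum.
  by apply: eq_bigr => i _; rewrite chi_near//; exact: h.
have [all_near|] := pselect (forall i, (i < M.+1)%N -> near_orbit (iter i F z)).
  exact: run all_near.
move=> /existsNP[i0 /not_implyP[i0M far0]].
have ex : exists i, `[< ~ near_orbit (iter i F z) >] by exists i0; exact/asboolP.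
(* The first time t away from the orbit ends the initial excursion; from there on the sum is at most
   0. *)
case: (ex_minnP ex) => t /asboolP ft tmin.
have t0 : (0 < t)%N by case: t ft {tmin}.
have tM : (t < M.+1)%N by apply: leq_ltn_trans i0M; apply: tmin; exact/asboolP.
have h1 : birkhoff F chi t z <= l / 2.
  apply: run; first exact: ltnW.
  move=> i it; apply: contrapT => /asboolP/tmin; by rewrite leqNgt it.
have [] := IH (M.+1 - t)%N (iter t F z); first by move: t0 tM Mm; clear; lia.
move=> _ /(_ ft) h2.
by rewrite -(subnKC (ltnW tM)) birkhoffD; move: h1 h2; lra.
Qed.

End Locking.

End Expanding.

(** * Bump perturbations *)

Section Derivatives.
Variable R : realType.
Implicit Types (f df : R -> R).

Lemma is_derive_quadratic f (x d C : R) :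
  (forall h, `|f (x + h) - f x - h * d| <= C * h ^+ 2) -> is_derive x 1 f d.
Proof.
move=> hf.
have C0 : 0 <= C.
  by have := hf 1; rewrite expr1n mulr1; exact: le_trans.
suff lim : (fun h : R => h^-1 *: ((f \o shift x) (h *: 1) - f x)) @ 0^' --> d.
  apply: DeriveDef; first by apply/cvg_ex; exists d.
  exact: cvg_lim.
apply/cvgrPdist_le => e e0.
near=> h.
have h0 : h != 0 by near: h; exact: nbhs_dnbhs_neq.
have hC : `|h| <= e / (C + 1).
  near: h; apply: dnbhs0_le; rewrite divr_gt0//; lra.
rewrite /= /GRing.scale /= mulr1.
have -> : d - h^-1 * (f (h + x) - f x) = - (h^-1 * (f (x + h) - f x - h * d)).
  by rewrite [h + x]addrC; field.
rewrite normrN normrM normfV ler_pdivrMl ?normr_gt0//.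
apply: le_trans (hf h) _.
have -> : h ^+ 2 = `|h| * `|h| by rewrite -expr2 real_normK ?num_real.
rewrite mulrCA ler_pM2l ?normr_gt0//.
apply: le_trans (ler_wpM2l C0 hC) _.
by rewrite mulrCA ger_pMr// ler_pdivrMr ?mul1r; lra.
Unshelve. all: by end_near.
Qed.

Lemma is_derive_local f g (x d e : R) : 0 < e ->
  (forall z, `|z - x| < e -> f z = g z) -> is_derive x 1 g d -> is_derive x 1 f d.
Proof.
move=> e0 fg; apply: near_eq_is_derive; near=> z.
by apply/esym/fg; rewrite distrC; near: z; exact: nbhsx_ballx.
Unshelve. all: by end_near.
Qed.

Lemma is_derive_continuous f df : (forall x : R, is_derive x 1 f (df x)) -> continuous f.
Proof.
move=> hf x; apply: differentiable_continuous; apply/derivable1_diffP.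
by have [] := hf x.
Qed.

Lemma MVT_derive f df x y : (forall x : R, is_derive x 1 f (df x)) -> x <= y ->
  exists2 c, x <= c <= y & f y - f x = df c * (y - x).
Proof.
move=> hf; rewrite le_eqVlt => /predU1P[->|xy].
  by exists y; rewrite ?lexx// !subrr mulr0.
have [|c] := @MVT R f df x y xy (fun z _ => hf z).
  exact: continuous_subspaceT (is_derive_continuous hf).
by rewrite in_itv /= => /andP[/ltW c1 /ltW c2] ->; exists c; rewrite ?c1.
Qed.

Lemma MVT_norm f df x y C : (forall x : R, is_derive x 1 f (df x)) ->
  (forall x, `|df x| <= C) -> `|f x - f y| <= C * `|x - y|.
Proof.
move=> hf hC; wlog xy : x y / x <= y => [hw|].
  have [/hw//|/ltW/hw] := leP x y; by rewrite distrC (distrC y).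
by have [c _ e] := MVT_derive hf xy; rewrite distrC e normrM (distrC x) ler_wpM2r.
Qed.

Lemma is_derive_sqr_pos (u : R) :
  is_derive u 1 (fun u => Num.max 0 u ^+ 2) (2 * Num.max 0 u).
Proof.
apply: (@is_derive_quadratic _ _ _ 1) => h; rewrite mul1r ler_norml.
have [u0|u0] := leP u 0; have [v0|v0] := leP (u + h) 0; apply/andP; split; nra.
Qed.

Lemma ln_lip (x y : R) : 1 <= x -> 1 <= y -> `|ln x - ln y| <= `|x - y|.
Proof.
have h (a b : R) : 1 <= a -> 1 <= b -> a <= b -> ln b - ln a <= b - a.
  move=> a1 b1 ab; have a0 : 0 < a by lra.
  have b0 : 0 < b by lra.
  rewrite -ln_div ?posrE//.
  have -> : b / a = 1 + (b - a) / a by field; rewrite gt_eqF.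
  apply: le_trans (le_ln1Dx _) _.
    by rewrite (lt_le_trans (ltrN10 _))// divr_ge0 ?subr_ge0// ltW.
  by rewrite ler_pdivrMr// ler_peMr// subr_ge0.
move=> x1 y1; have [xy|/ltW yx] := leP x y.
  rewrite distrC (distrC x) !ger0_norm ?subr_ge0 ?ler_ln ?posrE ?(lt_le_trans ltr01)//.
  exact: h.
rewrite !ger0_norm ?subr_ge0 ?ler_ln ?posrE ?(lt_le_trans ltr01)//.
exact: h.
Qed.

End Derivatives.

(** * The bump function *)

Section Bump.
Variables (R : realType) (D : R).
Hypothesis D_gt0 : 0 < D.

Definition bump_weight (t : R) := Num.max 0 (1 - (t / D) ^+ 2).
Local Notation w := bump_weight.

(** Slope 1 at the centre, support of radius D. Squaring the weight makes the derivative continuous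
    at the edge, with Lipschitz constant of order 1 / D. *)
Definition bump t := t * w t ^+ 2.

(* The derivative of [bump], rewritten with (t / D)^2 = 1 - w t. *)
Definition dbump t := w t * (5 * w t - 4).

Lemma bump_weight_bound t : 0 <= w t <= 1.
Proof.
rewrite /w le_max lexx /= ge_max ler01 /= gerBl; exact: sqr_ge0.
Qed.

Lemma bump_weight_out t : D <= `|t| -> w t = 0.
Proof.
move=> Dt; apply/max_idPl; rewrite subr_le0 -[X in X <= _](expr1n _ 2).
rewrite -[X in _ <= X](real_normK (num_real _)) lerXn2r ?nnegrE// normrM normfV (gtr0_norm D_gt0).
by rewrite ler_pdivlMr// mul1r.
Qed.

Lemma is_derive_bump (t : R) : is_derive t (1 : R) bump (dbump t).
Proof.
pose u (t : R) := 1 - (t / D) ^+ 2.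
have hu : is_derive t 1 u (- (2 * (t / D) / D)).
  apply: (@is_derive_quadratic _ _ _ _ (D ^- 2)) => h.
  rewrite /u (_ : _ - _ - _ = - (D ^- 2 * h ^+ 2)).
    by rewrite normrN ger0_norm// mulr_ge0 ?sqr_ge0// invr_ge0 sqr_ge0.
  by field; rewrite gt_eqF.
have hc := @is_derive1_comp _ (fun u => Num.max 0 u ^+ 2) u t _ _ (is_derive_sqr_pos (u t)) hu.
have hd : is_derive t 1 bump _ := @is_deriveM _ _ id _ t 1 _ _ (is_derive_id t 1) hc.
apply: (is_derive_eq hd) => /=.
rewrite /GRing.scale /= mulr1 /dbump -/(w t).
have [h|h] := ltP `|t| D; last by rewrite bump_weight_out//; ring.
have -> : w t = u t.
  apply/max_idPr; rewrite subr_ge0 -[X in _ <= X](expr1n _ 2).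
  rewrite -[X in X <= _](real_normK (num_real _)) lerXn2r ?nnegrE// normrM normfV (gtr0_norm D_gt0).
  by rewrite ler_pdivrMr// mul1r ltW.
by rewrite /u; field; rewrite gt_eqF.
Qed.

Lemma bump_at0 : bump 0 = 0. Proof. by rewrite /bump mul0r. Qed.

Lemma dbump_at0 : dbump 0 = 1.
Proof.
rewrite /dbump (_ : w 0 = 1); first by ring.
by rewrite /w mul0r expr0n subr0; apply/max_idPr.
Qed.

Lemma bump_out t : D <= `|t| -> bump t = 0.
Proof. by move=> h; rewrite /bump bump_weight_out// expr0n mulr0. Qed.

Lemma dbump_out t : D <= `|t| -> dbump t = 0.
Proof. by move=> h; rewrite /dbump bump_weight_out// mul0r. Qed.

Lemma dbump_le t : dbump t <= w t.
Proof. have /andP[h1 h2] := bump_weight_bound t; rewrite /dbump; nra. Qed.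

Lemma dbump_norm t : `|dbump t| <= 1.
Proof.
have /andP[h1 h2] := bump_weight_bound t; rewrite /dbump ler_norml.
have := sqr_ge0 (5 * w t - 2).
have : 0 <= (1 - w t) * (5 * w t + 1) by rewrite mulr_ge0// ?subr_ge0//; lra.
by rewrite expr2 => h3 h4; apply/andP; split; lra.
Qed.

Lemma bump_norm t : `|bump t| <= D.
Proof.
have [h|h] := ltP `|t| D; last by rewrite bump_out// normr0 ltW.
have /andP[h1 h2] := bump_weight_bound t.
rewrite /bump normrM (le_trans _ (ltW h))// ler_piMr// ger0_norm ?sqr_ge0//.
by rewrite exprn_ile1.
Qed.

Lemma bump_weight_lip x y : `|w x - w y| <= 2 * (`|x - y| / D).
Proof.
wlog xy : x y / `|x| <= `|y| => [hw|].
  have [/hw//|/ltW/hw] := leP `|x| `|y|; by rewrite distrC (distrC y).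
have hd : `|y| - `|x| <= `|x - y| by rewrite distrC; exact: lerB_dist.
have D0 : 0 <= D^-1 by rewrite invr_ge0 ltW.
have sqE t : (t / D) ^+ 2 = (`|t| / D) ^+ 2.
  by rewrite -[LHS](real_normK (num_real _)) normrM normfV (gtr0_norm D_gt0).
rewrite /w (sqE x) (sqE y).
set s := `|x| / D; set v := `|y| / D; set e := `|x - y| / D.
have s0 : 0 <= s by rewrite mulr_ge0.
have sv : s <= v by rewrite ler_wpM2r.
have ve : v - s <= e by rewrite /v /s -mulrBl ler_wpM2r.
have [h1|h1] := leP (1 - s ^+ 2) 0.
  have h2 : 1 - v ^+ 2 <= 0.
    by apply: le_trans h1; rewrite lerD2l lerN2 lerXn2r ?nnegrE// (le_trans s0).
  by rewrite max_l// subrr normr0; lra.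
have s1 : s <= 1.
  by rewrite -(@ler_pXn2r _ 2)// ?nnegrE// expr1n; lra.
have [h2|h2] := leP (1 - v ^+ 2) 0.
  have v1 : 1 <= v.
    by rewrite -(@ler_pXn2r _ 2)// ?nnegrE// ?(le_trans s0)// expr1n; lra.
  have : 0 <= (1 - s) * (1 - s) by rewrite mulr_ge0// subr_ge0.
  by rewrite subr0 gtr0_norm// => h3; rewrite expr2; lra.
have v1 : v <= 1.
  by rewrite -(@ler_pXn2r _ 2)// ?nnegrE// ?(le_trans s0)// expr1n; lra.
have p1 : 0 <= (v - s) * (v + s) by rewrite mulr_ge0 ?subr_ge0// addr_ge0// (le_trans s0).
have p2 : 0 <= (v - s) * (2 - v - s) by rewrite mulr_ge0 ?subr_ge0//; lra.
by rewrite !expr2 ler_norml; apply/andP; split; lra.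
Qed.

(** Below the scale D a Lipschitz bound suffices, as e <= e^alpha for e <= 1; its constant 12 is 2
    from [bump_weight_lip] times 6. Above that scale the sup norm is enough. *)
Lemma dbump_hold (alpha : R) x y : 0 < alpha -> alpha <= 1 ->
  `|dbump x - dbump y| <= 12 * (`|x - y| / D) `^ alpha.
Proof.
move=> a0 a1; set e := `|x - y| / D.
have e0 : 0 <= e by rewrite divr_ge0// ltW.
have [e1|e1] := leP e 1; last first.
  have := dbump_norm x; have := dbump_norm y; move=> h1 h2.
  have : 1 <= e `^ alpha.
    by rewrite -[X in X <= _](powRr0 e); apply: ler_powR; rewrite ltW.
  by have := ler_normB (dbump x) (dbump y); lra.
have ea : e <= e `^ alpha.
  have [->|] := eqVneq e 0; first by rewrite powR_ge0.
  move=> en; apply: ger1_powR => //; by rewrite e1 lt_neqAle eq_sym en e0.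
have h := bump_weight_lip x y; rewrite -/e in h.
have /andP[x0 x1] := bump_weight_bound x; have /andP[y0 y1] := bump_weight_bound y.
have -> : dbump x - dbump y = (w x - w y) * (5 * (w x + w y) - 4).
  by rewrite /dbump; ring.
rewrite normrM.
have h5 : `|5 * (w x + w y) - 4| <= 6 by rewrite ler_norml; apply/andP; lra.
apply: (le_trans (ler_pM (normr_ge0 _) (normr_ge0 _) h h5)); lra.
Qed.

End Bump.

(** * Lifts of expanding circle maps and their periodic orbits *)

Record circle_lift (R : realType) (alpha lam Lam H : R) (F dF : R -> R) : Prop :=
  CircleLift {
    lift_derive : forall x : R, is_derive x (1 : R) F (dF x);
    lift_deg2 : forall x, F (x + 1) = F x + 2;
    lift_dper : forall x, dF (x + 1) = dF x;
    lift_gt : forall x, lam < dF x;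
    lift_le : forall x, dF x <= Lam;
    lift_hold : forall x y, `|dF x - dF y| <= H * `|x - y| `^ alpha }.

Section LiftFacts.
Variables (R : realType) (alpha lam Lam H : R) (F dF : R -> R).
Hypothesis lam_gt1 : 1 < lam.
Hypothesis FL : circle_lift alpha lam Lam H F dF.

Lemma lift_dge1 x : 1 <= dF x.
Proof. by rewrite ltW// (lt_trans lam_gt1)// (lift_gt FL). Qed.

Lemma lift_Lam_ge1 : 1 <= Lam.
Proof. exact: le_trans (lift_dge1 0) (lift_le FL 0). Qed.

Lemma lift_H_ge0 : 0 <= H.
Proof.
have := lift_hold FL 1 0; rewrite subr0 normr1 powR1 mulr1; exact: le_trans.
Qed.

Lemma lift_cont : continuous F.
Proof. exact: is_derive_continuous (lift_derive FL). Qed.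

Lemma lift_exp x y : x <= y -> lam * (y - x) <= F y - F x.
Proof.
move=> xy; have [c _ ->] := MVT_derive (lift_derive FL) xy.
by rewrite ler_wpM2r ?subr_ge0// ltW// (lift_gt FL).
Qed.

Lemma lift_lip x y : `|F x - F y| <= Lam * `|x - y|.
Proof.
apply: (MVT_norm x y (lift_derive FL)) => z.
by rewrite ger0_norm ?(lift_le FL)// (le_trans ler01)// lift_dge1.
Qed.

Definition log_deriv x := ln (dF x).

Lemma log_deriv_per x : log_deriv (x + 1) = log_deriv x.
Proof. by rewrite /log_deriv (lift_dper FL). Qed.

Lemma log_deriv_hold x y : `|log_deriv x - log_deriv y| <= H * `|x - y| `^ alpha.
Proof. by apply: le_trans (lift_hold FL x y); apply: ln_lip; exact: lift_dge1. Qed.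

End LiftFacts.

Section OrbitIndex.
Variables (R : realType) (F : R -> R) (n : nat) (p g : R).
Hypothesis F_deg2 : forall x, F (x + 1) = F x + 2.
Hypothesis pn : per F n p.
Hypothesis g_le1 : g <= 1.
Hypothesis sep : separated F n p g.

Lemma orbit_lift_int y (a : int) : orbit_lift F p y -> orbit_lift F p (y + a%:~R).
Proof. by move=> [j [b ->]]; exists j, (b + a); rewrite intrD addrA. Qed.

Lemma orbit_index y : orbit_lift F p y ->
  exists j (a : int), (j < n)%N /\ y = iter j F p + a%:~R.
Proof.
have n0 : (0 < n)%N by case: pn.
move=> [j [a ->]]; rewrite (divn_eq j n) addnC iterD.
have [b ->] : exists b : int, iter (j %/ n * n) F p = p + b%:~R.
  have [->|c0] := posnP (j %/ n); first by exists 0; rewrite addr0.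
  by have [] := per_mul F_deg2 c0 pn.
exists (j %% n)%N, (2 ^+ (j %% n) * b + a); split; first by rewrite ltn_mod.
by rewrite (iter_deg2 F_deg2) intrD addrA.
Qed.

Lemma orbit_sep_index i j (a b : int) : (i < n)%N -> (j < n)%N ->
  `|iter i F p + a%:~R - (iter j F p + b%:~R)| < g -> i = j /\ a = b.
Proof.
move=> iN jN; have [ij|ji|->] := ltngtP i j.
- move=> h; exfalso; have := sep (b - a) (i := i) (j := j); rewrite ij jN => /(_ isT).
  apply/negP; rewrite -ltNge intrB; apply: le_lt_trans h.
  by rewrite le_eqVlt; apply/orP; left; apply/eqP; congr `|_|; ring.
- move=> h; exfalso; have := sep (a - b) (i := j) (j := i); rewrite ji iN => /(_ isT).
  apply/negP; rewrite -ltNge intrB; apply: le_lt_trans h.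
  by rewrite distrC le_eqVlt; apply/orP; left; apply/eqP; congr `|_|; ring.
(* [separated] is silent about i = j; here g <= 1 excludes nonzero integers. *)
- move=> h; split => //; apply/eqP; rewrite -subr_eq0 -normr_eq0 -absz_eq0 absz_id.
  have : `|(a - b)%:~R : R| < 1.
    apply: lt_le_trans g_le1; apply: le_lt_trans h.
    by rewrite intrB le_eqVlt; apply/orP; left; apply/eqP; congr `|_|; ring.
  rewrite -intr_norm -[1]/(1%:~R) ltr_int => h1.
  by move: h1; case: (a - b) => [[|m]|m].
Qed.

Lemma orbit_sep y z : orbit_lift F p y -> orbit_lift F p z -> `|y - z| < g -> y = z.
Proof.
move=> /orbit_index[i [a [iN ->]]] /orbit_index[j [b [jN ->]]] h.
by have [-> ->] := orbit_sep_index iN jN h.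
Qed.

End OrbitIndex.

(* By the last clause, each visit outside the r-neighbourhood of the orbit of p
   costs at least c in the Birkhoff sums of ln T'. *)
Definition locked (R : realType) (T dT : R -> R) : Prop := exists n p r c C,
  [/\ per T n p /\ 0 < r, 0 < c,
    forall i j (a : int), (i < j < n)%N -> iter i T p != iter j T p + a%:~R,
    forall x, (forall i, near_orbit T p r (iter i T x)) -> orbit_lift T p x &
    forall N x, birkhoff T (log_deriv dT) N x + c * birkhoff T (far_indic T p r) N x <=
      N%:R * orbit_average T (log_deriv dT) n p + C].

(** Gathers the smallness conditions that [robust_locking] puts on the size of the error. *)
Lemma small_error (R : realType) (alpha a b c M z d : R) : 0 < alpha -> 0 <= a -> 0 <= b -> 0 <= c ->
  0 <= M -> 0 < z -> 0 < d -> exists2 e, 0 < e &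
  [/\ e <= z, a * e `^ alpha <= z, b * (e * M) `^ alpha <= z, c * (e * M) `^ alpha <= z &
     e * M <= d].
Proof.
move=> al0 a0 b0 c0 M0 z0 d0; pose K := a + b + c + 1.
have K0 : 0 < K by rewrite /K; lra.
have M1 : 0 < M + 1 by lra.
have zK : 0 < z / K by rewrite divr_gt0.
have [h h0 hh] := powR_small al0 zK.
pose e := Num.min (Num.min z h) (Num.min h d / (M + 1)).
have e0 : 0 < e by rewrite !lt_min z0 h0 divr_gt0// lt_min h0.
have eM : e * M <= Num.min h d.
  apply: (@le_trans _ _ (e * (M + 1))); first by rewrite ler_pM2l//; lra.
  by rewrite -ler_pdivlMr// ge_min lexx orbT.
have fin t u : 0 <= t -> t <= K -> 0 <= u -> u <= h -> t * u `^ alpha <= z.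
  move=> t0 tK u0 uh; apply: (@le_trans _ _ (K * (z / K))).
    by apply: ler_pM; rewrite ?powR_ge0// hh.
  by rewrite mulrCA divff ?mulr1// gt_eqF.
have eMh : e * M <= h by apply: le_trans eM _; rewrite ge_min lexx.
have eM0 : 0 <= e * M by rewrite mulr_ge0// ltW.
exists e => //; split.
- by rewrite !ge_min lexx.
- by apply: fin; rewrite ?(ltW e0)// /K ?ge_min ?lexx ?orbT//; lra.
- by apply: fin => //; rewrite /K; lra.
- by apply: fin => //; rewrite /K; lra.
- by apply: le_trans eM _; rewrite ge_min lexx orbT.
Qed.

(** * The perturbed map, its excess and its stability *)

Section Perturbation.
Variables (R : realType) (alpha lam Lam H : R) (F dF : R -> R).
Hypothesis alpha_gt0 : 0 < alpha.
Hypothesis alpha_le1 : alpha <= 1.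
Hypothesis lam_gt1 : 1 < lam.
Hypothesis FL : circle_lift alpha lam Lam H F dF.
Variables (n : nat) (p g D kap : R).
Hypothesis pn : per F n p.
Hypothesis g_le1 : g <= 1.
Hypothesis sep : separated F n p g.
Hypothesis D_gt0 : 0 < D.
Hypothesis D_sep : 4 * D <= g.
Hypothesis kap_gt0 : 0 < kap.
Local Notation orb := (orbit_lift F p).

Let osep y z : orb y -> orb z -> `|y - z| < g -> y = z.
Proof. by move=> Oy Oz; apply: (orbit_sep (lift_deg2 FL) pn g_le1 sep). Qed.

(** The factor [dF y] makes the derivative grow by the same factor 1 + kap at every orbit point. As
    4 D <= g, at most one orbit point lies within D of x, so the choice made by [cid] is forced. *)
Definition perturbation (b : R -> R) x : R :=
  match pselect (exists y, orb y /\ `|x - y| < D) with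
  | left h => kap * dF (projT1 (cid h)) * b (x - projT1 (cid h))
  | right _ => 0
  end.

(** The formula is extended to twice the support of the bump, so that it holds on a whole
    neighbourhood of the edge. *)
Lemma perturbation_near b x y : (forall t, D <= `|t| -> b t = 0) ->
  orb y -> `|x - y| < 2 * D -> perturbation b x = kap * dF y * b (x - y).
Proof.
move=> bout Oy xy; rewrite /perturbation; case: pselect => [h|no].
  case: (cid h) => z [Oz xz] /=; suff -> : z = y by [].
  apply: osep => //; apply: lt_le_trans D_sep.
  have -> : z - y = (x - y) - (x - z) by ring.
  have D0 := D_gt0.
  by apply: le_lt_trans (ler_normB _ _) _; lra.
rewrite bout ?mulr0// leNgt; apply/negP => h; apply: no; by exists y.
Qed.

Lemma perturbation_far b x : (forall y, orb y -> D <= `|x - y|) -> perturbation b x = 0.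
Proof.
move=> h; rewrite /perturbation; case: pselect => // xy; exfalso.
by case: xy => y [Oy]; rewrite ltNge h.
Qed.

Lemma near_or_far x d : (exists2 y, orb y & `|x - y| < d) \/
  (forall y, orb y -> d <= `|x - y|).
Proof.
have [h|h] := pselect (exists2 y, orb y & `|x - y| < d); [by left|right => y Oy].
by rewrite leNgt; apply/negP => xy; apply: h; exists y.
Qed.

Definition eta := perturbation (bump D).
Definition deta := perturbation (dbump D).

Lemma eta_near x y : orb y -> `|x - y| < 2 * D -> eta x = kap * dF y * bump D (x - y).
Proof. by apply: perturbation_near => t; exact: bump_out. Qed.

Lemma deta_near x y : orb y -> `|x - y| < 2 * D -> deta x = kap * dF y * dbump D (x - y).
Proof. by apply: perturbation_near => t; exact: dbump_out. Qed.

Lemma is_derive_eta (x : R) : is_derive x (1 : R) eta (deta x).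
Proof.
have D0 := D_gt0; have D2 : 0 < D / 2 by rewrite divr_gt0.
have [[y Oy xy]|far] := near_or_far x (3 / 2 * D).
  rewrite (deta_near Oy); last by lra.
  apply: (@is_derive_local _ _ (fun z => kap * dF y * bump D (z - y)) _ _ _ D2).
    move=> z zx; apply: eta_near => //.
    have -> : z - y = (z - x) + (x - y) by ring.
    by apply: le_lt_trans (ler_normD _ _) _; lra.
  have hs : is_derive x (1 : R) (fun z : R => z - y) 1.
    by apply: (@is_derive_quadratic _ _ _ _ 0) => h; rewrite mul0r normr_le0; apply/eqP; ring.
  have hc := @is_derive1_comp _ (bump D) (fun z : R => z - y) x _ _ (is_derive_bump D_gt0 _) hs.
  have hz : is_derive x (1 : R) (fun z => kap * dF y * bump D (z - y)) _ :=
    @is_deriveZ _ _ _ (bump D \o (fun z : R => z - y)) (kap * dF y) x 1 _ hc.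
  by apply: (is_derive_eq hz); rewrite mulr1.
rewrite /deta perturbation_far; last by move=> y /far; lra.
apply: (@is_derive_local _ _ (cst 0) _ _ _ D2).
move=> z zx; apply: perturbation_far => y /far h.
have -> : z - y = (x - y) - (x - z) by ring.
apply: le_trans (lerB_dist _ _); rewrite distrC in zx; lra.
Qed.

Lemma perturbation_per b x : (forall t, D <= `|t| -> b t = 0) ->
  perturbation b (x + 1) = perturbation b x.
Proof.
move=> bout; have D0 := D_gt0.
have [[y Oy xy]|far] := near_or_far x (2 * D).
  rewrite (perturbation_near bout Oy xy) (@perturbation_near _ _ (y + 1))//.
  - by rewrite (lift_dper FL); congr (_ * b _); ring.
  - exact: (orbit_lift_int 1 Oy).
  - by have -> : x + 1 - (y + 1) = x - y by ring.
rewrite !perturbation_far//; first by move=> y /far; lra.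
move=> y Oy; have := far _ (orbit_lift_int (-1) Oy).
rewrite rmorphN /= => h.
have -> : x + 1 - y = x - (y - 1) by ring.
by move: h; lra.
Qed.

Lemma perturbation_norm b C x : (forall t, D <= `|t| -> b t = 0) -> 0 <= C ->
  (forall t, `|b t| <= C) -> `|perturbation b x| <= kap * Lam * C.
Proof.
move=> bout C0 hb; have D0 := D_gt0; have L1 := lift_Lam_ge1 lam_gt1 FL.
have [[y Oy xy]|far] := near_or_far x (2 * D).
  rewrite (perturbation_near bout Oy xy) normrM ler_pM// normrM ler_pM//.
    by rewrite gtr0_norm.
  by rewrite ger0_norm ?(lift_le FL)// (le_trans ler01)// (lift_dge1 lam_gt1 FL).
rewrite perturbation_far ?normr0 ?mulr_ge0// ?(ltW kap_gt0) ?(le_trans ler01)//.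
by move=> y /far; lra.
Qed.

Lemma deta_norm x : `|deta x| <= kap * Lam.
Proof.
rewrite -[X in _ <= X]mulr1; apply: perturbation_norm => // t.
  exact: dbump_out.
exact: dbump_norm.
Qed.

Lemma eta_norm x : `|eta x| <= kap * Lam * D.
Proof.
apply: perturbation_norm; rewrite ?(ltW D_gt0)// => t.
  exact: bump_out.
exact: bump_norm.
Qed.

Lemma eta_orbit y : orb y -> eta y = 0 /\ deta y = kap * dF y.
Proof.
have yy : `|y - y| < 2 * D by rewrite subrr normr0 mulr_gt0.
move=> Oy; rewrite (eta_near Oy yy) (deta_near Oy yy) subrr bump_at0 dbump_at0.
by rewrite mulr0 mulr1.
Qed.

Lemma eta_le x y : orb y -> `|eta x| <= kap * Lam * `|x - y|.
Proof.
move=> /eta_orbit[e0 _]; rewrite -[eta x]subr0 -e0.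
exact: (MVT_norm x y is_derive_eta deta_norm).
Qed.

(** Points less than D apart are governed by the same orbit point or lie outside all bumps; for
    others the sup norm suffices. The factor kap / D^alpha is what ties the slope to the width. *)
Lemma deta_hold x z : `|deta x - deta z| <= 12 * Lam * (kap / D `^ alpha) * `|x - z| `^ alpha.
Proof.
have L1 := lift_Lam_ge1 lam_gt1 FL; have L0 : 0 <= Lam by exact: le_trans L1.
have D0 := D_gt0; have Da : 0 < D `^ alpha by exact: powR_gt0.
have kL0 : 0 <= kap * Lam by rewrite mulr_ge0// ltW.
have DE t : 0 <= t -> t `^ alpha = (t / D) `^ alpha * D `^ alpha.
  by move=> t0; rewrite -powRM ?divr_ge0 ?(ltW D_gt0)// divfK// gt_eqF.
have -> : 12 * Lam * (kap / D `^ alpha) * `|x - z| `^ alpha =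
    kap * Lam * (12 * (`|x - z| / D) `^ alpha).
  by rewrite (DE `|x - z|)//; field; rewrite gt_eqF.
have same y u v : orb y -> `|u - y| < 2 * D -> `|v - y| < 2 * D ->
    `|deta u - deta v| <= kap * Lam * (12 * (`|u - v| / D) `^ alpha).
  move=> Oy uy vy; rewrite (deta_near Oy uy) (deta_near Oy vy) -mulrBr normrM.
  apply: ler_pM => //.
    rewrite gtr0_norm; first by rewrite ler_pM2l// (lift_le FL).
    by rewrite mulr_gt0// (lt_le_trans ltr01)// (lift_dge1 lam_gt1 FL).
  apply: le_trans (dbump_hold D_gt0 _ _ alpha_gt0 alpha_le1) _.
  by have -> : u - y - (v - y) = u - v by ring.
have [xz|xz] := ltP `|x - z| D; last first.
  apply: (@le_trans _ _ (kap * Lam * 2)).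
    apply: le_trans (ler_normB _ _) _.
    by have := deta_norm x; have := deta_norm z; lra.
  rewrite ler_wpM2l//.
  have : 1 <= (`|x - z| / D) `^ alpha.
    rewrite -[X in X <= _](powRr0 (`|x - z| / D)); apply: ler_powR; last exact: ltW.
    by rewrite ler_pdivlMr// mul1r.
  by lra.
have [[y Oy xy]|farx] := near_or_far x D.
  apply: (same y) => //; first by lra.
  have -> : z - y = (x - y) - (x - z) by ring.
  by apply: le_lt_trans (ler_normB _ _) _; lra.
have [[y Oy zy]|farz] := near_or_far z D.
  apply: (same y) => //; last by lra.
  have -> : x - y = (x - z) + (z - y) by ring.
  by apply: le_lt_trans (ler_normD _ _) _; lra.
rewrite /deta !perturbation_far// subrr normr0 mulr_ge0// mulr_ge0// powR_ge0//.
Qed.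

Local Notation phi := (log_deriv dF).
Local Notation V := (subaction F phi).
Local Notation CV := (hold_sum alpha lam H).
Local Notation A := (orbit_average F phi n p).

Let Fc := lift_cont FL.
Let Fe := lift_exp FL.
Let F2 := lift_deg2 FL.
Let H0 := lift_H_ge0 FL.
Let pper := log_deriv_per FL.
Let phold := log_deriv_hold lam_gt1 FL.

Definition plift x := F x + eta x.
Definition dplift x := dF x + deta x.
Local Notation G := plift.
Local Notation dG := dplift.
Hypothesis dplift_ge1 : forall x, 1 <= dG x.
Hypothesis kap_le1 : kap <= 1.

(** The excess of the perturbed map relative to its own orbit average, [A + ln (1 + kap)], but with
    the sub-action of the unperturbed F. *)
Definition pexcess x := ln (dG x) - (A + ln (1 + kap)) + V x - V (G x).
Definition avg_defect := defect F phi n p / n%:R.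
Definition near_coef := kap * H + CV * (kap * Lam) `^ alpha.

Lemma near_coef_ge0 : 0 <= near_coef.
Proof.
apply: addr_ge0; apply: mulr_ge0; rewrite ?(ltW kap_gt0) ?powR_ge0//.
exact: hold_sum_ge0.
Qed.

Lemma avg_defect_ge0 : 0 <= avg_defect.
Proof.
apply: divr_ge0 => //; exact: (defect_ge0 alpha_gt0 lam_gt1 H0 Fc Fe pper phold pn).
Qed.

Lemma dlift_gt0 x : 0 < dF x.
Proof. exact: lt_le_trans ltr01 (lift_dge1 lam_gt1 FL x). Qed.

(** Three facts are added up: the deficit of F is nonnegative, V is Hölder, and ln (1 + z) <= z,
    applied to the ratio of [dG x] to [dF x * (1 + kap)]. *)
Lemma pexcess_le x : pexcess x <=
  avg_defect + (deta x - kap * dF x) / (dF x * (1 + kap)) + CV * `|eta x| `^ alpha.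
Proof.
have d0 := deficit_ge0 alpha_gt0 lam_gt1 H0 Fc Fe F2 pper phold x.
have F0 := dlift_gt0 x; have G0 : 0 < dG x by exact: lt_le_trans ltr01 (dplift_ge1 x).
have k0 := kap_gt0; have k1 : 0 < 1 + kap by lra.
have n0 : (n%:R : R) != 0 by rewrite pnatr_eq0 -lt0n; case: pn.
have -> : avg_defect = max_average F phi - A.
  by rewrite /avg_defect /defect /orbit_average; field.
have vG : V (F x) - V (G x) <= CV * `|eta x| `^ alpha.
  have := subaction_hold alpha_gt0 lam_gt1 H0 Fc Fe pper phold (F x) (G x).
  rewrite /G (_ : F x - (F x + eta x) = - eta x); last by ring.
  by rewrite normrN ler_norml => /andP[].
have lnG : ln (dG x) - phi x - ln (1 + kap) <= (deta x - kap * dF x) / (dF x * (1 + kap)).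
  have -> : ln (dG x) - phi x - ln (1 + kap) = ln (1 + (deta x - kap * dF x) / (dF x * (1 + kap))).
    rewrite /log_deriv -addrA -opprD -lnM ?posrE// -ln_div ?posrE ?mulr_gt0//.
    by congr ln; rewrite /dplift; field; rewrite !gt_eqF.
  apply: le_ln1Dx.
  have -> : (deta x - kap * dF x) / (dF x * (1 + kap)) = dG x / (dF x * (1 + kap)) - 1.
    by rewrite /dplift; field; rewrite !gt_eqF.
  by rewrite ltrDr divr_gt0// mulr_gt0.
move: d0; rewrite /deficit /pexcess; lra.
Qed.

(** The slope of the bump never exceeds 1, so [deta x] is at most kap dF y, and dF y exceeds dF x
    only by a Hölder term: no loss of order kap remains. *)
Lemma pexcess_near x y : orb y -> `|x - y| < 2 * D ->
  pexcess x <= avg_defect + near_coef * `|x - y| `^ alpha.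
Proof.
move=> Oy xy; apply: le_trans (pexcess_le x) _.
rewrite /near_coef [_ * `|x - y| `^ alpha]mulrDl addrA; have k0 := kap_gt0.
have F0 := dlift_gt0 x; have F1 := lift_dge1 lam_gt1 FL x.
have L0 : 0 <= Lam by exact: le_trans ler01 (lift_Lam_ge1 lam_gt1 FL).
apply: lerD; last first.
  rewrite -[X in _ <= X]mulrA ler_wpM2l ?hold_sum_ge0//.
  rewrite -powRM ?mulr_ge0 ?(ltW k0)//; apply: powR_le; rewrite ?(ltW alpha_gt0)//.
  exact: eta_le.
rewrite lerD2l.
have den : 1 <= dF x * (1 + kap) by rewrite -[X in X <= _]mulr1 ler_pM//; lra.
have B0 : 0 <= kap * H * `|x - y| `^ alpha by rewrite !mulr_ge0 ?powR_ge0// ltW.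
rewrite ler_pdivrMr; last by lra.
apply: (@le_trans _ _ (kap * H * `|x - y| `^ alpha)); last by rewrite ler_peMr.
rewrite (deta_near Oy xy) -!mulrA -mulrBr ler_pM2l//.
have := lift_hold FL y x; rewrite distrC (distrC y) => h.
have db1 : dbump D (x - y) <= 1 by have := dbump_norm D (x - y); rewrite ler_norml => /andP[].
have h2 : dF y * dbump D (x - y) <= dF y by rewrite ler_piMr// ltW// dlift_gt0.
by move: h; rewrite ler_norml => /andP[h3 h4]; lra.
Qed.

(** At distance D / 2 the weight of the bump is at most 3 / 4, so, up to a Hölder term, [deta x]
    misses at least a quarter of kap dF x. Division by dF x (1 + kap), at most 2 dF x, leaves kap /
    8. *)
Lemma pexcess_far x : (forall y, orb y -> D / 2 <= `|x - y|) ->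
  pexcess x <= avg_defect + kap * H * D `^ alpha + CV * (kap * Lam * D) `^ alpha - kap / 8.
Proof.
move=> far; apply: le_trans (pexcess_le x) _; have k0 := kap_gt0; have D0 := D_gt0.
have F0 := dlift_gt0 x; have F1 := lift_dge1 lam_gt1 FL x; have k1 := kap_le1.
have h1 : CV * `|eta x| `^ alpha <= CV * (kap * Lam * D) `^ alpha.
  rewrite ler_wpM2l ?hold_sum_ge0//; apply: powR_le; rewrite ?(ltW alpha_gt0)//.
  exact: eta_norm.
have den : 1 <= dF x * (1 + kap) by rewrite -[X in X <= _]mulr1 ler_pM//; lra.
have den0 : 0 < dF x * (1 + kap) by lra.
have k8 : kap / 8 * (dF x * (1 + kap)) <= kap / 4 * dF x.
  have -> : kap / 8 * (dF x * (1 + kap)) = kap * dF x * ((1 + kap) / 8) by ring.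
  have -> : kap / 4 * dF x = kap * dF x * (2 / 8) by field.
  by rewrite ler_pM2l ?mulr_gt0//; lra.
have B0 : 0 <= kap * H * D `^ alpha by rewrite !mulr_ge0 ?powR_ge0// ltW.
suff h2 : (deta x - kap * dF x) / (dF x * (1 + kap)) <= kap * H * D `^ alpha - kap / 8 by lra.
rewrite ler_pdivrMr// mulrBl.
have h3 : kap * H * D `^ alpha <= kap * H * D `^ alpha * (dF x * (1 + kap)) by rewrite ler_peMr.
suff h4 : deta x - kap * dF x <= kap * H * D `^ alpha - kap / 4 * dF x by lra.
have [[y Oy xy]|farD] := near_or_far x D; last first.
  have kF : 0 < kap * dF x by rewrite mulr_gt0.
  by rewrite /deta perturbation_far//; lra.
rewrite (deta_near Oy); last by lra.
have wle : bump_weight D (x - y) <= 3 / 4.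
  rewrite /bump_weight ge_max; apply/andP; split; first by lra.
  have : 1 / 2 <= `|(x - y) / D|.
    by rewrite normrM normfV (gtr0_norm D0) ler_pdivlMr//; have := far _ Oy; lra.
  rewrite -(@ler_pXn2r _ 2)// ?nnegrE// real_normK ?num_real// => h.
  by move: h; rewrite expr_div_n expr1n !expr2; lra.
have dF0 := dlift_gt0 y.
have h5 : dF y * dbump D (x - y) <= dF y * (3 / 4).
  by rewrite ler_pM2l// (le_trans (dbump_le D _)).
have h6 : dF y <= dF x + H * D `^ alpha.
  have := lift_hold FL y x; rewrite ler_norml => /andP[_ h].
  have : H * `|y - x| `^ alpha <= H * D `^ alpha.
    rewrite ler_wpM2l//; apply: powR_le; rewrite ?(ltW alpha_gt0)//.
    by rewrite distrC ltW.
  by lra.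
have HD : 0 <= H * D `^ alpha by rewrite mulr_ge0// powR_ge0.
have -> : kap * dF y * dbump D (x - y) - kap * dF x = kap * (dF y * dbump D (x - y) - dF x) by ring.
have -> : kap * H * D `^ alpha - kap / 4 * dF x = kap * (H * D `^ alpha - dF x / 4) by field.
by rewrite ler_pM2l//; lra.
Qed.

(** The orbit of p persists for every T near the perturbed map, and the excess of T, still taken
    with the V of F, differs from [pexcess] by a small error. *)
Lemma robust_locking (Lam' H' : R) (k : nat) : 0 <= H' -> 1 <= Lam' ->
  (Lam' + 2) * D <= g ->
  (hold_sum alpha lam H' + 2 * CV) * hold_ratio alpha lam ^+ k * D `^ alpha <= kap / 256 ->
  (n + k)%:R * avg_defect <= kap / 256 ->
  2 * near_coef / (1 - hold_ratio alpha lam) * D `^ alpha <= kap / 256 ->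
  avg_defect + kap * H * D `^ alpha + CV * (kap * Lam * D) `^ alpha <= kap / 16 ->
  exists2 e, 0 < e & forall T dT, circle_lift alpha lam Lam' H' T dT ->
    (forall x, `|T x - G x| <= e) -> (forall x, `|dT x - dG x| <= e) -> locked T dT.
Proof.
move=> H'0 L'1 Dsep B1 B2 B3 Bfar.
have k0 := kap_gt0; have D0 := D_gt0; have n0 : (0 < n)%N by case: pn.
have CV0 : 0 <= CV by exact: hold_sum_ge0.
have E0 := near_coef_ge0; have def0 := avg_defect_ge0.
have q0 : 0 < 1 - hold_ratio alpha lam by rewrite subr_gt0 hold_ratio_lt1.
have nk0 : 0 < ((n + k)%:R : R) by rewrite ltr0n addn_gt0 n0.
have L'0 : 0 <= Lam' by exact: le_trans L'1.
have lam1 : 0 < lam - 1 by rewrite subr_gt0.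
(* Bounds the total error. The first entry keeps the far estimate, - kap / 8 + kap / 16 plus the
   error, below - kap / 32; the second makes the error over n + k steps at most kap / 256. *)
pose zeta := Num.min (kap / 32) (kap / 256 / (n + k)%:R).
have z0 : 0 < zeta.
  have k32 : 0 < kap / 32 by lra.
  have k256 : 0 < kap / 256 by lra.
  by rewrite lt_min k32 divr_gt0.
have z32 : zeta <= kap / 32 by rewrite ge_min lexx.
have znk : (n + k)%:R * zeta <= kap / 256.
  by rewrite mulrC -ler_pdivlMr// ge_min lexx orbT.
(* If T is within e of the perturbed map, e times [M i] bounds the distance between the orbits of p
   under T and F after i steps. *)
pose M := fix M i := if i is j.+1 then Lam' * M j + 1 else 0.
have M0 i : 0 <= M i by elim: i => //= i IH; rewrite addr_ge0// mulr_ge0.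
pose K := lam / (lam - 1).
have K0 : 0 <= K by rewrite divr_ge0 ?(ltW lam1) ?(le_trans ler01 (ltW lam_gt1)).
(* Displacement due to closing the T-orbit of p, plus the drift [M i], majorised by a sum for all i
   <= n at once. *)
pose M2 := K * M n + \sum_(i < n.+1) M i.
have M20 : 0 <= M2.
  by apply: addr_ge0; [exact: mulr_ge0|apply: sumr_ge0 => i _; exact: M0].
have E20 : 0 <= 2 * near_coef by rewrite mulr_ge0.
have z8 : 0 < zeta / 8 by rewrite divr_gt0.
have D2 : 0 < D / 2 by rewrite divr_gt0.
have [e e0 [e1 e2 e3 e4 e5]] := small_error alpha_gt0 CV0 H'0 E20 M20 z8 D2.
exists e => // T dT TL cT cdT.
have Tc := lift_cont TL; have Te := lift_exp TL; have Tl := lift_lip lam_gt1 TL.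
have T2 := lift_deg2 TL; have tper := log_deriv_per TL.
have thold := log_deriv_hold lam_gt1 TL.
set psi := log_deriv dT in tper thold *.
have GF y : orb y -> G y = F y.
  move=> Oy; rewrite /plift.
  by have [-> _] := eta_orbit Oy; rewrite addr0.
have orb_iter i : orb (iter i F p) by exists i, 0; rewrite addr0.
have close i : `|iter i T p - iter i F p| <= e * M i.
  elim: i => [|i IH]; first by rewrite subrr normr0 mulr0.
  have h1 : `|T (iter i T p) - T (iter i F p)| <= Lam' * (e * M i).
    by apply: le_trans (Tl _ _) _; rewrite ler_wpM2l.
  have h2 : `|T (iter i F p) - F (iter i F p)| <= e by rewrite -GF.
  rewrite !iterS /=.
  have -> : T (iter i T p) - F (iter i F p) = (T (iter i T p) - T (iter i F p)) +
     (T (iter i F p) - F (iter i F p)) by ring.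
  by apply: le_trans (ler_normD _ _) _; lra.
have [a Fp] : exists a : int, iter n F p = p + a%:~R by case: pn.
pose t := iter n T p - iter n F p.
have Tp : iter n T p = p + a%:~R + t by rewrite /t Fp; ring.
have [p' [hp' cp' _]] := closing alpha_gt0 lam_gt1 H'0 Tc Te thold n0 Tp.
have pn' : per T n p' by split => //; exists a.
have sigma i : (i <= n)%N -> `|iter i T p' - iter i F p| <= e * M2.
  move=> iN.
  have -> : iter i T p' - iter i F p = (iter i T p' - iter i T p) + (iter i T p - iter i F p) by ring.
  apply: le_trans (ler_normD _ _) _; rewrite /M2 mulrDr; apply: lerD.
    apply: le_trans (cp' _ iN) _; rewrite mulrCA; apply: ler_wpM2l => //.
    exact: close.
  apply: le_trans (close i) _; rewrite ler_pM2l//.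
  have i' : (i < n.+1)%N by [].
  by rewrite (bigD1 (Ordinal i')) //= lerDl sumr_ge0.
set s := e * M2 in sigma e3 e4 e5.
have s0 : 0 <= s by rewrite mulr_ge0// ltW.
pose A' := orbit_average T psi n p'.
(* A lower bound for the average of the continued orbit, which enters the excess with a minus
   sign. *)
have AA : (A + ln (1 + kap)) - A' <= e + H' * s `^ alpha.
  have nR : 0 < (n%:R : R) by rewrite ltr0n.
  have -> : A + ln (1 + kap) = n%:R^-1 * \sum_(i < n) ln (dG (iter i F p)).
    have -> : \sum_(i < n) ln (dG (iter i F p)) = \sum_(i < n) (phi (iter i F p) + ln (1 + kap)).
      apply: eq_bigr => i _; rewrite /dplift.
      have [_ ->] := eta_orbit (orb_iter i).
      rewrite -lnM ?posrE ?dlift_gt0//; last by lra.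
      by congr ln; ring.
    rewrite big_split /= sumr_const card_ord -[ln (1 + kap) *+ n]mulr_natl mulrDr.
    by rewrite mulKf ?gt_eqF// [_^-1 * _]mulrC.
  rewrite /A' /orbit_average /birkhoff [X in _ - X]mulrC -mulrBr -sumrB.
  rewrite ler_pdivrMl// mulr_natl -[X in _ *+ X]card_ord -sumr_const; apply: ler_sum => i _.
  have iN : (i <= n)%N by exact: ltnW.
  have h1 : `|ln (dG (iter i F p)) - psi (iter i T p')| <= `|dG (iter i F p) - dT (iter i T p')|.
    by apply: ln_lip => //; exact: lift_dge1 lam_gt1 TL _.
  have h2 := cdT (iter i F p).
  have h3 := lift_hold TL (iter i F p) (iter i T p').
  have h4 : H' * `|iter i F p - iter i T p'| `^ alpha <= H' * s `^ alpha.
    rewrite ler_wpM2l//; apply: powR_le; rewrite ?(ltW alpha_gt0)// distrC.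
    exact: sigma.
  have h5 : `|dG (iter i F p) - dT (iter i T p')| <=
     `|dT (iter i F p) - dG (iter i F p)| + `|dT (iter i F p) - dT (iter i T p')|.
    rewrite (distrC (dT _) (dG _)) (_ : dG (iter i F p) - dT (iter i T p') =
      (dG (iter i F p) - dT (iter i F p)) + (dT (iter i F p) - dT (iter i T p'))); last by ring.
    exact: ler_normD.
  by move: h1; rewrite ler_norml => /andP[_ h1]; lra.
pose w := 2 * e + CV * e `^ alpha + H' * s `^ alpha.
have Pw x : excess T psi V n p' x <= pexcess x + w.
  rewrite /excess /pexcess /w -/A'.
  have h1 : psi x - ln (dG x) <= e.
    have : `|psi x - ln (dG x)| <= `|dT x - dG x|.
      by apply: ln_lip => //; exact: lift_dge1 lam_gt1 TL _.
    by have := cdT x; rewrite ler_norml => h2 h3; move: h3; rewrite ler_norml => /andP[_ h3]; move: h2 => /andP[_ h2]; have := ler_norm (dT x - dG x); have := cdT x; lra.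
  have h2 : V (G x) - V (T x) <= CV * e `^ alpha.
    have := subaction_hold alpha_gt0 lam_gt1 H0 Fc Fe pper phold (G x) (T x).
    rewrite ler_norml => /andP[_ h]; apply: (le_trans h); rewrite ler_wpM2l//.
    by apply: powR_le; rewrite ?(ltW alpha_gt0)// distrC.
  by lra.
have wz : w + 2 * near_coef * s `^ alpha <= zeta by rewrite /w; lra.
have w0 : 0 <= w.
  have h1 : 0 <= CV * e `^ alpha by apply: mulr_ge0 => //; exact: powR_ge0.
  have h2 : 0 <= H' * s `^ alpha by apply: mulr_ge0 => //; exact: powR_ge0.
  by rewrite /w; lra.
have Es0 : 0 <= 2 * near_coef * s `^ alpha by rewrite mulr_ge0// powR_ge0.
have T_index := orbit_index T2 pn'.
have toF y : orbit_lift T p' y -> exists2 z, orb z & `|y - z| <= s.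
  move=> /T_index[j [b [jn ->]]]; exists (iter j F p + b%:~R); first by exists j, b.
  by rewrite opprD addrACA subrr addr0; apply: sigma; exact: ltnW.
have near_ineq x y : orbit_lift T p' y -> `|x - y| < D ->
    excess T psi V n p' x <= avg_defect + w + 2 * near_coef * s `^ alpha + 2 * near_coef * `|x - y| `^ alpha.
  move=> /toF[z Oz yz] xy; apply: le_trans (Pw x) _.
  have xz : `|x - z| <= `|x - y| + s.
    have -> : x - z = (x - y) + (y - z) by ring.
    by apply: le_trans (ler_normD _ _) _; rewrite lerD2l.
  have := @pexcess_near x z Oz; have h : `|x - z| < 2 * D by lra.
  move=> /(_ h) h1.
  have h2 : near_coef * `|x - z| `^ alpha <= near_coef * (2 * (`|x - y| `^ alpha + s `^ alpha)).
    rewrite ler_wpM2l//; apply: le_trans (powR_addle (ltW alpha_gt0) alpha_le1 (normr_ge0 _) s0).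
    by apply: powR_le; rewrite ?(ltW alpha_gt0).
  by lra.
have far_ineq x : ~ near_orbit T p' D x -> excess T psi V n p' x <= - (kap / 32).
  move=> nx; apply: le_trans (Pw x) _.
  have := @pexcess_far x; have far : forall y, orb y -> D / 2 <= `|x - y|.
    move=> y /(orbit_index F2 pn)[j [b [jn ->]]]; rewrite leNgt; apply/negP => h; apply: nx.
    exists (iter j T p' + b%:~R); first by exists j, b.
    have -> : x - (iter j T p' + b%:~R) = (x - (iter j F p + b%:~R)) - (iter j T p' - iter j F p) by ring.
    by apply: le_lt_trans (ler_normB _ _) _; have := sigma _ (ltnW jn); lra.
  by move=> /(_ far) h; lra.
have T_sep y z : orbit_lift T p' y -> orbit_lift T p' z -> `|y - z| < (Lam' + 1) * D -> y = z.
  move=> /T_index[i [b [iN ->]]] /T_index[j [c [jN ->]]] h.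
  have [//|-> -> //] := @orbit_sep_index _ F n p g g_le1 sep i j b c iN jN.
  have -> : iter i F p + b%:~R - (iter j F p + c%:~R) =
    (iter i T p' + b%:~R - (iter j T p' + c%:~R)) - (iter i T p' - iter i F p) + (iter j T p' - iter j F p) by ring.
  apply: le_lt_trans (ler_normD _ _) _.
  have := ler_normB (iter i T p' + b%:~R - (iter j T p' + c%:~R)) (iter i T p' - iter i F p).
  have := sigma _ (ltnW iN); have := sigma _ (ltnW jN); lra.
exists n, p', D, (kap / 64), (kap / 64 + closing_const alpha lam H); split.
- by split.
- by rewrite divr_gt0.
- move=> i j b /andP[ij jn]; apply/eqP => h.
  have := @orbit_sep_index _ F n p g g_le1 sep i j 0 b (ltn_trans ij jn) jn.
  rewrite addr0 => /(_ _)[]; last by move=> eij; rewrite eij ltnn in ij.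
  have -> : iter i F p - (iter j F p + b%:~R) = (iter j T p' - iter j F p) - (iter i T p' - iter i F p).
    by rewrite h; ring.
  apply: le_lt_trans (ler_normB _ _) _.
  have := sigma _ (ltnW (ltn_trans ij jn)); have := sigma _ (ltnW jn).
  have : 1 * D <= Lam' * D by rewrite ler_wpM2r// ltW.
  by lra.
- exact: (near_orbit_always lam_gt1 Te Tl T2 T_sep).
(* Here l = kap / 32; the terms bounded in [B1], [B2], [B3] and [znk], at most kap / 256 each, fill
   the budget l / 2. *)
- have k32 : kap / 64 = kap / 32 / 2 by field.
  rewrite k32.
  apply: (locking (V := V) (CV := CV) (tau := avg_defect + w + 2 * near_coef * s `^ alpha)
     (E := 2 * near_coef) (k := k) alpha_gt0 lam_gt1 H'0 Te Tl T2 tper thold) => //.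
  + exact: (subaction_per alpha_gt0 lam_gt1 H0 Fc Fe pper phold).
  + exact: (subaction_hold alpha_gt0 lam_gt1 H0 Fc Fe pper phold).
  + move=> x y.
    have /andP[h1 h2] := subaction_bound alpha_gt0 lam_gt1 H0 Fc Fe pper phold x.
    have /andP[h3 h4] := subaction_bound alpha_gt0 lam_gt1 H0 Fc Fe pper phold y.
    by lra.
  + by rewrite divr_ge0// ltW.
  + by lra.
  + have : (n + k)%:R * (w + 2 * near_coef * s `^ alpha) <= (n + k)%:R * zeta by rewrite ler_pM2l.
    by rewrite -[avg_defect + w + _]addrA mulrDr; lra.
Qed.

End Perturbation.

Lemma bernoulli (R : realType) (x : R) n : 0 <= x -> 1 + n%:R * x <= (1 + x) ^+ n.
Proof.
move=> x0; elim: n => [|n IH]; first by rewrite mul0r addr0.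
have x1 : 0 <= 1 + x by lra.
rewrite exprS (le_trans _ (ler_wpM2l x1 IH))// -natr1.
have : 0 <= n%:R * (x * x) by rewrite !mulr_ge0.
lra.
Qed.

Lemma small_geometric (R : realType) (C q z : R) : 0 <= C -> 0 < q -> q < 1 -> 0 < z ->
  exists k, C * q ^+ k <= z.
Proof.
move=> C0 q0 q1 z0; pose x := q^-1 - 1.
have x0 : 0 < x by rewrite subr_gt0 invf_gt1.
pose k := (Num.trunc (C / z / x)).+1; exists k.
have := truncnS_gt (C / z / x); rewrite -/k ltr_pdivrMr// ltr_pdivrMr// => h.
have qE : q ^+ k = ((1 + x) ^+ k)^-1 by rewrite -exprVn /x addrC subrK invrK.
rewrite qE ler_pdivrMr; last by rewrite exprn_gt0//; lra.
apply: (le_trans (ltW h)); rewrite mulrC ler_pM2l//.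
by have := bernoulli k (ltW x0); lra.
Qed.

(** The order of choices is decisive: [ep], [k], [de], [c] and [D0] depend on F and [eps0] only, and
    must be fixed before the period n and the separation g are known. *)
Lemma perturb_locked (R : realType) (alpha lam Lam H lam1 eps0 : R) (F dF : R -> R) :
  0 < alpha -> alpha <= 1 -> 1 < lam -> circle_lift alpha lam Lam H F dF ->
  lam < lam1 -> (forall x, lam1 <= dF x) -> 0 < eps0 ->
  exists h dh : R -> R,
  [/\ (forall x : R, is_derive x (1 : R) h (dh x)),
     (forall x, h (x + 1) = h x) /\ (forall x, dh (x + 1) = dh x),
     (forall x, `|h x| <= eps0) /\ (forall x, `|dh x| <= eps0),
     (forall x y, `|dh x - dh y| <= eps0 * `|x - y| `^ alpha) /\
     (forall x, lam < dF x + dh x) &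
     exists2 e, 0 < e & forall psi dpsi : R -> R,
       (forall x : R, is_derive x (1 : R) psi (dpsi x)) ->
       (forall x, psi (x + 1) = psi x) -> (forall x, dpsi (x + 1) = dpsi x) ->
       (forall x, `|psi x| <= e) -> (forall x, `|dpsi x| <= e) ->
       (forall x y, `|dpsi x - dpsi y| <= e * `|x - y| `^ alpha) ->
       (forall x, lam < dF x + dh x + dpsi x) ->
       locked (fun x => F x + h x + psi x) (fun x => dF x + dh x + dpsi x)].
Proof.
move=> alpha_gt0 alpha_le1 lam_gt1 FL lam1_gt dF_lam1 eps0_gt0.
have L1 := lift_Lam_ge1 lam_gt1 FL; have L0 : 0 < Lam by lra.
have H0 := lift_H_ge0 FL.
pose th := Num.min 1 (Num.min eps0 (lam1 - lam)).
have th0 : 0 < th by rewrite !lt_min ltr01 eps0_gt0 /= subr_gt0.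
have th1 : th <= 1 by rewrite ge_min lexx.
have the : th <= eps0 by rewrite !ge_min lexx orbT.
have thl : th <= lam1 - lam by rewrite !ge_min lexx !orbT.
(* Makes the Hölder constant 12 Lam ep of the perturbation equal to th / 2. *)
pose ep := th / (24 * Lam).
have ep0 : 0 < ep by rewrite divr_gt0// mulr_gt0.
have epL : ep * Lam = th / 24 by rewrite /ep; field; rewrite gt_eqF.
have ep1 : ep <= 1.
  have : ep * 1 <= ep * Lam by rewrite ler_pM2l.
  lra.
(* Common bounds for all the maps T to come: bump and error add at most 1 each. *)
pose Lam' := Lam + 2; pose H' := H + 2.
have H'0 : 0 <= H' by rewrite /H'; lra.
have L'1 : 1 <= Lam' by rewrite /Lam'; lra.
pose q := hold_ratio alpha lam.
have q0 : 0 < q by exact: hold_ratio_gt0.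
have q1 : q < 1 by exact: hold_ratio_lt1.
pose CV := hold_sum alpha lam H.
have CV0 : 0 <= CV by exact: hold_sum_ge0.
have ep256 : 0 < ep / 256 by lra.
have hsCV : 0 <= hold_sum alpha lam H' + 2 * CV.
  by apply: addr_ge0; [exact: hold_sum_ge0|exact: mulr_ge0].
have [k hk] := small_geometric hsCV q0 q1 ep256.
pose de := ep / (256 * k.+1%:R).
have k1 : 0 < (k.+1%:R : R) by rewrite ltr0n.
have k256 : 0 < 256 * (k.+1%:R : R) by lra.
have de0 : 0 < de by exact: divr_gt0.
have dek : k.+1%:R * de = ep / 256 by rewrite /de; field; rewrite addrC natr1 gt_eqF.
(* The bound wanted for [near_coef]: then 2 c / (1 - q) = ep / 256. *)
pose c := ep * (1 - q) / 512.
have q10 : 0 < 1 - q by clear -q1; lra.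
have epq := mulr_gt0 ep0 q10.
have c0 : 0 < c by rewrite /c; lra.
have cep : c <= ep / 512.
  by have := mulr_gt0 ep0 q0; rewrite /c; lra.
have c2 : 0 < c / 2 by clear -c0; lra.
have [d2 d20 hd2] : exists2 d, 0 < d & forall x, 0 <= x -> x <= d -> CV * x `^ alpha <= c / 2.
  have CV1 : 0 < CV + 1 by clear -CV0; lra.
  have z0 : 0 < c / 2 / (CV + 1) by exact: divr_gt0.
  have [d d0 hd] := powR_small alpha_gt0 z0; exists d => // x x0 xd.
  have h1 : x `^ alpha * (CV + 1) <= c / 2 by rewrite -ler_pdivlMr//; exact: hd.
  by have := powR_ge0 x alpha; clear -h1 CV0; lra.
(* The first entry gives H u <= c / 2, the second kap Lam <= d2, for u = D^alpha: the two halves of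
   the bound on [near_coef]. *)
pose u0 := Num.min (c / 2 / (H + 1)) (d2 / Lam).
have H1 : 0 < H + 1 by clear -H0; lra.
have u00 : 0 < u0 by rewrite lt_min; apply/andP; split; exact: divr_gt0.
have [D1 D10 hD1] := powR_small alpha_gt0 u00.
(* Lam' + 4 serves both 4 D <= g and (Lam' + 2) D <= g. *)
pose D0 := Num.min D1 (Lam' + 4)^-1.
have L'4 : 0 < Lam' + 4 by clear -L'1; lra.
have D00 : 0 < D0 by rewrite lt_min D10 invr_gt0.
have D0L : D0 * (Lam' + 4) <= 1.
  by rewrite -ler_pdivlMr// div1r ge_min lexx orbT.
have dD0 : 0 < de * D0 `^ alpha by rewrite mulr_gt0// powR_gt0.
(* Asking for the factor D0^alpha in advance turns the defect bound into de D^alpha with D = D0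
   g. *)
have [n [p [g [pn /andP[g0 g1] sep hdef]]]] := exists_separated_periodic alpha_gt0 lam_gt1 H0
  (lift_cont FL) (lift_exp FL) (lift_lip lam_gt1 FL) (lift_deg2 FL) (log_deriv_per FL)
  (log_deriv_hold lam_gt1 FL) dD0.
pose D := D0 * g.
have D_gt0 : 0 < D by rewrite mulr_gt0.
have DD0 : D <= D0 by rewrite ger_pMr.
have DL : D * (Lam' + 4) <= g.
  rewrite /D mulrAC; have := ler_wpM2r (ltW g0) D0L; rewrite mul1r; exact.
have DL' : 0 <= D * Lam' by apply: mulr_ge0; [exact: ltW|clear -L'1; lra].
have D_sep : 4 * D <= g by clear -DL DL'; lra.
pose u := D `^ alpha.
have u_gt0 : 0 < u by exact: powR_gt0.
have uu0 : u <= u0.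
  by apply: hD1; rewrite ?(ltW D_gt0)// (le_trans DD0)// ge_min lexx.
have u1 : u <= 1.
  by apply: powR_le_one; [exact: ltW|exact: ltW|clear -D_sep g1 D_gt0; lra].
have Hu : H * u <= c / 2.
  apply: (@le_trans _ _ ((H + 1) * u)); first by apply: ler_wpM2r; [exact: ltW|clear; lra].
  by rewrite mulrC -ler_pdivlMr// (le_trans uu0)// ge_min lexx.
pose kap := ep * u.
have kap0 : 0 < kap by rewrite mulr_gt0.
have kapu : kap <= u by rewrite ger_pMl.
have kap1 : kap <= 1 by clear -kapu u1; lra.
have kapep : kap <= ep by rewrite ger_pMr.
have kapL : kap * Lam <= th / 24 by rewrite -epL ler_pM2r.
have kapL0 : 0 <= kap * Lam by rewrite mulr_ge0 ?(ltW kap0)// ltW.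
have CVk : CV * (kap * Lam) `^ alpha <= c / 2.
  apply: hd2 => //; apply: (@le_trans _ _ (u * Lam)); first by rewrite ler_pM2r.
  by rewrite -ler_pdivlMr// (le_trans uu0)// ge_min lexx orbT.
have def : defect F (log_deriv dF) n p <= de * u.
  by apply: (le_trans hdef); rewrite -mulrA -powRM ?(ltW D00) ?(ltW g0).
have n0 : (0 < n)%N by case: pn.
have nR : 0 < (n%:R : R) by rewrite ltr0n.
have nR1 : 1 <= (n%:R : R) by rewrite ler1n.
pose h := eta F dF p D kap; pose dh := deta F dF p D kap.
have hdh := is_derive_eta FL kap pn g1 sep D_gt0 D_sep.
have dhn := deta_norm lam_gt1 FL pn g1 sep D_gt0 D_sep kap0.
have hn := eta_norm lam_gt1 FL pn g1 sep D_gt0 D_sep kap0.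
have dhh := deta_hold alpha_gt0 alpha_le1 lam_gt1 FL pn g1 sep D_gt0 D_sep kap0.
have dhgt x : lam < dF x + dh x.
  have := dhn x; rewrite ler_norml => /andP[h1 _]; have := dF_lam1 x.
  by rewrite -/dh in h1; clear -h1 kapL thl th0; lra.
have dpl1 x : 1 <= dplift F dF p D kap x by rewrite /dplift -/dh; have := dhgt x; clear -lam_gt1; lra.
have D_le1 : D <= 1 by clear -D_sep g1 D_gt0; lra.
have kD : kap * Lam * D <= kap * Lam by rewrite -[X in _ <= X]mulr1 ler_wpM2l.
have hper x : h (x + 1) = h x.
  by apply: (perturbation_per FL kap pn g1 sep D_gt0 D_sep) => t; exact: bump_out.
have dhper x : dh (x + 1) = dh x.
  by apply: (perturbation_per FL kap pn g1 sep D_gt0 D_sep) => t; exact: dbump_out.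
have kD12 : 12 * Lam * (kap / D `^ alpha) = th / 2.
  have -> : kap / D `^ alpha = ep by rewrite /kap -/u mulfK// gt_eqF.
  have -> : 12 * Lam * ep = 12 * (ep * Lam) by ring.
  by rewrite epL; field.
have dhold x y : `|dh x - dh y| <= th / 2 * `|x - y| `^ alpha by rewrite -kD12.
have Ec : near_coef alpha lam Lam H kap <= c.
  have h1 : kap * H <= H * u by rewrite mulrC ler_wpM2l.
  by rewrite /near_coef -/CV; clear -h1 Hu CVk; lra.
have def0 : 0 <= defect F (log_deriv dF) n p.
  exact: (defect_ge0 alpha_gt0 lam_gt1 H0 (lift_cont FL) (lift_exp FL) (log_deriv_per FL) (log_deriv_hold lam_gt1 FL) pn).
exists h, dh; split => //.
- by split => x; [apply: le_trans (hn x) _|apply: le_trans (dhn x) _]; clear -kD kapL the th0; lra.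
- split => // x y; apply: le_trans (dhold x y) _.
  by apply: ler_wpM2r; [exact: powR_ge0|clear -th0 the; lra].
have [|||||e e_gt0 he] := @robust_locking R alpha lam Lam H F dF alpha_gt0 alpha_le1 lam_gt1 FL
   n p g D kap pn g1 sep D_gt0 D_sep kap0 dpl1 kap1 Lam' H' k H'0 L'1.
- by clear -DL D_gt0; lra.
- have := ler_wpM2r (ltW u_gt0) hk; rewrite -/q -/CV -/u /kap; clear -ep0 u_gt0; lra.
(* Since n + k <= (k + 1) n, dividing the defect by the period makes up for the length n, which was
   not known when [de] was chosen. *)
- rewrite /avg_defect mulrA ler_pdivrMr//.
  have h1 : (n + k)%:R <= k.+1%:R * n%:R :> R.
    by rewrite -natrM ler_nat mulSn leq_add2l leq_pmulr.
  apply: (@le_trans _ _ (k.+1%:R * n%:R * (de * u))).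
    by apply: ler_pM.
  have -> : k.+1%:R * n%:R * (de * u) = (k.+1%:R * de) * u * n%:R by ring.
  by rewrite dek /kap ler_pM2r//; clear -ep0 u_gt0; lra.
- rewrite -/q -/u /kap.
  have -> : ep * u / 256 = ep / 256 * u by ring.
  rewrite ler_pM2r// ler_pdivrMr//.
  have -> : ep / 256 * (1 - q) = 2 * c by rewrite /c; field.
  by rewrite ler_pM2l.
- have h1 : avg_defect F dF n p <= de * u.
    rewrite /avg_defect ler_pdivrMr//; apply: (le_trans def).
    by rewrite ler_peMr// mulr_ge0// ltW.
  have h2 : de <= ep / 256.
    by rewrite -dek ler_peMl ?(ltW de0)// ler1n.
  have h3 : de * u <= ep / 256 * u by rewrite ler_pM2r.
  have h4 : kap * H * D `^ alpha <= kap * (c / 2).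
    by rewrite -mulrA ler_pM2l.
  have h5 : hold_sum alpha lam H * (kap * Lam * D) `^ alpha <= c / 2 * u.
    rewrite powRM ?(ltW D_gt0)// mulrA ler_pM2r//.
  have h6 : kap * c <= kap * (ep / 512) by rewrite ler_pM2l.
  have h7 : kap * ep <= kap by rewrite ger_pMr.
  have h8 : c * u <= ep / 512 * u by rewrite ler_pM2r.
  have kE : kap = ep * u by [].
  by clear -h1 h2 h3 h4 h5 h6 h7 h8 kE kap0 kapep ep1 u1 u_gt0 c0 cep CVk Ec kap1 ep0; lra.
exists (Num.min e 1); first by rewrite lt_min e_gt0 ltr01.
move=> psi dpsi psid psip dpsip psin dpsin psih Tgt.
have e1 : Num.min e 1 <= 1 by rewrite ge_min lexx orbT.
have ee : Num.min e 1 <= e by rewrite ge_min lexx.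
apply: he; last 2 first.
- by move=> x; rewrite /plift -/h addrAC subrr add0r (le_trans (psin x)).
- by move=> x; rewrite /dplift -/dh addrAC subrr add0r (le_trans (dpsin x)).
split => //.
- move=> x; have d1 : is_derive x (1 : R) (F + h)%R (dF x + dh x).
    exact: is_deriveD (lift_derive FL x) (hdh x).
  exact: (@is_deriveD _ _ _ (F + h)%R psi x 1 _ _ d1 (psid x)).
- by move=> x; rewrite (lift_deg2 FL) hper psip; ring.
- by move=> x; rewrite (lift_dper FL) dhper dpsip.
- move=> x; have := lift_le FL x; have := dhn x; have := dpsin x.
  rewrite -/dh !ler_norml /Lam' => /andP[_ h1] /andP[_ h2] h3.
  by clear -h1 h2 h3 kapL th0 th1 e1; lra.
- move=> x y.
  have -> : dF x + dh x + dpsi x - (dF y + dh y + dpsi y) =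
    (dF x - dF y) + (dh x - dh y) + (dpsi x - dpsi y) by ring.
  apply: le_trans (ler_normD _ _) _.
  have h1 := ler_normD (dF x - dF y) (dh x - dh y).
  have h2 := lift_hold FL x y; have h3 := dhold x y; have h4 := psih x y.
  have P0 : 0 <= `|x - y| `^ alpha by exact: powR_ge0.
  have h5 : Num.min e 1 * `|x - y| `^ alpha <= 1 * `|x - y| `^ alpha by rewrite ler_wpM2r.
  have h6 : th / 2 * `|x - y| `^ alpha <= 1 * `|x - y| `^ alpha.
    by apply: ler_wpM2r => //; clear -th0 th1; lra.
  by rewrite /H' mulrDl; clear -h1 h2 h3 h4 h5 h6; lra.
Qed.

(** * The circle *)

Section CircleBasics.
Variable R : realType.
Implicit Types (x y : circle R) (s t : R).

Lemma cpi_eqP s t : cpi s = cpi t <-> exists a : int, s = t + a%:~R.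
Proof.
have -> : cpi s = cpi t <-> s - t \in integers R.
  rewrite (Quotient.idealrBE (integers R)); split => [h|/eqP h]; last exact: h.
  by apply/eqP; exact: h.
split.
  move=> h; have /intrP[a ha] : s - t \is a Num.int by exact: h.
  by exists a; rewrite -ha addrC subrK.
move=> [a ->]; rewrite addrAC subrr add0r.
exact: (intr_int R a).
Qed.

Lemma cpi_int s (a : int) : cpi (s + a%:~R) = cpi s.
Proof. by apply/cpi_eqP; exists a. Qed.

Lemma cpiD s t : cpi (s + t) = cpi s + cpi t.
Proof. exact: (Quotient.pi_add (integers R)). Qed.

Lemma cpi0 : cpi (0 : R) = 0.
Proof. by apply: (addIr (cpi 0)); rewrite -cpiD addr0 add0r. Qed.

Lemma cpiN s : cpi (- s) = - cpi s.
Proof. by apply: (addIr (cpi s)); rewrite -cpiD !addNr cpi0. Qed.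

Lemma cpiB s t : cpi (s - t) = cpi s - cpi t.
Proof. by rewrite cpiD cpiN. Qed.

Lemma cvalK x : cpi (cval x) = x.
Proof.
rewrite /cval -rmorphN /= cpi_int.
exact: (@reprK _ (Quotient.quot (integers R)) x).
Qed.

Lemma cpi_surj x : exists t, x = cpi t.
Proof. by exists (cval x); rewrite cvalK. Qed.

Lemma cval_bound x : - 2^-1 <= cval x < 2^-1.
Proof.
rewrite /cval; set t := repr _; have := floor_itv (t + 2^-1); rewrite intrD => /andP[h1 h2].
by apply/andP; split; lra.
Qed.

Lemma cval_cpi t : cval (cpi t) = t - (Num.floor (t + 2^-1))%:~R.
Proof.
have /cpi_eqP[a ha] := cvalK (cpi t); rewrite ha; congr (_ + _).
have /andP[h1 h2] := cval_bound (cpi t); rewrite ha in h1 h2.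
rewrite -[a]opprK rmorphN /=; congr (- _%:~R); symmetry; apply: floor_def.
by rewrite !intrD !rmorphN /=; apply/andP; split; lra.
Qed.

Lemma cval_small t : - 2^-1 <= t < 2^-1 -> cval (cpi t) = t.
Proof.
move=> /andP[h1 h2]; rewrite cval_cpi (@floor_def _ _ 0) ?subr0//.
by rewrite add0r; apply/andP; split; lra.
Qed.

Lemma cdist_cpi s t : exists a : int, cdist (cpi s) (cpi t) = `|s - t - a%:~R|.
Proof. by rewrite /cdist -cpiB cval_cpi; exists (Num.floor (s - t + 2^-1)). Qed.

Lemma cdist_le_half x y : cdist x y <= 2^-1.
Proof.
rewrite /cdist ler_norml; have /andP[h1 h2] := cval_bound (x - y).
by rewrite h1 ltW.
Qed.

Lemma cdist_le s t : cdist (cpi s) (cpi t) <= `|s - t|.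
Proof.
rewrite /cdist -cpiB; set u := s - t.
have [h|h] := leP (2^-1) `|u|.
  apply: le_trans h; rewrite ler_norml; have /andP[h1 h2] := cval_bound (cpi u).
  by rewrite h1 ltW.
by rewrite cval_small//; move: h; rewrite ltr_norml => /andP[h1 h2]; rewrite h2 ltW.
Qed.

Lemma cdist_eq0 x y : cdist x y = 0 -> x = y.
Proof.
move=> /normr0_eq0 h; have := cvalK (x - y); rewrite h cpi0 => /esym/eqP.
by rewrite subr_eq0 => /eqP.
Qed.

Lemma cdist_ge0 x y : 0 <= cdist x y. Proof. exact: normr_ge0. Qed.

Lemma cdist_lift x t : exists s, x = cpi s /\ cdist x (cpi t) = `|s - t|.
Proof.
have [u ->] := cpi_surj x; have [a ha] := cdist_cpi u t.
exists (u - a%:~R); split; first by rewrite -rmorphN /= cpi_int.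
by rewrite ha; congr `|_|; ring.
Qed.

Lemma open_circle (U : set (circle R)) : open U <-> open (@cpi R @^-1` U).
Proof. by []. Qed.

Lemma cpi_continuous : continuous (@cpi R : R -> circle R).
Proof. exact: pi_continuous. Qed.

Lemma circle_continuous (Z : topologicalType) (f : circle R -> Z) :
  continuous (f \o @cpi R) -> continuous f.
Proof. by move=> h; apply/(quotient_continuous f). Qed.

Lemma cpi_open (A : set R) : open A -> open (@cpi R @` A).
Proof.
move=> oA; apply/open_circle.
rewrite (_ : _ @^-1` _ = \bigcup_(a in [set: int]) ((fun s => s + a%:~R) @^-1` A)).
  apply: bigcup_open => a _; apply: open_comp => // s _.
  by apply: cvgD; [exact: cvg_id|exact: cvg_cst].
apply/seteqP; split => s /=.
  move=> [t At /cpi_eqP[a ha]]; exists (a) => //=; by rewrite -ha.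
by move=> [a _ /= As]; exists (s + a%:~R) => //; rewrite cpi_int.
Qed.

Lemma closed_cpi_point t : closed [set cpi t].
Proof.
rewrite -[X in closed X]setCK; apply: open_closedC; apply/open_circle.
have -> : @cpi R @^-1` (~` [set cpi t]) = \bigcup_(a in [set: int]) (`]t + a%:~R, (t + a%:~R) + 1[%classic).
  apply/seteqP; split => s /=.
    move=> h; exists (Num.floor (s - t)) => //=; rewrite in_itv /=.
    have := floor_itv (s - t); rewrite intrD => /andP[h1 h2].
    apply/andP; split; last by lra.
    rewrite lt_neqAle; apply/andP; split; last by lra.
    by apply/eqP => e; apply: h; rewrite -e cpi_int.
  move=> [a _ /=]; rewrite in_itv /= => /andP[h1 h2] /cpi_eqP[b hb].
  have : a%:~R < (b%:~R : R) by lra.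
  have : (b%:~R : R) < (a + 1)%:~R by rewrite intrD; lra.
  rewrite !ltr_int ltzD1 => ba ab; by have := le_lt_trans ba ab; rewrite ltxx.
by apply: bigcup_open => a _; exact: itv_open.
Qed.

End CircleBasics.

(** * Antiderivatives of periodic functions *)

Section Antiderivative.
Variables (R : realType) (c : R -> R).
Hypothesis c_cont : continuous c.
Hypothesis c_per : forall x, c (x + 1) = c x.

Lemma is_derive_shift (f : R -> R) (s t d : R) :
  is_derive (t + s) (1 : R) f d -> is_derive t (1 : R) (fun z => f (z + s)) d.
Proof.
move=> hf.
have hs : is_derive t (1 : R) (fun z : R => z + s) 1.
  by apply: (@is_derive_quadratic _ _ _ _ 0) => h; rewrite mul0r normr_le0; apply/eqP; ring.
have hc := @is_derive1_comp _ f (fun z : R => z + s) t _ _ hf hs.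
by apply: is_derive_eq hc _; rewrite mulr1.
Qed.

Let P (x : R) : R := (\int[@lebesgue_measure R]_(t in [set` `[0, x]]) c t)%R.

Let P_derive (x : R) : 0 < x -> is_derive x (1 : R) P (c x).
Proof.
move=> x0.
have xu : x < x + 1 by rewrite ltrDl.
have int : (@lebesgue_measure R).-integrable `[0, x + 1] (EFin \o c).
  apply: continuous_compact_integrable; first exact: segment_compact.
  exact: continuous_subspaceT.
have cx : {for x, continuous c} by exact: c_cont.
have [d1 d2] := continuous_FTC1_closed xu int x0 cx.
by apply: DeriveDef; [exact: d1|rewrite -derive1E].
Qed.

Let P_shift (x : R) : 0 < x -> P (x + 1) - P x = P 2 - P 1.
Proof.
have main (u v : R) : 0 < u -> u <= v -> P (u + 1) - P u = P (v + 1) - P v.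
  move=> u0; rewrite le_eqVlt => /predU1P[->//|uv].
  have hd (z : R) : 0 < z -> is_derive z (1 : R) (fun z => P (z + 1) - P z) 0.
    move=> z0; have z1 : 0 < z + 1 by lra.
    have h1 := is_derive_shift (P_derive z1).
    have h2 := is_deriveB h1 (P_derive z0).
    by apply: (is_derive_eq h2); rewrite c_per subrr.
  have hd' z : z \in `]u, v[ -> is_derive z (1 : R) (fun z => P (z + 1) - P z) ((fun=> 0) z).
    by rewrite in_itv /= => /andP[uz _]; apply: hd; exact: lt_trans uz.
  have [|z _ h] := @MVT R (fun z => P (z + 1) - P z) (fun=> 0) u v uv hd'.
    apply: continuous_in_subspaceT => z; rewrite inE /= in_itv /= => /andP[uz _].
    have z0 : 0 < z by exact: lt_le_trans uz.
    by apply: differentiable_continuous; apply/derivable1_diffP; case: (hd z z0).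
  by move: h; rewrite mul0r => /eqP; rewrite subr_eq0 => /eqP.
move=> x0; have [x1|/ltW x1] := leP x 1; last by rewrite -(main 1 x).
by rewrite (main x 1).
Qed.

(** [P] is an antiderivative on the positive half-line only. By periodicity [P (x + 1) - P x] is a
    constant k there, so P is extended by shifting t by a large integer N and subtracting N k; the
    result does not depend on N. *)
Lemma antiderivative : exists F : R -> R, forall t : R, is_derive t (1 : R) F (c t).
Proof.
pose k := P 2 - P 1.
have Pn x n : 0 < x -> P (x + n%:R) = P x + n%:R * k.
  move=> x0; elim: n => [|n IH]; first by rewrite addr0 mul0r addr0.
  have xn : 0 < x + n%:R by rewrite ltr_wpDr.
  have := P_shift xn; rewrite -/k -addrA natr1 IH -natr1 => h; lra.
pose N (t : R) := (Num.trunc `|t|).+1.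
have tN t : 0 < t + (N t)%:R.
  have := truncnS_gt `|t|; rewrite -/(N t) => h.
  by have := ler_norm (- t); rewrite normrN; lra.
pose F t := P (t + (N t)%:R) - (N t)%:R * k; exists F => t0.
have FE n t : 0 < t + n%:R -> F t = P (t + n%:R) - n%:R * k.
  move=> tn; rewrite /F.
  wlog nN : / True by apply.
  have [h|/ltnW h] := leqP n (N t).
    have := Pn _ (N t - n)%N tn; rewrite -addrA -natrD subnKC// natrB//.
    by move=> ->; ring.
  have := Pn _ (n - N t)%N (tN t); rewrite -addrA -natrD subnKC// natrB//.
  by move=> ->; ring.
pose n0 := (N t0).+1.
have t0n : 0 < t0 + n0%:R by rewrite /n0 -natr1; have := tN t0; lra.
apply: (@is_derive_local _ _ (fun t => P (t + n0%:R) - n0%:R * k) _ _ 1) => //.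
  move=> z; rewrite ltr_norml => /andP[z1 z2]; apply: FE.
  by rewrite /n0 -natr1; have := tN t0; lra.
have h1 := is_derive_shift (P_derive t0n).
have h2 := is_deriveB h1 (is_derive_cst (n0%:R * k : R) t0 (1 : R)).
apply: (is_derive_eq h2); rewrite subr0.
exact: (periodic_int c_per t0 n0).
Qed.

End Antiderivative.

(** * Lifting circle maps to the line *)

Section CircleLifts.
Variable R : realType.
Implicit Types (f : circle R -> circle R) (F dF : R -> R).

Definition is_lift f F := forall t, f (cpi t) = cpi (F t).

(** Near 0 the chart [cval] inverts [cpi], so [local_expr] is the increment of F there. *)
Lemma cderiv_lift f F (t d : R) : is_lift f F -> is_derive t (1 : R) F d ->
  is_derive (0 : R) (1 : R) (local_expr f (cpi t)) d.
Proof.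
move=> fF hF.
have e h : local_expr f (cpi t) h = cval (cpi (F (h + t) - F t)).
  by rewrite /local_expr -cpiD !fF -cpiB [t + h]addrC.
have hF0 : is_derive (0 + t : R) (1 : R) F d by rewrite add0r.
have h1 := is_deriveB (is_derive_shift hF0) (is_derive_cst (F t) (0 : R) (1 : R)).
have h2 : is_derive (0 : R) (1 : R) (fun h => F (h + t) - F t) d.
  by apply: (is_derive_eq h1); rewrite subr0.
apply: near_eq_is_derive (h2).
have Pc : {for (0 : R), continuous (fun h => F (h + t) - F t)}.
  by apply: differentiable_continuous; apply/derivable1_diffP; case: h2.
have h4 : (0 : R) < 2^-1 by rewrite invr_gt0.
move/cvgrPdist_lt : Pc => /(_ _ h4) near0.
near=> h; rewrite e cval_small//.
have : `|(F (0 + t) - F t) - (F (h + t) - F t)| < 2^-1 by near: h.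
by rewrite add0r subrr sub0r normrN ltr_norml => /andP[/ltW -> ->].
Unshelve. all: by end_near.
Qed.

Lemma C1_map_lift f F dF : is_lift f F -> (forall t : R, is_derive t (1 : R) F (dF t)) ->
  continuous dF -> C1_map f /\ forall t, cderiv f (cpi t) = dF t.
Proof.
move=> fF hF dFc.
have cd t : cderiv f (cpi t) = dF t.
  by rewrite /cderiv derive1E; have [_ ->] := cderiv_lift fF (hF t).
split => //; split.
  by move=> x; have [t ->] := cpi_surj x; have [] := cderiv_lift fF (hF t).
apply: circle_continuous; rewrite (_ : _ \o _ = dF)//.
by apply/funext => t /=; rewrite cd.
Qed.

Lemma cderiv_int f t (a : int) : cderiv f (cpi (t + a%:~R)) = cderiv f (cpi t).
Proof. by rewrite cpi_int. Qed.

(* A circle-valued function with zero derivative is constant: test it with the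
   1-periodic function sin^2(pi x), which vanishes exactly at the integers. *)
Lemma lift_exists f : C1_map f -> exists F, is_lift f F /\
  forall t : R, is_derive t (1 : R) F (cderiv f (cpi t)).
Proof.
move=> [fd fc].
have c_cont : continuous (cderiv f \o @cpi R).
  by move=> x; apply: continuous_comp; [exact: cpi_continuous|exact: fc].
have c_per x : (cderiv f \o @cpi R) (x + 1) = (cderiv f \o @cpi R) x.
  exact: (cderiv_int f x 1).
have [F hF] := antiderivative c_cont c_per.
pose e t := f (cpi t) - cpi (F t).
pose g (s : R) := sin (pi * s) ^+ 2.
have g_per s (a : int) : g (s + a%:~R) = g s.
  by apply: periodic_int => x; rewrite /g mulrDr mulr1 sinDpi sqrrN.
have gE s : g (cval (cpi s)) = g s.
  have /cpi_eqP[a ->] := cvalK (cpi s); exact: g_per.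
pose h t := g (cval (e t - e 0)).
have hd (t : R) : is_derive t (1 : R) h 0.
  have ld : is_derive (t + - t : R) (1 : R) (local_expr f (cpi t)) (cderiv f (cpi t)).
    by rewrite subrr; apply: DeriveDef; [exact: fd|rewrite /cderiv derive1E].
  have d1 := is_derive_shift ld.
  have d2 := is_deriveB d1 (is_deriveB (hF t) (is_derive_cst (F t) t (1 : R))).
  have d3 := is_deriveD (is_derive_cst (cval (e t - e 0)) t (1 : R)) d2.
  (* A real-valued lift of e - e 0 built from the chart at t: its derivative is known, and zero, at
     t, while h = g o u holds everywhere. *)
  set u := (X in is_derive _ _ X _) in d3.
  have d4 : is_derive t (1 : R) u 0.
    by apply: (is_derive_eq d3); rewrite /= subr0 subrr addr0.
  have hu z : h z = g (u z).
    rewrite /h -(gE (u z)); congr (g (cval _)).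
    have -> : u z = cval (e t - e 0) + (local_expr f (cpi t) (z + - t) - (F z - F t)) by [].
    rewrite cpiD cvalK cpiB /local_expr cvalK -cpiD [t + _]addrC subrK cpiB.
    move: (e 0) => E; rewrite /e opprB [RHS]addrAC; congr (_ - _).
    by rewrite [RHS]addrA [X in _ = X + _]addrC !subrKA.
  have d5 : is_derive (u t) (1 : R) g (2 * sin (pi * u t) * (cos (pi * u t) * pi)).
    have hs : is_derive (u t) (1 : R) (fun s : R => pi * s) pi.
      by apply: (@is_derive_quadratic _ _ _ _ 0) => w; rewrite mul0r normr_le0; apply/eqP; ring.
    have hc := @is_derive1_comp _ (@sin R) (fun s : R => pi * s) (u t) _ _ (is_derive_sin _) hs.
    set v : R -> R := @sin R \o _ in hc.
    have hx := @is_deriveM _ _ v v (u t) (1 : R) _ _ hc hc.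
    rewrite (_ : g = (v * v)%R); last by apply/funext => s; rewrite /g expr2.
    by apply: (is_derive_eq hx); rewrite /v /GRing.scale /=; ring.
  have d6 := @is_derive1_comp _ g u t _ _ d5 d4.
  rewrite mulr0 in d6.
  by rewrite (_ : h = g \o u)//; apply/funext => z /=; rewrite hu.
have h0 t : h t = 0.
  rewrite (is_derive_0_is_cst t 0 hd) /h subrr -cpi0 gE /g mulr0 sin0 expr0n.
  by [].
have e0 t : e t = e 0.
  apply/eqP; rewrite -subr_eq0 -(cvalK (e t - e 0)) -cpi0; apply/eqP; congr cpi.
  have /eqP := h0 t; rewrite /h /g sqrf_eq0 => /eqP.
  set s := cval _; have /andP[s1 s2] : - 2^-1 <= s < 2^-1 by exact: cval_bound.
  have p0 := pi_gt0 R.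
  have [sp|sn|//] := ltgtP 0 s => hs.
    have : 0 < sin (pi * s).
      apply: sin_gt0_pi; rewrite mulr_gt0//= gtr_pMr//; lra.
    by rewrite hs ltxx.
  have : 0 < sin (pi * (- s)).
    apply: sin_gt0_pi; rewrite mulr_gt0 ?oppr_gt0//= gtr_pMr//; lra.
  by rewrite mulrN sinN hs oppr0 ltxx.
exists (fun t => F t + cval (e 0)); split.
  by move=> t; rewrite cpiD cvalK -(e0 t) /e addrC subrK.
move=> t; have d := is_deriveD (hF t) (is_derive_cst (cval (e 0)) t (1 : R)).
by apply: (is_derive_eq d); rewrite addr0.
Qed.

End CircleLifts.

(** * Degree and covering maps *)

Section Degree.
Variable R : realType.
Variables (f : circle R -> circle R) (F dF : R -> R).
Hypothesis fF : is_lift f F.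
Hypothesis F_der : forall t : R, is_derive t (1 : R) F (dF t).
Hypothesis dF_gt0 : forall t, 0 < dF t.
Hypothesis dF_per : forall t, dF (t + 1) = dF t.

Lemma lift_lt s t : s < t -> F s < F t.
Proof.
move=> st; have [c _ e] := MVT_derive F_der (ltW st).
by rewrite -subr_gt0 e mulr_gt0// subr_gt0.
Qed.

Lemma lift_add1 : exists k : int, 0 < k /\ forall t, F (t + 1) = F t + k%:~R.
Proof.
have : cpi (F 1) = cpi (F 0).
  by rewrite -!fF -(cpi_int 0 1) add0r.
move=> /cpi_eqP[k hk]; exists k; split.
  by have := lift_lt ltr01; rewrite hk ltrDl ltr0z.
move=> t.
have hd (x : R) : is_derive x (1 : R) (fun z => F (z + 1) - F z) 0.
  have h2 := is_deriveB (is_derive_shift (F_der (x + 1))) (F_der x).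
  by apply: (is_derive_eq h2); rewrite dF_per subrr.
have := is_derive_0_is_cst t 0 hd; rewrite add0r hk; lra.
Qed.

(** F takes the values F 0 + j, 0 <= j < k, on [0, 1[, giving distinct points in the fibre of
    [f (cpi 0)], whereas each of the two disjoint sheets contains exactly one. k = 1 leaves a single
    point for two sheets, k >= 3 puts two points in one sheet. *)
Lemma lift_degree : covering_of_degree 2 f -> forall t, F (t + 1) = F t + 2.
Proof.
move=> [_ cov]; have [k [k0 hk]] := lift_add1.
suff k2 : k = 2 by move=> t; rewrite hk k2.
have [V [U [[_ Vy] _ tU fV hU]]] := cov (f (cpi 0)).
have pre (i : 'I_2) : exists x, [/\ U i x, f x = f (cpi 0) &
    forall x', U i x' -> f x' = f (cpi 0) -> x' = x].
  have [g [_ _ h1 h2]] := hU i; have [Ug fg] := h2 _ Vy.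
  exists (g (f (cpi 0))); split => // x' Ux' fx'.
  by have [_] := h1 _ Ux'; rewrite fx'.
have inU x : f x = f (cpi 0) -> exists i : 'I_2, U i x.
  move=> fx; have : (f @^-1` V) x by rewrite /= fx.
  by rewrite fV => -[i _ Ui]; exists i.
have F1 : F 1 = F 0 + k%:~R by have := hk 0; rewrite add0r.
have cpi_inj (s t : R) : 0 <= s -> s < 1 -> 0 <= t -> t < 1 -> cpi s = cpi t -> s = t.
  move=> s0 s1 t0 t1 /cpi_eqP[a ha].
  have a1 : (a%:~R : R) < 1 by lra.
  have a2 : (0 : R) < (a + 1)%:~R by rewrite intrD; lra.
  rewrite ltrz1 in a1; rewrite ltr0z in a2.
  by rewrite ha (_ : a = 0) ?addr0//; clear -a1 a2; lia.
have Fc : continuous F := is_derive_continuous F_der.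
have lift_point (j : int) : 0 <= j -> j < k -> exists t, [/\ 0 <= t, t < 1 & F t = F 0 + j%:~R].
  move=> j0 jk; have [|||t /andP[t0 t1] ht] := @IVT_solve R F 0 1 (F 0 + j%:~R).
  - exact: Fc.
  - exact: ler01.
  - by rewrite F1 lerDl ler0z j0 lerD2l ler_int ltW.
  exists t; split => //; rewrite lt_neqAle t1 andbT; apply/eqP => e.
  by move: ht; rewrite e F1 => /addrI/intr_inj h; rewrite h ltxx in jk.
have same (i : 'I_2) x x' : U i x -> U i x' -> f x = f (cpi 0) -> f x' = f (cpi 0) -> x = x'.
  move=> Ux Ux' fx fx'; have [z [_ _ hz]] := pre i.
  by rewrite (hz x)// (hz x').
have fpt t (j : int) : F t = F 0 + j%:~R -> f (cpi t) = f (cpi 0).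
  by move=> ht; rewrite !fF ht cpi_int.
have [k1|k1] := eqVneq k 1.
  have uniq x : f x = f (cpi 0) -> x = cpi 0.
    have [t ->] := cpi_surj x.
    rewrite -(cpi_int t (- Num.floor t)) rmorphN /=; set s := t - _.
    have /andP[s0 s1] : 0 <= s < 1 by exact: frac_bound.
    rewrite !fF => /cpi_eqP[a ha]; congr cpi.
    have Fs1 : F s < F 0 + 1 by have := lift_lt s1; rewrite F1 k1.
    have Fs0 : F 0 <= F s.
      by move: s0; rewrite le_eqVlt => /predU1P[<-//|/lift_lt/ltW].
    have a0 : a = 0.
      have h1 : (a%:~R : R) < 1 by lra.
      have h2 : 0 <= (a%:~R : R) by lra.
      rewrite ltrz1 in h1; rewrite ler0z in h2; clear -h1 h2; lia.
    rewrite a0 addr0 in ha.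
    move: s0; rewrite le_eqVlt => /predU1P[//|/lift_lt]; by rewrite ha ltxx.
  have [x [Ux fx _]] := pre ord0; have [x' [Ux' fx' _]] := pre ord_max.
  exfalso; have : ord0 = ord_max :> 'I_2.
    apply: (tU ord0 ord_max) => //; exists x; split => //.
    by rewrite (uniq _ fx) -(uniq _ fx').
  by move=> /(congr1 val).
have [->//|k2] := eqVneq k 2.
have k3 : 2 < k by lia.
have [t0 [s0 u0 h0]] := lift_point 0 isT k0.
have [t1 [s1 u1 h1]] : exists t, [/\ 0 <= t, t < 1 & F t = F 0 + (1 : int)%:~R] by apply: lift_point => //; lia.
have [t2 [s2 u2 h2]] : exists t, [/\ 0 <= t, t < 1 & F t = F 0 + (2 : int)%:~R] by apply: lift_point => //; lia.
exfalso.
have ne (a b : int) (s t : R) : a != b -> F s = F 0 + a%:~R -> F t = F 0 + b%:~R ->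
    0 <= s -> s < 1 -> 0 <= t -> t < 1 -> cpi s <> cpi t.
  move=> ab hs ht ? ? ? ? e; have st := cpi_inj _ _ _ _ _ _ e.
  move: hs; rewrite st// ht => /addrI/intr_inj h; by rewrite h eqxx in ab.
have [i0 I0] := inU _ (fpt _ _ h0); have [i1 I1] := inU _ (fpt _ _ h1).
have [i2 I2] := inU _ (fpt _ _ h2).
have pig : [\/ i0 = i1, i0 = i2 | i1 = i2].
  case: i0 i1 i2 {I0 I1 I2} => [[|[|//]] p0] [[|[|//]] p1] [[|[|//]] p2];
  by [constructor 1; exact/val_inj|constructor 2; exact/val_inj|constructor 3; exact/val_inj].
case: pig => e.
- rewrite e in I0; exact: (ne _ _ _ _ _ h0 h1 s0 u0 s1 u1 (same _ _ _ I0 I1 (fpt _ _ h0) (fpt _ _ h1))).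
- rewrite e in I0; exact: (ne _ _ _ _ _ h0 h2 s0 u0 s2 u2 (same _ _ _ I0 I2 (fpt _ _ h0) (fpt _ _ h2))).
- rewrite e in I1; exact: (ne _ _ _ _ _ h1 h2 s1 u1 s2 u2 (same _ _ _ I1 I2 (fpt _ _ h1) (fpt _ _ h2))).
Qed.

End Degree.

Section Covering.
Variables (R : realType) (lam : R) (f : circle R -> circle R) (F : R -> R).
Hypothesis fF : is_lift f F.
Hypothesis lam_gt1 : 1 < lam.
Hypothesis F_cont : continuous F.
Hypothesis F_exp : forall x y, x <= y -> lam * (y - x) <= F y - F x.
Hypothesis F_deg2 : forall x, F (x + 1) = F x + 2.

Lemma lift_continuous : continuous f.
Proof.
apply: circle_continuous; rewrite (_ : _ \o _ = @cpi R \o F).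
  by move=> t; apply: continuous_comp; [exact: F_cont|exact: cpi_continuous].
by apply/funext => t /=; rewrite fF.
Qed.

(** The trivialised neighbourhood of y is the circle without the antipode of y, the image of the
    unit interval [J 0]. Moving t by 1 moves F t by 2, so among the integer translates of this
    interval only the parity distinguishes preimages: two sheets. *)
Lemma lift_covering : covering_of_degree 2 f.
Proof.
split; first exact: lift_continuous.
have [Fi FiK] : exists Fi : R -> R, forall v, F (Fi v) = v.
  have h v : exists x, F x = v by have [x] := iter_surj lam_gt1 F_cont F_exp 1 v; exists x.
  by have [g hg] := choice h; exists g.
have Fdist x y : `|x - y| <= `|F x - F y| := iter_mono lam_gt1 F_exp 1 x y.
have FK t : Fi (F t) = t.
  apply/eqP; rewrite -subr_eq0 -normr_le0; apply: le_trans (Fdist _ _) _.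
  by rewrite FiK subrr normr0.
have Fi_cont : continuous Fi.
  move=> v; apply/cvgrPdist_lt => e e0; near=> u.
  apply: le_lt_trans (Fdist _ _) _; rewrite !FiK.
  by near: u; apply: cvgr_dist_lt => //; exact: cvg_id.
have F_int x (a : int) : F (x + a%:~R) = F x + (a%:~R + a%:~R).
  have := iter_deg2 F_deg2 1 x a.
  have -> : 2 ^+ 1 * a = a + a by ring.
  by rewrite intrD.
move=> y; pose s0 := cval y.
have ys0 : y = cpi s0 by rewrite /s0 cvalK.
pose J (i : nat) : set R := [set s | `|s - s0 - i%:R| < 2^-1].
have half0 : (0 : R) < 2^-1 by rewrite invr_gt0.
have oJ i : open (J i).
  rewrite (_ : J i = `]s0 + i%:R - 2^-1, s0 + i%:R + 2^-1[%classic); first exact: itv_open.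
  by apply/seteqP; split => s; rewrite /J /= in_itv /= ltr_norml => /andP[h1 h2]; apply/andP; split; lra.
exists (@cpi R @` J 0%N), (fun i : 'I_2 => @cpi R @` (F @^-1` J i)).
have Jint (i : nat) s : J i s -> J 0%N (s - i%:R).
  by rewrite /J /= subr0 => h; rewrite addrAC.
have Jint' (i : nat) s : J 0%N s -> J i (s + i%:R).
  rewrite /J /= subr0 => h.
  by have -> : s + i%:R - s0 - i%:R = s - s0 by ring.
have cvalJ s : J 0%N s -> cval (cpi s - y) = s - s0.
  rewrite /J /= subr0 ltr_norml => /andP[h1 h2].
  by rewrite ys0 -cpiB cval_small// h2 ltW.
have cpi_nat (s : R) (i : nat) : cpi (s + i%:R) = cpi s by exact: (cpi_int s i).
split.
- split; first exact: cpi_open.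
  by rewrite ys0; exists s0 => //; rewrite /J /= !subrr normr0.
- by move=> i; apply: cpi_open; apply: open_comp => // t _; exact: F_cont.
- move=> i j _ _ [x [[t Jt <-] [t' Jt' /cpi_eqP[a ha]]]].
  move: Jt Jt'; rewrite /J /= ha F_int !ltr_norml => /andP[h1 h2] /andP[h3 h4].
  have h5 : ((a + a + i%:Z)%:~R : R) < (j%:Z + 1)%:~R.
    by rewrite !intrD -!pmulrn; lra.
  have h6 : ((j%:Z)%:~R : R) < (a + a + i%:Z + 1)%:~R.
    by rewrite !intrD -!pmulrn; lra.
  rewrite !ltr_int in h5 h6.
  apply/val_inj; have := ltn_ord i; have := ltn_ord j; move: h5 h6 => /=; clear -a; lia.
- apply/seteqP; split => x /=.
    move=> [s Js]; have [t ->] := cpi_surj x; rewrite fF => /esym/cpi_eqP[b hb].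
    (* The parity of b is the index of the sheet. *)
    pose c := (b %/ 2)%Z; pose i := `|(b %% 2)%Z|%N.
    have i2 : (i < 2)%N by rewrite /i; have := modz_ge0 b (isT : 2 != 0 :> int); have := ltz_pmod b (isT : 0 < 2 :> int); lia.
    have bE : b = c + c + i%:Z by rewrite /i /c; have := divz_eq b 2; have := modz_ge0 b (isT : 2 != 0 :> int); lia.
    exists (Ordinal i2) => //; exists (t - c%:~R); last by rewrite -rmorphN /= cpi_int.
    rewrite /= -rmorphN /= F_int hb (_ : s + b%:~R + ((- c)%:~R + (- c)%:~R) = s + i%:R).
      exact: Jint'.
    by rewrite bE !intrD -!pmulrn rmorphN /=; ring.
  move=> [i _ [t Jt <-]]; exists (F t - i%:R); first exact: Jint.
  by rewrite fF -(cpi_nat (F t - i%:R) i) subrK.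
- move=> i; exists (fun z => cpi (Fi (s0 + cval (z - y) + i%:R))); split.
  + by apply: continuous_subspaceT; exact: lift_continuous.
  + rewrite continuous_open_subspace; last exact: cpi_open.
    move=> z; rewrite inE => -[s Js <-] W /=.
    pose gam u := cpi (Fi (u + i%:R)).
    have c1 : continuous (fun u : R => u + i%:R).
      by move=> u; apply: cvgD; [exact: cvg_id|exact: cvg_cst].
    have c2 : continuous (Fi \o (fun u : R => u + i%:R)).
      by move=> u; apply: continuous_comp; [exact: c1|exact: Fi_cont].
    have gam_cont : continuous (@cpi R \o (Fi \o (fun u : R => u + i%:R))).
      by move=> u; apply: continuous_comp; [exact: c2|exact: cpi_continuous].
    have gE u : J 0%N u -> cpi (Fi (s0 + cval (cpi u - y) + i%:R)) = gam u.
      move=> Ju; rewrite cvalJ//.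
      by have -> : s0 + (u - s0) + i%:R = u + i%:R by ring.
    rewrite gE// nbhsE => -[W' [oW' W's] W'W].
    suff : nbhs (cpi s) ((fun z => cpi (Fi (s0 + cval (z - y) + i%:R))) @^-1` W) by [].
    apply: (@filterS _ _ _ (@cpi R @` (J 0%N `&` gam @^-1` W'))).
      by move=> _ [u [Ju W'u] <-] /=; apply: W'W; rewrite gE.
    apply: open_nbhs_nbhs; split; last by exists s.
    by apply: cpi_open; apply: openI => //; apply: open_comp => // u _; exact: gam_cont.
  + move=> _ [t Jt <-]; rewrite /= in Jt; split.
      exists (F t - i%:R); first exact: Jint.
      by rewrite fF -(cpi_nat (F t - i%:R) i) subrK.
    have -> : f (cpi t) = cpi (F t - i%:R) by rewrite fF -(cpi_nat (F t - i%:R) i) subrK.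
    by rewrite cvalJ; [congr cpi; rewrite -[RHS]FK; congr Fi; ring|exact: Jint].
  + move=> _ [s Js <-]; rewrite cvalJ//.
    have e : F (Fi (s0 + (s - s0) + i%:R)) = s + i%:R by rewrite FiK; ring.
    split; last by rewrite fF e cpi_nat.
    by eexists; last reflexivity; rewrite /= e; exact: Jint'.
Unshelve. all: by end_near.
Qed.

End Covering.

(** * Hölder and C^{1+alpha} norms on the circle *)

Section Norms.
Variables (R : realType) (alpha : R).
Hypothesis alpha_gt0 : 0 < alpha.
Implicit Types (g phi : circle R -> R).

Lemma Hold_le g C : 0 <= C -> (Hold alpha g <= C%:E)%E ->
  forall s t, `|g (cpi s) - g (cpi t)| <= C * `|s - t| `^ alpha.
Proof.
move=> C0 hC s t; have d0 := cdist_ge0 (cpi s) (cpi t).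
apply: (@le_trans _ _ (C * cdist (cpi s) (cpi t) `^ alpha)); last first.
  by rewrite ler_wpM2l//; apply: powR_le; rewrite ?(ltW alpha_gt0)// cdist_le.
have [e|ne] := eqVneq (cdist (cpi s) (cpi t)) 0.
  by rewrite (cdist_eq0 e) subrr normr0 mulr_ge0// powR_ge0.
have dpos : 0 < cdist (cpi s) (cpi t) by rewrite lt_neqAle eq_sym ne.
have d1 : cdist (cpi s) (cpi t) <= 1 by have := cdist_le_half (cpi s) (cpi t); lra.
rewrite -ler_pdivrMr ?powR_gt0// -lee_fin; apply: le_trans hC.
by apply: ereal_sup_ubound; exists (cpi s), (cpi t); rewrite dpos d1.
Qed.

Lemma le_Hold g C : (forall s t, `|g (cpi s) - g (cpi t)| <= C * `|s - t| `^ alpha) ->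
  (Hold alpha g <= C%:E)%E.
Proof.
move=> hC; apply: ge_ereal_sup => _ [x [y [/andP[d0 d1] ->]]].
have [t yE] := cpi_surj y; move: d0; rewrite yE => d0.
have [s [xE ds]] := cdist_lift x t.
by rewrite lee_fin ler_pdivrMr ?powR_gt0// {1}xE ds hC.
Qed.

Lemma Hold_finite g : (Hold alpha g < +oo)%E -> exists C, 0 <= C /\
  forall s t, `|g (cpi s) - g (cpi t)| <= C * `|s - t| `^ alpha.
Proof.
move=> hg; have [C [C0 hC]] : exists C, 0 <= C /\ (Hold alpha g <= C%:E)%E.
  case: (Hold alpha g) hg => [r _|//|_].
    by exists (Num.max 0 r); rewrite le_max lexx lee_fin le_max lexx orbT.
  by exists 0; rewrite leNye.
by exists C; split => //; exact: Hold_le.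
Qed.

Let sup_ge0 (X : set (\bar R)) x : X x%:E -> 0 <= x -> (0 <= ereal_sup X)%E.
Proof. by move=> Xx x0; apply: (@le_trans _ _ x%:E); [rewrite lee_fin|exact: ereal_sup_ubound]. Qed.

Lemma norm_C1alpha_lt phi e : (norm_C1alpha alpha phi < e%:E)%E ->
  [/\ forall x, `|phi x| <= e, forall x, `|rderiv phi x| <= e &
    forall s t, `|rderiv phi (cpi s) - rderiv phi (cpi t)| <= e * `|s - t| `^ alpha].
Proof.
rewrite /norm_C1alpha /norm_C1.
set A := ereal_sup _; set B := ereal_sup _; set C := Hold _ _.
have A0 : (0 <= A)%E by apply: (@sup_ge0 _ `|phi (cpi 0)|); [exists (cpi 0)|].
have B0 : (0 <= B)%E by apply: (@sup_ge0 _ `|rderiv phi (cpi 0)|); [exists (cpi 0)|].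
have C0 : (0 <= C)%E.
  apply: sup_ge0.
    (* One pair at positive distance makes [Hold] nonnegative; the supremum of the empty set would
       be -oo. *)
    exists (cpi (4^-1)), (cpi 0); split; last reflexivity.
    rewrite /cdist -cpiB subr0 cval_small; last by apply/andP; split; lra.
    by rewrite ger0_norm; [apply/andP; split; lra|lra].
  by rewrite divr_ge0// powR_ge0.
move=> h.
have hA : (A <= e%:E)%E by apply: le_trans (ltW h); rewrite -addeA leeDl// adde_ge0.
have hB : (B <= e%:E)%E by apply: le_trans (ltW h); rewrite addeAC leeDr// adde_ge0.
have hC : (C <= e%:E)%E by apply: le_trans (ltW h); rewrite leeDr// adde_ge0.
have e0 : 0 <= e by rewrite -lee_fin (le_trans A0).
split.
- by move=> x; rewrite -lee_fin; apply: le_trans hA; apply: ereal_sup_ubound; exists x.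
- by move=> x; rewrite -lee_fin; apply: le_trans hB; apply: ereal_sup_ubound; exists x.
- exact: Hold_le.
Qed.

Lemma norm_C1alpha_le phi d : (forall x, `|phi x| <= d) -> (forall x, `|rderiv phi x| <= d) ->
  (forall s t, `|rderiv phi (cpi s) - rderiv phi (cpi t)| <= d * `|s - t| `^ alpha) ->
  (norm_C1alpha alpha phi <= (3 * d)%:E)%E.
Proof.
move=> h1 h2 h3; have -> : 3 * d = d + d + d by ring.
rewrite /norm_C1alpha /norm_C1 !EFinD; apply: leeD; last exact: le_Hold.
by apply: leeD; apply: ge_ereal_sup => _ [x _ <-]; rewrite lee_fin.
Qed.

Lemma C1_fun_lift phi : C1_fun phi ->
  forall t : R, is_derive t (1 : R) (phi \o @cpi R) (rderiv phi (cpi t)).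
Proof.
move=> [hd _] t.
have ld : is_derive (t + - t : R) (1 : R) (rlocal_expr phi (cpi t)) (rderiv phi (cpi t)).
  by rewrite subrr; apply: DeriveDef; [exact: hd|rewrite /rderiv derive1E].
have := is_derive_shift ld.
rewrite (_ : (fun z => _) = phi \o @cpi R)//.
by apply/funext => z; rewrite /rlocal_expr /= -cpiD addrC subrK.
Qed.

Lemma lift_C1_fun phi (psi dpsi : R -> R) : (forall t, phi (cpi t) = psi t) ->
  (forall t : R, is_derive t (1 : R) psi (dpsi t)) -> continuous dpsi ->
  C1_fun phi /\ forall t, rderiv phi (cpi t) = dpsi t.
Proof.
move=> hphi hpsi cpsi.
have h t : is_derive (0 : R) (1 : R) (rlocal_expr phi (cpi t)) (dpsi t).
  have ht : is_derive (0 + t : R) (1 : R) psi (dpsi t) by rewrite add0r.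
  have := is_derive_shift ht; rewrite (_ : (fun z => _) = rlocal_expr phi (cpi t))//.
  by apply/funext => z; rewrite /rlocal_expr /= -cpiD hphi addrC.
have hr t : rderiv phi (cpi t) = dpsi t.
  by rewrite /rderiv derive1E; have [_ ->] := h t.
split => //; split.
  by move=> x; have [t ->] := cpi_surj x; have [] := h t.
apply: circle_continuous; rewrite (_ : _ \o _ = dpsi)//.
by apply/funext => t /=; rewrite hr.
Qed.

Lemma hold_continuous (u : R -> R) C : 0 <= C ->
  (forall s t, `|u s - u t| <= C * `|s - t| `^ alpha) -> continuous u.
Proof.
move=> C0 hu t; apply/cvgrPdist_le => e e0.
have [d d0 hd] := powR_small alpha_gt0 (divr_gt0 e0 (ltr_wpDl C0 ltr01) : 0 < e / (C + 1)).
near=> s; apply: le_trans (hu _ _) _.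
have : `|t - s| `^ alpha <= e / (C + 1).
  apply: hd => //; apply: ltW; near: s; apply: cvgr_dist_lt => //; exact: cvg_id.
rewrite ler_pdivlMr ?ltr_wpDl// => h; apply: le_trans h.
by have := powR_ge0 `|t - s| alpha; lra.
Unshelve. all: by end_near.
Qed.

Lemma periodic_bounds (u : R -> R) : continuous u -> (forall x, u (x + 1) = u x) ->
  exists a b, (forall x, u a <= u x) /\ (forall x, u x <= u b).
Proof.
move=> uc up.
have red x : exists2 y, y \in `[0, 1]%R & u x = u y.
  exists (x - (Num.floor x)%:~R).
    by rewrite in_itv /=; have /andP[-> /ltW ->] := frac_bound x.
  by rewrite -(periodic_int up (x - (Num.floor x)%:~R) (Num.floor x)) subrK.
have [a _ ha] := @EVT_min R u 0 1 ler01 (continuous_subspaceT uc).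
have [b _ hb] := @EVT_max R u 0 1 ler01 (continuous_subspaceT uc).
exists a, b; split => x; have [y yI ->] := red x; [exact: ha|exact: hb].
Qed.

End Norms.

(** Compactness makes the strict bound on the derivative uniform: [lam1] and [Lam] are its minimum
    and its maximum. *)
Lemma expanding_lift (R : realType) (alpha lam : R) (f : circle R -> circle R) :
  0 < alpha -> 1 < lam -> is_expanding_map alpha lam f ->
  exists F Lam H lam1, [/\ is_lift f F,
    circle_lift alpha lam Lam H F (cderiv f \o @cpi R), 0 <= H, lam < lam1 &
    forall x, lam1 <= (cderiv f \o @cpi R) x].
Proof.
move=> a0 l1 [[C1f Hf] cov pos gt].
have [F [fF Fd]] := lift_exists C1f.
have dper x : (cderiv f \o @cpi R) (x + 1) = (cderiv f \o @cpi R) x.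
  exact: (cderiv_int f x 1).
have dcont : continuous (cderiv f \o @cpi R).
  by move=> x; apply: continuous_comp; [exact: cpi_continuous|have [_ cc] := C1f; exact: cc].
have [a [b [ha hb]]] := periodic_bounds dcont dper.
have [H [H0 hH]] := Hold_finite a0 Hf.
have F2 : forall t, F (t + 1) = F t + 2.
  by apply: (lift_degree fF Fd _ _ cov) => t; [exact: pos|exact: dper].
exists F, (cderiv f (cpi b)), H, (cderiv f (cpi a)); split; [exact: fF| |exact: H0|exact: gt|exact: ha].
by split; [exact: Fd|exact: F2|exact: dper|move=> x; exact: gt|exact: hb|exact: hH].
Qed.

(** * Invariant measures *)

Section InvariantIntegral.
Context d (T : measurableType d) (R : realType).
Variables (nu : probability T R) (f : T -> T).
Hypothesis mf : measurable_fun [set: T] f.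
Hypothesis inv : forall A, measurable A -> nu (f @^-1` A) = nu A.

Lemma measurable_iter i : measurable_fun [set: T] (iter i f).
Proof.
elim: i => [|i IH]; first exact: measurable_id.
exact: (measurableT_comp mf IH).
Qed.

Lemma measure_preimage_iter i A : measurable A -> nu (iter i f @^-1` A) = nu A.
Proof.
elim: i A => [//|i IH] A mA.
have mfA : measurable (f @^-1` A) by rewrite -[X in measurable X]setTI; exact: mf.
by rewrite -(inv mA) -(IH _ mfA).
Qed.

Lemma integral_comp_inv (g : T -> \bar R) : measurable_fun setT g -> (forall x, (0 <= g x)%E) ->
  (\int[nu]_x g (f x) = \int[nu]_x g x)%E.
Proof.
move=> mg g0.
rewrite -(@ge0_integral_pushforward _ _ T T R f mf nu setT g measurableT mg (fun x _ => g0 x)).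
by apply: eq_measure_integral => A mA _; exact: inv.
Qed.

Lemma integral_birkhoff (g : T -> \bar R) N : measurable_fun setT g -> (forall x, (0 <= g x)%E) ->
  (\int[nu]_x (\sum_(i < N) g (iter i f x)) = N%:R%:E * \int[nu]_x g x)%E.
Proof.
move=> mg g0.
have mgi i : measurable_fun setT (fun x => g (iter i f x)).
  exact: (measurableT_comp mg (measurable_iter i)).
have it i : (\int[nu]_x g (iter i f x) = \int[nu]_x g x)%E.
  elim: i => [//|i IH]; rewrite -IH.
  rewrite -(@integral_comp_inv (fun x => g (iter i f x)))//.
  by apply: eq_integral => x _; rewrite -iterSr.
elim: N => [|N IH].
  by rewrite mul0e; under eq_integral do rewrite big_ord0; rewrite integral0.
under eq_integral do rewrite big_ord_recr /=.
rewrite ge0_integralD//=; last by apply: emeasurable_sum => i; exact: mgi.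
  by rewrite IH it -natr1 EFinD ge0_muleDl ?mul1e.
by move=> x _; apply: sume_ge0.
Qed.

(** Integrating the bound gives N times the integral at most N A + C, first with N = 1 for
    finiteness; then C becomes negligible as N grows. *)
Lemma integral_le_average (g : T -> R) (A C : R) : measurable_fun setT g -> (forall x, 0 <= g x) ->
  (forall N x, \sum_(i < N) g (iter i f x) <= N%:R * A + C) -> (\int[nu]_x (g x)%:E <= A%:E)%E.
Proof.
move=> mg g0 hN.
have mg' : measurable_fun setT (fun x => (g x)%:E) by exact/measurable_EFinP.
have I0 : (0 <= \int[nu]_x (g x)%:E)%E by apply: integral_ge0 => x _; rewrite lee_fin.
have bound N : (N%:R%:E * \int[nu]_x (g x)%:E <= (N%:R * A + C)%:E)%E.
  rewrite -integral_birkhoff//.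
  apply: (@le_trans _ _ (\int[nu]_x (cst (N%:R * A + C)%:E x))%E).
    apply: ge0_le_integral => //.
    - by move=> x _; apply: sume_ge0 => i _; rewrite lee_fin.
    - by apply: emeasurable_sum => i; exact: (measurableT_comp mg' (measurable_iter i)).
    - by move=> x _; rewrite sumEFin lee_fin.
  by rewrite integral_cst//= probability_setT mule1.
have If : (\int[nu]_x (g x)%:E < +oo)%E.
  by have := bound 1%N; rewrite mul1e => h; apply: le_lt_trans h _; rewrite ltry.
rewrite -(@fineK _ (\int[nu]_x (g x)%:E)%E) in bound *; last by rewrite ge0_fin_numE.
move: (fine _) bound => I bound; rewrite lee_fin.
have [//|AI] := leP I A.
have d0 : 0 < I - A by rewrite subr_gt0.
have := truncnS_gt (C / (I - A)); set N := (Num.trunc _).+1.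
by rewrite ltr_pdivrMr// => h; have := bound N; rewrite -EFinM lee_fin; lra.
Qed.

End InvariantIntegral.

(** * Measures on periodic orbits *)

Section OrbitMeasure.
Context d (T : measurableType d) (R : realType).
Variables (f : T -> T) (x0 : T) (m : nat).
Hypothesis f_per : iter m.+1 f x0 = x0.

(** The average of Dirac masses over a period [m.+1], not necessarily the least one. *)
Definition orbit_measure : set T -> \bar R :=
  mscale (m.+1%:R^-1)%:nng (msum (fun i => @dirac _ T (iter i f x0) R) m.+1).

HB.instance Definition _ := Measure.on orbit_measure.

Lemma orbit_measureE A : orbit_measure A =
  ((m.+1%:R^-1)%:E * \sum_(i < m.+1) (\1_A (iter i f x0))%:E)%E.
Proof. by []. Qed.

Lemma orbit_measure_setT : orbit_measure setT = 1%E.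
Proof.
rewrite orbit_measureE; under eq_bigr do rewrite indicT.
by rewrite sumEFin sumr_const card_ord -EFinM mulVf// pnatr_eq0.
Qed.

HB.instance Definition _ := Measure_isProbability.Build _ _ _ orbit_measure orbit_measure_setT.

Lemma orbit_sum_shift (V : nmodType) (g : T -> V) :
  \sum_(i < m.+1) g (f (iter i f x0)) = \sum_(i < m.+1) g (iter i f x0).
Proof.
rewrite big_ord_recr [RHS]big_ord_recl /= -iterS f_per addrC.
by congr (_ + _); apply: eq_bigr => i _; rewrite -iterS.
Qed.

Lemma orbit_sum_iter (V : nmodType) (g : T -> V) k :
  \sum_(i < m.+1) g (iter i f (iter k f x0)) = \sum_(i < m.+1) g (iter i f x0).
Proof.
elim: k g => [//|k IH] g; rewrite -orbit_sum_shift -(IH (g \o f)).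
by apply: eq_bigr => i _; rewrite /= -iterSr iterS.
Qed.

Lemma orbit_measure_inv A : orbit_measure (f @^-1` A) = orbit_measure A.
Proof.
rewrite !orbit_measureE !sumEFin; congr (_ * _%:E)%E.
exact: (orbit_sum_shift (fun x => \1_A x : R)).
Qed.

Lemma integral_orbit_measure (g : T -> R) : measurable_fun setT g -> (forall x, 0 <= g x) ->
  (\int[orbit_measure]_x (g x)%:E)%E = ((\sum_(i < m.+1) g (iter i f x0)) / m.+1%:R)%:E.
Proof.
move=> mg g0; have mg' : measurable_fun setT (fun x => (g x)%:E) by exact/measurable_EFinP.
rewrite ge0_integral_mscale//; last by move=> x _; rewrite lee_fin.
rewrite ge0_integral_measure_sum//; last by move=> x _; rewrite lee_fin.
under eq_bigr do rewrite integral_dirac// diracT mul1e.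
by rewrite sumEFin -EFinM mulrC.
Qed.

(* On the orbit, the sum of the indicator of A along a period is constant. *)
Lemma orbit_measure_unique (nu : probability T R) : measurable_fun [set: T] f ->
  (forall A, measurable A -> nu (f @^-1` A) = nu A) ->
  measurable (range (fun i => iter i f x0)) -> nu (range (fun i => iter i f x0)) = 1%E ->
  forall A, measurable A -> nu A = orbit_measure A.
Proof.
move=> mf inv mO nuO A mA; set O := range _ in mO nuO.
have mI : measurable_fun setT (fun x => (\1_A x : R)%:E) by apply/measurable_EFinP; exact: measurable_indic.
have I0 x : (0 <= (\1_A x : R)%:E)%E by rewrite lee_fin.
have h1 := integral_birkhoff mf inv m.+1 mI I0.
have nuOC : nu (~` O) = 0%E by rewrite probability_setC// nuO subee.
have h2 : (\int[nu]_x \sum_(i < m.+1) (\1_A (iter i f x))%:E =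
    \int[nu]_x (cst (\sum_(i < m.+1) (\1_A (iter i f x0))%:E) x))%E.
  apply: ge0_ae_eq_integral => //.
  - by apply: emeasurable_sum => i; exact: (measurableT_comp mI (measurable_iter mf i)).
  - by move=> x _; apply: sume_ge0.
  - by move=> x _; apply: sume_ge0.
  - exists (~` O); split => //; first exact: measurableC.
    move=> x /= h [k _ kx]; apply: h => _; rewrite -kx.
    by rewrite !sumEFin; congr EFin; exact: (orbit_sum_iter (fun x => \1_A x : R)).
rewrite h2 integral_cst//= probability_setT mule1 integral_indic// setIT in h1.
rewrite orbit_measureE h1 muleA -EFinM mulVf ?mul1e// pnatr_eq0//.
Qed.

End OrbitMeasure.

(** * Borel sets of the circle *)

Section CircleBorel.
Variable R : realType.

Lemma open_borel (U : set (circle R)) : open U -> measurable (U : set (cborel R)).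
Proof. by move=> oU; exact: sub_sigma_algebra. Qed.

Lemma closed_borel (U : set (circle R)) : closed U -> measurable (U : set (cborel R)).
Proof.
move=> cU; rewrite -[U]setCK; apply: measurableC.
by apply: open_borel; exact: closed_openC.
Qed.

Lemma circle_fun_measurable (u : circle R -> R) : continuous u ->
  measurable_fun [set: cborel R] (u : cborel R -> R).
Proof.
move=> /continuousP cu; apply: (measurability _ (RGenOpens.measurableE R)).
move=> _ [_ [a [b ->] <-]]; rewrite setTI; apply: open_borel.
exact/cu/interval_open.
Qed.

Lemma circle_map_measurable (f : circle R -> circle R) : continuous f ->
  measurable_fun [set: cborel R] (f : cborel R -> cborel R).
Proof.
move=> /continuousP cf; apply: (@measurability _ _ (cborel R) (cborel R) setT f (@open (circle R)) erefl).
move=> _ [U oU <-]; rewrite setTI; apply: open_borel; exact: cf.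
Qed.

Lemma orbit_closed (f : circle R -> circle R) x0 m : iter m.+1 f x0 = x0 ->
  closed (range (fun i => iter i f x0)).
Proof.
move=> fper; rewrite (_ : range _ = \bigcup_(i in `I_m.+1) [set iter i f x0]).
  apply: closed_bigcup => // i _.
  by have [t ->] := cpi_surj (iter i f x0); exact: closed_cpi_point.
apply/seteqP; split; last by move=> _ [i _ ->]; exists i.
move=> _ [k _ <-]; exists (k %% m.+1)%N; first by rewrite /= ltn_mod.
rewrite /= {1}(divn_eq k m.+1); elim: (k %/ m.+1)%N => [//|q IH].
by rewrite mulSn -addnA addnC iterD fper IH.
Qed.

End CircleBorel.

Theorem locked_unique_maximizing (R : realType) (f : circle R -> circle R) (T dT : R -> R) :
  is_lift f T -> continuous f -> continuous (cderiv f) -> (forall t, cderiv f (cpi t) = dT t) ->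
  (forall t, 1 <= dT t) -> locked T dT ->
  exists mu : probability (cborel R) R,
      [/\ maximizing f mu,
          (forall nu : probability (cborel R) R, maximizing f nu -> same_measure nu mu) &
          uniquely_ergodic f (supp mu)].
Proof.
move=> fT fc dfc dfE dT1 [[|m] [p [r [c [C [[[n0 [a ha]] r0] c0 _ expa bound]]]]]] //.
have fTi i t : iter i f (cpi t) = cpi (iter i T t) by elim: i => [//|i IH] /=; rewrite IH fT.
pose x0 : circle R := cpi p.
have fper : iter m.+1 f x0 = x0 by rewrite fTi ha cpi_int.
have mf := circle_map_measurable fc.
pose O : set (circle R) := range (fun i => iter i f x0).
have cO : closed O := orbit_closed fper.
have mO := closed_borel cO.
have OE t : O (cpi t) <-> orbit_lift T p t.
  split=> [[i _]|[i [b ->]]].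
    by rewrite fTi => /esym/cpi_eqP[b ->]; exists i, b.
  by exists i => //; rewrite fTi cpi_int.
pose mu : probability (cborel R) R := orbit_measure R (f : cborel R -> cborel R) (x0 : cborel R) m.
pose Near : set (circle R) := @cpi R @` near_orbit T p r.
have NearE t : Near (cpi t) <-> near_orbit T p r t.
  split=> [[s [y [i [b ->]] ys] /cpi_eqP[e es]]|]; last by exists t.
  have -> : t = s - e%:~R by rewrite es addrK.
  exists (iter i T p + b%:~R - e%:~R); first by exists i, (b - e); rewrite intrB addrA.
  by rewrite opprB addrA subrK.
have mFar : measurable (~` Near : set (cborel R)).
  apply: measurableC; apply: open_borel; apply: cpi_open.
  rewrite (_ : near_orbit T p r = \bigcup_(y in orbit_lift T p) `]y - r, y + r[%classic).
    by apply: bigcup_open => y _; exact: itv_open.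
  apply/seteqP; split => [t [y oy]|t [y oy]]; rewrite /= ?in_itv /=.
    by rewrite ltr_norml => /andP[h1 h2]; exists y => //; rewrite /= in_itv /=; apply/andP; split; lra.
  by move=> /andP[h1 h2]; exists y => //; rewrite ltr_norml; apply/andP; split; lra.
have cd1 x : 1 <= cderiv f x by have [t ->] := cpi_surj x; rewrite dfE.
pose u x := ln (cderiv f x).
have u0 x : 0 <= u x by exact: ln_ge0.
have mu_ : measurable_fun [set: cborel R] (u : cborel R -> R).
  apply: circle_fun_measurable => x; apply: continuous_comp; first exact: dfc.
  by apply: continuous_ln; exact: lt_le_trans ltr01 (cd1 x).
pose A := orbit_average T (log_deriv dT) m.+1 p.
(* The potential plus a penalty for being far from the orbit. Both are nonnegative since f' >= 1, so
   their integrals add up in the extended reals. *)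
pose psi x : R := u x + c * \1_(~` Near) x.
have mI : measurable_fun [set: cborel R] (fun x : cborel R => c * \1_(~` Near) x : R).
  by apply: measurable_funM => //; exact: measurable_indic.
have I0 x : 0 <= c * \1_(~` Near) x :> R by apply: mulr_ge0; [exact: ltW|rewrite indicE].
have psi0 x : 0 <= psi x by apply: addr_ge0; [exact: u0|exact: I0].
have mpsi : measurable_fun [set: cborel R] (psi : cborel R -> R).
  exact: measurable_funD.
have psiS N x : \sum_(i < N) psi (iter i f x) <= N%:R * A + C.
  have [t ->] := cpi_surj x; apply: le_trans (bound N t).
  rewrite /birkhoff big_split /= mulr_sumr; apply: lerD; apply: ler_sum => i _; rewrite fTi.
    by rewrite /u dfE.
  rewrite /far_indic indicE; apply: ler_wpM2l; first exact: ltW.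
  rewrite le_eqVlt; apply/orP; left; apply/eqP; congr (nat_of_bool _)%:R.
  apply/idP/idP => [/set_mem h|/asboolP h]; [apply/asboolP|apply/mem_set] => h';
  by apply: h; exact/NearE.
(* The constant C is lost in the average, while mass far from the orbit is charged at rate c. *)
have key nu : Defs.invariant f nu -> (lyapunov f nu + c%:E * nu (~` Near) <= A%:E)%E.
  move=> inv; have := integral_le_average mf inv mpsi psi0 psiS.
  rewrite /psi; under eq_integral do rewrite EFinD.
  have u0' (x : cborel R) : setT x -> (0 <= (u x)%:E)%E by rewrite lee_fin.
  have I0' (x : cborel R) : setT x -> (0 <= (c * \1_(~` Near) x)%:E)%E by rewrite lee_fin.
  have mu' : measurable_fun [set: cborel R] (fun x : cborel R => (u x)%:E) by exact/measurable_EFinP.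
  have mI' : measurable_fun [set: cborel R] (fun x : cborel R => (c * \1_(~` Near) x)%:E).
    exact/measurable_EFinP.
  have mF' : measurable_fun [set: cborel R] (fun x : cborel R => (\1_(~` Near) x : R)%:E).
    by apply/measurable_EFinP; exact: measurable_indic.
  rewrite ge0_integralD//.
  under [X in (_ + X <= _)%E -> _]eq_integral do rewrite EFinM.
  by rewrite ge0_integralZl// ?lee_fin ?(ltW c0)// integral_indic// setIT.
have lmu : lyapunov f mu = A%:E.
  rewrite /lyapunov (@integral_orbit_measure _ (cborel R) R f x0 m u mu_ u0).
  congr (_ / _)%:E; apply: eq_bigr => i _.
  by rewrite fTi /u dfE.
have minv : Defs.invariant f mu by move=> B _; exact: (@orbit_measure_inv _ (cborel R) R f x0 m fper B).
have muO : mu O = 1%E.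
  rewrite -(orbit_measure_setT R (f : cborel R -> cborel R) x0 m).
  rewrite /mu /= !orbit_measureE; congr (_ * _)%E; apply: eq_bigr => i _.
  by rewrite !indicE in_setT mem_set//; exists i.
have unique nu : Defs.invariant f nu -> nu O = 1%E -> same_measure nu mu.
  by move=> inv nuO; exact: (@orbit_measure_unique _ (cborel R) R f x0 m fper nu mf inv mO nuO).
have max_mu : maximizing f mu.
  split => // nu inv; rewrite lmu; apply: le_trans (key nu inv).
  by rewrite leeDl// mule_ge0// lee_fin ltW.
have suppE : supp mu = O.
  apply/seteqP; split => x.
    move=> h; apply: contrapT => nO; have := h _ (closed_openC cO) nO.
    by rewrite probability_setC// muO subee// ltxx.
  move=> [i _ <-] U oU Ui.
  have fi : (i = i %/ m.+1 * m.+1 + i %% m.+1)%N := divn_eq i m.+1.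
  have im : (i %% m.+1 < m.+1)%N by rewrite ltn_mod.
  have ie : iter i f x0 = iter (i %% m.+1) f x0.
    rewrite {1}fi; elim: (i %/ m.+1)%N => [//|q IH].
    by rewrite mulSn -addnA addnC iterD fper IH.
  rewrite ie in Ui; rewrite /mu /= orbit_measureE; apply: mule_gt0; first by rewrite lte_fin invr_gt0 ltr0n.
  rewrite (bigD1 (Ordinal im))//= indicE mem_set//.
  apply: (@lt_le_trans _ _ 1%E); first by rewrite lte_fin.
  by rewrite leeDl// sume_ge0// => j _; rewrite lee_fin indicE.
exists mu; split => //.
  move=> nu [inv mx]; apply: unique => //.
  have far0 : nu (~` Near) = 0%E.
    have h1 := mx _ minv; rewrite lmu in h1.
    have h2 := key nu inv.
    have h3 : (A%:E + c%:E * nu (~` Near) <= A%:E)%E.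
      by apply: le_trans h2; rewrite leeD2r.
    rewrite -[leRHS]adde0 leeD2lE// pmule_rle0 ?lte_fin// in h3.
    by apply/eqP; rewrite eq_le h3 measure_ge0.
  have nuOC : nu (~` O) = 0%E.
    (* A point off the orbit is far at some time; the countably many preimages of the far set are
       null by invariance. *)
    have sub : ~` O `<=` \bigcup_k (iter k f @^-1` (~` Near)).
      move=> x nO; apply: contrapT => h; apply: nO.
      have [t xt] := cpi_surj x; rewrite xt; apply/OE; apply: expa => k.
      apply/NearE; apply: contrapT => nk; apply: h; exists k => //=.
      by rewrite xt fTi.
    have [B [mB B0 sB]] : nu.-negligible (\bigcup_k (iter k f @^-1` (~` Near)) : set (cborel R)).
      apply: negligible_bigcup => k; exists (iter k f @^-1` (~` Near)); split => //.
        by rewrite -[X in measurable X]setTI; exact: (measurable_iter mf).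
      by apply: etrans far0; exact: (@measure_preimage_iter _ (cborel R) R nu f mf inv).
    apply: (@subset_measure0 _ _ _ nu _ B) => //; first exact: measurableC.
    exact: subset_trans sB.
  have mOC : measurable (~` O : set (cborel R)) by exact: measurableC.
  by rewrite -(setCK O) (probability_setC nu mOC) nuOC sube0.
(* As the support is the orbit itself, unique ergodicity is the uniqueness already obtained on
   [O]. *)
rewrite suppE; split => //.
  by move=> _ [_ [i _ <-] <-]; exists i.+1.
by exists mu; split.
Qed.

(** * Generic maps *)

Section Assembly.
Variables (R : realType) (alpha lam : R).
Hypothesis alpha_gt0 : 0 < alpha.
Hypothesis lam_gt1 : 1 < lam.
Implicit Types f g : expanding_map alpha lam.

Definition has_unique_maximizing f := exists mu : probability (cborel R) R,
  [/\ maximizing (emap f) mu,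
      (forall nu : probability (cborel R) R, maximizing (emap f) nu -> same_measure nu mu) &
      uniquely_ergodic (emap f) (supp mu)].

Lemma emap_spec f : is_expanding_map alpha lam (emap f).
Proof. exact: set_mem (valP f). Qed.

Lemma locked_has_unique_maximizing f (T dT : R -> R) : is_lift (emap f) T ->
  (forall t, cderiv (emap f) (cpi t) = dT t) -> locked T dT -> has_unique_maximizing f.
Proof.
have [[[_ cd] _] [cf _] _ gt] := emap_spec f.
move=> fT dE; apply: locked_unique_maximizing => // t.
by rewrite -dE ltW// (lt_trans lam_gt1).
Qed.

Lemma ball_lift f g e (F dF : R -> R) : is_lift (emap f) F ->
  (forall t : R, is_derive t (1 : R) F (dF t)) -> C1alpha_ball f e g ->
  exists psi dpsi : R -> R,
  [/\ is_lift (emap g) (fun t => F t + psi t) /\ (forall t, cderiv (emap g) (cpi t) = dF t + dpsi t),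
    (forall t : R, is_derive t (1 : R) psi (dpsi t)),
    (forall t, psi (t + 1) = psi t) /\ (forall t, dpsi (t + 1) = dpsi t),
    (forall t, `|psi t| <= e) /\ (forall t, `|dpsi t| <= e) &
    forall s t, `|dpsi s - dpsi t| <= e * `|s - t| `^ alpha].
Proof.
move=> fF hF [phi [phiC small gE]]; have [s1 s2 s3] := norm_C1alpha_lt alpha_gt0 small.
have hd := C1_fun_lift phiC.
have gG : is_lift (emap g) (fun t => F t + phi (cpi t)).
  by move=> t; rewrite gE fF -cpiD.
exists (phi \o @cpi R), (rderiv phi \o @cpi R); split => //.
- split => // t; rewrite /cderiv derive1E.
  by have [_ ->] := cderiv_lift gG (is_deriveD (hF t) (hd t)).
- by split => t /=; rewrite (cpi_int t 1).
- by split => t /=.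
Qed.

(** A small periodic perturbation of the lift descends to a map of the same class; the factor 3
    stands for the three suprema in the norm. *)
Lemma ball_of_lift f (F dF h dh : R -> R) Lam H eps : is_lift (emap f) F ->
  circle_lift alpha lam Lam H F dF -> 0 < eps -> (forall t : R, is_derive t (1 : R) h (dh t)) ->
  (forall t, h (t + 1) = h t) -> (forall t, dh (t + 1) = dh t) ->
  (forall t, `|h t| <= eps) -> (forall t, `|dh t| <= eps) ->
  (forall s t, `|dh s - dh t| <= eps * `|s - t| `^ alpha) -> (forall t, lam < dF t + dh t) ->
  exists g, is_lift (emap g) (fun t => F t + h t) /\ forall e, 3 * eps < e -> C1alpha_ball f e g.
Proof.
move=> fF FL e0 hd hp dhp hb dhb hh gt.
have H0 := lift_H_ge0 FL.
pose phi (x : circle R) := h (cval x).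
have hphi t : phi (cpi t) = h t.
  by rewrite /phi; have /cpi_eqP[a ->] := cvalK (cpi t); exact: periodic_int.
pose gm x := emap f x + cpi (phi x).
have gG : is_lift gm (fun t => F t + h t) by move=> t; rewrite /gm hphi fF cpiD.
have GL : circle_lift alpha lam (Lam + eps) (H + eps) (fun t => F t + h t) (fun t => dF t + dh t).
  split.
  - by move=> t; exact: is_deriveD (lift_derive FL t) (hd t).
  - by move=> t; rewrite (lift_deg2 FL) hp; ring.
  - by move=> t; rewrite (lift_dper FL) dhp.
  - exact: gt.
  - by move=> t; apply: lerD; [exact: (lift_le FL)|exact: le_trans (ler_norm _) (dhb t)].
  - move=> s t; have -> : dF s + dh s - (dF t + dh t) = (dF s - dF t) + (dh s - dh t) by ring.
    by apply: le_trans (ler_normD _ _) _; rewrite mulrDl lerD// (lift_hold FL).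
have He0 : 0 <= H + eps by apply: addr_ge0 => //; exact: ltW.
have dhc := hold_continuous alpha_gt0 (ltW e0) hh.
have dGc := hold_continuous alpha_gt0 He0 (lift_hold GL).
have [gC1 gE] := C1_map_lift gG (lift_derive GL) dGc.
have gP : is_expanding_map alpha lam gm.
  split; first split => //.
  - apply: (@le_lt_trans _ _ (H + eps)%:E); last by rewrite ltry.
    by apply: le_Hold => // s t; rewrite !gE; exact: (lift_hold GL).
  - apply: (lift_covering gG lam_gt1 (lift_cont GL)); last exact: (lift_deg2 GL).
    by move=> x y; exact: (lift_exp GL).
  - by move=> x; have [t ->] := cpi_surj x; rewrite gE; apply: lt_trans (gt t); exact: lt_trans lam_gt1.
  - by move=> x; have [t ->] := cpi_surj x; rewrite gE.
exists (SigSub (mem_set gP) : expanding_map alpha lam); split => // e he.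
have [phiC phiE] := lift_C1_fun hphi hd dhc.
exists phi; split => //; apply: le_lt_trans (_ : (_ <= (3 * eps)%:E)%E) _; last by rewrite lte_fin.
apply: norm_C1alpha_le => //.
- by move=> x; have [t ->] := cpi_surj x; rewrite hphi.
- by move=> x; have [t ->] := cpi_surj x; rewrite phiE.
- by move=> s t; rewrite !phiE.
Qed.

Lemma ball_center f e : 0 < e -> C1alpha_ball f e f.
Proof.
move=> e0.
have hd (t : R) : is_derive t (1 : R) (fun=> 0 : R) 0 by exact: is_derive_cst.
have [zC zE] := @lift_C1_fun R (fun=> 0) (fun=> 0) (fun=> 0) (fun=> erefl) hd (fun=> cvg_cst _).
exists (fun=> 0); split => //; last by move=> x; rewrite cpi0 addr0.
apply: le_lt_trans (_ : (_ <= (3 * 0)%:E)%E) _; last by rewrite lte_fin mulr0.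
apply: norm_C1alpha_le => //.
- by move=> x; rewrite normr0.
- by move=> x; have [t ->] := cpi_surj x; rewrite zE normr0.
- by move=> s t; rewrite !zE subrr normr0 mul0r.
Qed.

(* The C^{1+alpha} norm being a sum of three suprema, this crude form of the
   triangle inequality is read off componentwise. *)
Lemma ball_ball f g h d e : 6 * d < e -> C1alpha_ball f d g -> C1alpha_ball g d h ->
  C1alpha_ball f e h.
Proof.
move=> de [u [uC us gE]] [v [vC vs hE]].
have [u1 u2 u3] := norm_C1alpha_lt alpha_gt0 us; have [v1 v2 v3] := norm_C1alpha_lt alpha_gt0 vs.
pose w x := u x + v x.
have wd (t : R) : is_derive t (1 : R) (fun t => u (cpi t) + v (cpi t)) (rderiv u (cpi t) + rderiv v (cpi t)).
  exact: is_deriveD (C1_fun_lift uC t) (C1_fun_lift vC t).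
have wc : continuous (fun t => rderiv u (cpi t) + rderiv v (cpi t)).
  move=> t; apply: cvgD; apply: continuous_comp; try exact: cpi_continuous.
    by have [_ c] := uC; exact: c.
  by have [_ c] := vC; exact: c.
have [wC wE] := @lift_C1_fun R w _ _ (fun=> erefl) wd wc.
exists w; split => //; last by move=> x; rewrite hE gE cpiD addrA.
apply: le_lt_trans (_ : (_ <= (3 * (d + d))%:E)%E) _; last by rewrite lte_fin; lra.
apply: norm_C1alpha_le => //.
- by move=> x; apply: le_trans (ler_normD _ _) _; exact: lerD.
- by move=> x; have [t ->] := cpi_surj x; rewrite wE; apply: le_trans (ler_normD _ _) _; exact: lerD.
- move=> s t; rewrite !wE.
  have -> : forall a b c d : R, a + b - (c + d) = (a - c) + (b - d) by move=> *; ring.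
  by apply: le_trans (ler_normD _ _) _; rewrite mulrDl; exact: lerD.
Qed.

(** Asking for the property on a whole ball makes the set open by the triangle inequality alone. *)
Definition stably_unique : set (expanding_map alpha lam) :=
  [set f | exists2 e, 0 < e & C1alpha_ball f e `<=` has_unique_maximizing].

Lemma stably_unique_open : open stably_unique.
Proof.
(* Two steps of size e / 12 stay within e, as 6 (e / 12) < e in [ball_ball]. *)
move=> f [e e0 sub]; exists (e / 12) => [|g fg]; first by rewrite divr_gt0.
exists (e / 12) => [|h gh]; first by rewrite divr_gt0.
by apply: sub; apply: ball_ball fg gh; lra.
Qed.

Lemma stably_unique_dense : alpha <= 1 -> dense stably_unique.
Proof.
move=> alpha_le1 W [f Wf] oW.
have [e e0 sub] : exists2 e, 0 < e & C1alpha_ball f e `<=` W by exact: oW.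
have [F [Lam [H [lam1 [fF FL H0 l1 dF1]]]]] := expanding_lift alpha_gt0 lam_gt1 (emap_spec f).
(* With the factor 3 of [ball_of_lift], a perturbation of size e / 6 stays in the ball of radius
   e. *)
have e6 : 0 < e / 6 by rewrite divr_gt0.
have [h [dh [hd [hp dhp] [hb dhb] [hh gt] [r r0 lock]]]] :=
  perturb_locked alpha_gt0 alpha_le1 lam_gt1 FL l1 dF1 e6.
have [g [gG gB]] := ball_of_lift fF FL e6 hd hp dhp hb dhb hh gt.
exists g; split; first by apply: sub; apply: gB; lra.
have Gd (t : R) := is_deriveD (lift_derive FL t) (hd t).
exists r => // k gk; have [psi [dpsi [[kK kE] pd [pp dpp] [pb dpb] ph]]] := ball_lift gG Gd gk.
apply: (locked_has_unique_maximizing kK kE); apply: lock => // t.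
by rewrite -kE; have [_ _ _] := emap_spec k; apply.
Qed.

End Assembly.

Theorem theoremA1 (R : realType) (alpha lambda : R) (alpha_gt0 : 0 < alpha)
    (alpha_le1 : alpha <= 1) (lambda_gt1 : 1 < lambda) :
  generic [set f : expanding_map alpha lambda |
    exists mu : probability (cborel R) R,
      [/\ maximizing (emap f) mu,
          (forall nu : probability (cborel R) R,
             maximizing (emap f) nu -> same_measure nu mu) &
          uniquely_ergodic (emap f) (supp mu)]].
Proof.
(* A single open dense set suffices, taken as a constant sequence. *)
exists (fun=> @stably_unique R alpha lambda); split.
  by move=> _; split; [exact: stably_unique_open|exact: stably_unique_dense].
move=> f /(_ 0%N I) [e e0 sub]; apply: sub; exact: ball_center.
Qed.
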